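(* Let $k$ be an algebraically closed field, $R=k[x,y,z]$ the standard graded polynomial ring, and $f\in R$ a reduced form of degree $d+1$ with $d\ge 1$, where $\operatorname{char}(k)$ does not divide $d+1$. Let $\epsilon\in\operatorname{Syz}(J_f)$ be a minimal homogeneous generator of (standard) degree $e\geq 1$, and let $M_\epsilon:=\operatorname{Syz}(J_f)/R\epsilon$ be the cokernel of the homogeneous injection $R(-e)\stackrel{\epsilon}{\longrightarrow}\operatorname{Syz}(J_f)$, with canonical surjection $u:\operatorname{Syz}(J_f)\to M_\epsilon$. Then the following hold. (a) $M_\epsilon$ is a free $R$-module if and only if $f$ is a free divisor. In this case, $\deg(R/J_f)=d^2+e(e-d)$. (b) If $f$ is not a free divisor, $M_\epsilon$ is isomorphic to a proper homogeneous ideal $I_\epsilon\subset R$ of codimension two, such that the induced isomorphism $M_\epsilon\simeq I_\epsilon(e-d)$ is homogeneous of degree zero. In addition, for such an ideal $I_\epsilon$ one has $$\deg(R/I_\epsilon)=\begin{cases} d^2+e(e-d)-\deg(R/J_f) & \text{if } V(f) \text{ is singular},\\ d^2+e(e-d) & \text{if } V(f)\text{ is smooth}.\end{cases}$$ (c) If $f$ is not a free divisor, pick a complete set of minimal homogeneous generators of the $R$-module $\operatorname{Syz}(J_f)$ that includes $\epsilon$, and let $$0\to F_1\xrightarrow{\left[\begin{smallmatrix}\lambda\\ \psi\end{smallmatrix}\right]} R(-e)\oplus F_0\xrightarrow{(\epsilon,\phi)}\operatorname{Syz}(J_f)\to 0$$ denote a minimal graded free resolution based on these generators, with $F_0,F_1$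 graded free $R$-modules. Then a minimal graded free resolution of $I_\epsilon$ is $$0\to F_1(d-e)\xrightarrow{\ \psi\ } F_0(d-e)\xrightarrow{\ u\circ\phi\ } I_\epsilon\to 0,$$ where $M_\epsilon$ is identified with $I_\epsilon(e-d)$. In particular, $I_\epsilon$ is a codimension $2$ perfect ideal.
   Context: $f_x,f_y,f_z$ are the partial derivatives of $f$ and $J_f=(f_x,f_y,f_z)\subset R$ is the gradient ideal. $\operatorname{Syz}(J_f)=\{(a,b,c)\in R^3: af_x+bf_y+cf_z=0\}$ is the graded module of first syzygies of $f_x,f_y,f_z$, graded as a submodule of $R^3$ (so a syzygy has degree $e$ if its coordinates are forms of degree $e$). The form $f$ (or the curve $X=V(f)\subset\mathbb P^2_k$) is called a free divisor if $\operatorname{Syz}(J_f)$ is a free $R$-module (equivalently, the module of logarithmic derivations $\{\delta\in\operatorname{Der}_k(R):\delta(f)\in(f)\}=\operatorname{Syz}(J_f)\oplus R(x\partial_x+y\partial_y+z\partial_z)$ is free). For a homogeneous ideal $I$, $\deg(R/I)$ is the algebraic multiplicity of $R/I$. A homogeneous ideal $I$ is perfect if $R/I$ is Cohen–Macaulay, i.e. the projective dimension of $R/I$ equals the codimension of $I$. *)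

(* Defs.v *)
From HB Require Import structures.
From mathcomp Require Import all_boot all_order all_algebra.
From mathcomp Require Import boolp.
From mathcomp Require Import mpoly.

Set Implicit Arguments.
Unset Strict Implicit.
Unset Printing Implicit Defensive.

Import GRing.Theory.

Local Open Scope ring_scope.
Local Open Scope quotient_scope.

Section QuotientModule.

Variables (R : comNzRingType) (V : lmodType R) (N : submodClosed V).

(* Submodules of V are not [zmodClosed] in the library's hierarchy, but
   [Quotient.quot] expects one. *)
Definition zmod_of_submod : {pred V} := N.

Fact zmod_of_submod_closed : zmod_closed zmod_of_submod.
Proof.
split=> [|x y xN yN]; first exact: (@rpred0 V N).
by rewrite -scaleN1r; apply: (@rpredD V N) => //; apply: (@rpredZ R V N).
Qed.

HB.instance Definition _ :=
  GRing.isZmodClosed.Build V zmod_of_submod zmod_of_submod_closed.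

Definition lquot : Type := Quotient.quot zmod_of_submod.

HB.instance Definition _ := GRing.Zmodule.on lquot.

Definition lproj (x : V) : lquot := \pi_(Quotient.quot zmod_of_submod) x.

Fact lproj_eq (x y : V) : lproj x = lproj y <-> x - y \in N.
Proof.
rewrite /lproj; split=> [/eqP|xyN].
  by rewrite -Quotient.idealrBE.
by apply/eqP; rewrite -Quotient.idealrBE.
Qed.

Fact lproj_surj (q : lquot) : exists x, lproj x = q.
Proof. by exists (repr q); rewrite /lproj reprK. Qed.

Definition lquot_scale (a : R) (q : lquot) : lquot :=
  lproj (a *: repr (q : Quotient.quot zmod_of_submod)).

Fact lproj_scale a x : lquot_scale a (lproj x) = lproj (a *: x).
Proof.
apply/lproj_eq; rewrite -scalerBr; apply: rpredZ; apply/lproj_eq.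
by rewrite /lproj reprK.
Qed.

Fact lproj_add x y : lproj x + lproj y = lproj (x + y).
Proof. by rewrite /lproj Quotient.pi_add. Qed.

Fact lquot_scaleA a b q :
  lquot_scale a (lquot_scale b q) = lquot_scale (a * b) q.
Proof. by have [x <-] := lproj_surj q; rewrite !lproj_scale scalerA. Qed.

Fact lquot_scale1 : left_id 1 lquot_scale.
Proof. by move=> q; have [x <-] := lproj_surj q; rewrite lproj_scale scale1r. Qed.

Fact lquot_scaleDr : right_distributive lquot_scale +%R.
Proof.
move=> a p q; have [x <-] := lproj_surj p; have [y <-] := lproj_surj q.
by rewrite lproj_add !lproj_scale lproj_add scalerDr.
Qed.

Fact lquot_scaleDl q : {morph lquot_scale^~ q : a b / a + b}.
Proof.
move=> a b; have [x <-] := lproj_surj q.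
by rewrite !lproj_scale lproj_add scalerDl.
Qed.

HB.instance Definition _ := GRing.Zmodule_isLmodule.Build R lquot
  lquot_scaleA lquot_scale1 lquot_scaleDr lquot_scaleDl.

Fact lproj_linear : linear lproj.
Proof. by move=> a x y; rewrite -lproj_add -lproj_scale. Qed.

HB.instance Definition _ :=
  GRing.isLinear.Build R V lquot _ lproj lproj_linear.

End QuotientModule.

Section CyclicSubmodule.

Variables (R : comNzRingType) (V : lmodType R) (x : V).

Definition cyclic_submod : {pred V} :=
  [pred y | `[< exists r : R, y = r *: x >]].

Fact cyclic_submod_closed : submod_closed cyclic_submod.
Proof.
split=> [|a u v]; first by apply/asboolP; exists 0; rewrite scale0r.
move=> /asboolP[r ->] /asboolP[s ->]; apply/asboolP; exists (a * r + s).
by rewrite scalerA scalerDl.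
Qed.

HB.instance Definition _ :=
  GRing.isSubmodClosed.Build R V cyclic_submod cyclic_submod_closed.

End CyclicSubmodule.

Section IdealSubmodule.

Variables (R : comNzRingType) (I : idealr R).

Definition ideal_submod : {pred R^o} := (I : {pred R}).

Fact ideal_submod_closed : submod_closed ideal_submod.
Proof.
split=> [|a u v uI vI]; first exact: (@rpred0 R I).
by apply: (@rpredD R I) => //; apply: (@idealMr R I).
Qed.

HB.instance Definition _ :=
  GRing.isSubmodClosed.Build R R^o ideal_submod ideal_submod_closed.

End IdealSubmodule.

Section ModuleNotions.

Variable R : comNzRingType.

Definition lincomb (M : lmodType R) n (g : 'I_n -> M) (v : 'rV[R]_n) : M :=
  \sum_i v 0 i *: g i.

Definition generates (M : lmodType R) n (g : 'I_n -> M) : Prop :=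
  forall x, exists v, x = lincomb g v.

(* [B] is a basis, possibly infinite. *)
Definition is_basis (M : lmodType R) (B : M -> Prop) : Prop :=
  (forall x, exists n (b : 'I_n -> M) (v : 'rV[R]_n),
     (forall i, B (b i)) /\ x = lincomb b v) /\
  (forall n (b : 'I_n -> M) (v : 'rV[R]_n),
     (forall i, B (b i)) -> injective b -> lincomb b v = 0 -> v = 0).

Definition free_module (M : lmodType R) : Prop := exists B, @is_basis M B.

Definition projective (P : lmodType R) : Prop :=
  forall (A B : lmodType R) (g : {linear A -> B}) (h : {linear P -> B}),
    (forall b, exists a, g a = b) ->
    exists h' : {linear P -> A}, forall x, g (h' x) = h x.

Definition pd_le (M : lmodType R) (n : nat) : Prop :=
  exists (P : nat -> lmodType R) (D : forall i, {linear P i.+1 -> P i})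
         (aug : {linear P 0 -> M}),
  [/\ forall i, projective (P i),
      forall x, exists y, aug y = x,
      forall x, aug x = 0 <-> exists y, D 0 y = x,
      forall i x, D i x = 0 <-> exists y, D i.+1 y = x
    & forall i, (n < i)%N -> forall x : P i, x = 0].

Definition has_pd (M : lmodType R) (n : nat) : Prop :=
  pd_le M n /\ forall m, (m < n)%N -> ~ pd_le M m.

(* There is a strict chain P_0 < ... < P_n = P of primes, i.e. ht P >= n.
   The library's prime ideals are proper by definition. *)
Definition height_ge (P : prime_idealr R) (n : nat) : Prop :=
  exists Q : nat -> prime_idealr R,
    (Q n : {pred R}) =i P /\
    forall i, (i < n)%N ->
      {subset Q i <= Q i.+1} /\ ~ {subset Q i.+1 <= Q i}.

(* codim I = min { ht P | P prime, P contains I } *)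
Definition has_codim (I : {pred R}) (n : nat) : Prop :=
  (forall P : prime_idealr R, {subset I <= P} -> height_ge P n) /\
  (exists P : prime_idealr R, {subset I <= P} /\ ~ height_ge P n.+1).

Definition perfect_ideal (I : idealr R) : Prop :=
  exists n, has_codim I n /\ has_pd (lquot (ideal_submod I)) n.

End ModuleNotions.

(* [G j x] reads: x is homogeneous of degree j. *)
Definition grading (M : Type) := int -> M -> Prop.

(* M(s)_j = M_(s + j) *)
Definition gshift (M : Type) (G : grading M) (s : int) : grading M :=
  fun j => G (s + j).

Definition graded_map (M N : Type) (G : grading M) (H : grading N)
  (phi : M -> N) : Prop := forall j x, G j x -> H j (phi x).

Section Graded.

Variable k : closedFieldType.

Local Notation R := {mpoly k[3]}.

Definition grad_poly : grading R := fun j p =>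
  match j with Posz n => p \is n.-homog | Negz _ => p = 0 end.

(* The free module R(-a_1) + ... + R(-a_n): the i-th basis vector has
   degree a_i.  Consequently its shift by s is [grad_free (a - const_mx s)]. *)
Definition grad_free n (a : 'rV[int]_n) : grading 'rV[R]_n :=
  fun j v => forall i, grad_poly (j - a 0 i) (v 0 i).

Definition grad_quot (V : lmodType R) (G : grading V) (N : submodClosed V) :
  grading (lquot N) := fun j q => exists x, G j x /\ lproj N x = q.

Arguments grad_quot {V} G N j q.

Definition homogeneous_ideal (I : {pred R}) : Prop :=
  forall p n, p \in I -> pihomog mdeg n p \in I.

(* In the graded setting an irredundant system of homogeneous generators has
   the least possible number of elements. *)
Definition minimal_hom_generators (M : lmodType R) (G : grading M) n
  (g : 'I_n -> M) : Prop :=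
  [/\ forall i, exists j, G j (g i),
      generates g
    & forall i, ~ forall x, exists v : 'rV[R]_n, v 0 i = 0 /\ x = lincomb g v].

Definition minimal_hom_generator (M : lmodType R) (G : grading M) (x : M) :=
  exists n (g : 'I_n -> M), minimal_hom_generators G g /\ exists i, g i = x.

Definition cons_fam (T : Type) (x : T) m (g : 'I_m -> T) (i : 'I_(1 + m)) : T :=
  match split i with inl _ => x | inr j => g j end.

(* 0 -> F_1 --A--> F_0 --g--> N -> 0 is a minimal graded free resolution of the
   submodule N of V, where F_1 = \bigoplus R(-b_i) and F_0 = \bigoplus R(-a_i);
   vectors are rows and A acts on the right.  The last clause is minimality:
   the image of F_1 is contained in (x, y, z) F_0. *)
Definition minimal_free_res (V : lmodType R) (G : grading V) (N : {pred V})
  n m (b : 'rV[int]_n) (a : 'rV[int]_m) (A : 'M[R]_(n, m)) (g : 'I_m -> V) :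
  Prop :=
  [/\ graded_map (grad_free b) (grad_free a) (mulmxr A) /\
      graded_map (grad_free a) G (lincomb g),
      injective (fun v : 'rV[R]_n => v *m A),
      forall v : 'rV[R]_m, lincomb g v = 0 <-> exists w, w *m A = v,
      forall x, x \in N <-> exists v, lincomb g v = x
    & forall i j, (A i j)@_0%MM = 0].

(* [h] is the dimension of the degree t part of R/I, for a homogeneous I. *)
Definition hilbert_value (I : {pred R}) (t h : nat) : Prop :=
  exists U : {vspace dhomog 3 k t},
    (forall p : dhomog 3 k t, p \in U <-> (p : R) \in I) /\
    h = (\dim {:dhomog 3 k t} - \dim U)%N.

(* deg(R/I) for homogeneous I, as D! times the leading coefficient of the
   polynomial of degree D = dim R/I giving the length of R/(I + m^(n+1)) for
   large n.  This is (D-1)! times the leading coefficient of the Hilbert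
   polynomial if D > 0, and the length of R/I if D = 0. *)
Definition has_mult (I : {pred R}) (m : nat) : Prop :=
  exists h : nat -> nat, (forall t, hilbert_value I t (h t)) /\
  exists P : {poly rat},
    (exists N, forall n, (N <= n)%N ->
       (\sum_(t < n.+1) h t)%N%:R = P.[n%:R]) /\
    m%:R = lead_coef P * ((size P).-1)`!%:R.

(* R/(f) has no nonzero nilpotent. *)
Definition reduced (f : R) : Prop :=
  forall (g : R) n, (exists h, g ^+ n = h * f) -> exists h, g = h * f.

(* A point of P^2 where f and its partial derivatives vanish. *)
Definition singular_curve (f : R) : Prop :=
  exists v : 'I_3 -> k,
    [/\ exists i, v i != 0, f.@[v] = 0 & forall i, (f^`M(i)).@[v] = 0].

Definition gradient_ideal (f : R) : {pred R} :=
  [pred p | `[< exists c : 'I_3 -> R, p = \sum_i c i * f^`M(i) >]].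

Definition syz_pred (f : R) : {pred 'rV[R]_3} :=
  [pred s : 'rV[R]_3 | \sum_i s 0 i * f^`M(i) == 0].

Fact syz_closed f : submod_closed (syz_pred f).
Proof.
split=> [|a u v].
  by rewrite inE big1 // => i _; rewrite mxE mul0r.
rewrite !inE => /eqP u0 /eqP v0.
rewrite (eq_bigr (fun i => a * (u 0 i * f^`M(i)) + v 0 i * f^`M(i))).
  by rewrite big_split /= -mulr_sumr u0 v0 mulr0 addr0.
by move=> i _; rewrite !mxE mulrDl mulrA.
Qed.

HB.instance Definition _ f :=
  GRing.isSubmodClosed.Build R 'rV[R]_3 (syz_pred f) (syz_closed f).

Record syz (f : R) := Syz { syz_val :> 'rV[R]_3; _ : syz_val \in syz_pred f }.

HB.instance Definition _ f := [isSub for @syz_val f].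
HB.instance Definition _ f := [Choice of syz f by <:].
HB.instance Definition _ f := [SubChoice_isSubLmodule of syz f by <:].

Definition grad_syz (f : R) : grading (syz f) :=
  fun j s => forall i, grad_poly j (syz_val s 0 i).

Definition free_divisor (f : R) : Prop := free_module (syz f).

Definition Meps (f : R) (eps : syz f) : lmodType R :=
  lquot (cyclic_submod eps).

Definition grad_Meps (f : R) (eps : syz f) : grading (Meps eps) :=
  grad_quot (@grad_syz f) (cyclic_submod eps).

Definition ueps (f : R) (eps : syz f) : {linear syz f -> Meps eps} :=
  lproj (cyclic_submod eps).

(* [theta] identifies M_eps, through a degree zero isomorphism, with I(s) for
   the proper homogeneous ideal I of codimension two. *)
Definition codim2_ideal_model (f : R) (eps : syz f) (s : int) (I : idealr R)
  (theta : {linear Meps eps -> R^o}) : Prop :=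
  [/\ homogeneous_ideal I, has_codim I 2, injective theta,
      forall r : R, r \in (I : {pred R}) <-> exists x, theta x = r
    & graded_map (@grad_Meps f eps) (gshift grad_poly s) theta].

End Graded.

(* Main.v *)
Require Import Defs.
From HB Require Import structures.
From mathcomp Require Import all_boot all_algebra.
From mathcomp Require Import boolp ring zify.
From mathcomp Require Import mpoly.

Set Implicit Arguments.
Unset Strict Implicit.
Unset Printing Implicit Defensive.

Import GRing.Theory.

Local Open Scope ring_scope.

(**
Because f is reduced and char k does not divide deg f, Euler's formula shows
that the partial derivatives of f have no common factor, and minimality of eps
shows the same for its coordinates.  A syzygy s and eps are both orthogonal to
grad f, so eps x s = rho(s) grad f for a form rho(s); rho is linear of degree
e - d with kernel R eps, hence identifies M_eps with an ideal I, which contains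
the coordinates of eps and has depth at least two.  Every other model of M_eps
in codimension two is a scalar multiple of rho.

Dimension counts in 0 -> Syz -> R^3 -> J_f -> 0 and 0 -> R eps -> Syz -> I -> 0
give, for large t, the identity
  dim (R/J_f)_(t+d) + dim (R/I)_(t+e-d) = d^2 + e(e-d).
Both summands are bounded and eventually polynomial, hence constant.  A nonzero
constant forces a zero in the projective plane: of I, which then has
codimension two, or of J_f, which is a singular point.  If the constant of I
vanishes, depth two gives I = R, so that Syz = R eps + R s with rho(s) = 1 is
free.  Conversely minimal generators of Syz beyond eps map to generators of I;
if Syz or M_eps is free, these are independent, and an ideal without common
factor that is generated by independent elements is R.

The relations of a minimal system of generators form a free module because
the Koszul complex of (x, y, z) is exact and a graded submodule of R^n equal
to (x, y, z) times itself vanishes; deleting the column of eps yields the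
resolution of I.
*)

(** * Greatest common divisors and Gauss's lemma *)

(** The constant d^2 + e(e-d) comes from r(t) = (t+1)(t+2)/2. The two exact sequences leave r(t+d) +
    r(t+e-d) + r(t-e) - 3r(t); the shifts d, e-d, -e add up to zero, so only half the sum of their
    squares survives.

    Freeness is tested by arbitrary bases, possibly infinite and not homogeneous, whereas minimality
    concerns homogeneous generators. The bridge is a section of [lincomb g]: by minimality, the
    section applied to the generators gives a matrix that is the identity at the origin, so its
    determinant is nonzero and the generators are independent. The same device shows that R/I does
    not have projective dimension at most one.

    Codimension two also needs an upper bound on chains of primes. It is reduced to the fact that R
    has dimension at most three, which follows by counting monomials: four polynomials are
    algebraically dependent with an explicit bound on the exponents. *)

Definition rdvd (A : comNzRingType) (a b : A) := exists c, b = a * c.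

(** Greatest common divisor 1 in a form that needs no chosen gcd and serves directly for
    cancellation. With [a = 0] and [b = 1] it also excludes the zero family. *)
Definition coprime_family (A : comNzRingType) (I : Type) (v : I -> A) :=
  forall a b, (forall i, rdvd a (b * v i)) -> rdvd a b.

Definition coprime_pair (A : comNzRingType) (a b : A) :=
  forall c d, rdvd c (d * a) -> rdvd c (d * b) -> rdvd c d.

Definition gcd_domain (A : comNzRingType) :=
  forall a b : A, exists g a' b',
    [/\ a = g * a', b = g * b' & coprime_pair a' b'].

Section Divisibility.

Variable A : comNzRingType.
Implicit Types a b c : A.

Lemma rdvd_refl a : rdvd a a. Proof. by exists 1; rewrite mulr1. Qed.

Lemma rdvd0 a : rdvd a 0. Proof. by exists 0; rewrite mulr0. Qed.

Lemma rdvdD a b c : rdvd a b -> rdvd a c -> rdvd a (b + c).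
Proof. by move=> [x ->] [y ->]; exists (x + y); rewrite mulrDr. Qed.

Lemma rdvdB a b c : rdvd a b -> rdvd a c -> rdvd a (b - c).
Proof. by move=> [x ->] [y ->]; exists (x - y); rewrite mulrBr. Qed.

Lemma rdvd_mulr a b c : rdvd a b -> rdvd a (b * c).
Proof. by move=> [x ->]; exists (x * c); rewrite mulrA. Qed.

Lemma rdvd_mull a b c : rdvd a b -> rdvd a (c * b).
Proof. by rewrite mulrC; apply: rdvd_mulr. Qed.

Lemma rdvd_trans a b c : rdvd a b -> rdvd b c -> rdvd a c.
Proof. by move=> ab [x ->]; apply: rdvd_mulr. Qed.

Lemma coprime_family_neq0 (I : Type) (v : I -> A) :
  coprime_family v -> exists i, v i <> 0.
Proof.
move=> cv; apply/existsNP => v0.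
have [|c /eqP] := cv 0 1; last by rewrite mul0r oner_eq0.
by move=> i; rewrite v0 mulr0; apply: rdvd0.
Qed.

End Divisibility.

Section GcdDomain.

Variable A : idomainType.
Hypothesis gcdA : gcd_domain A.
Implicit Types a b c : A.

Lemma gcd_family n (v : 'I_n.+1 -> A) :
  exists g w, (forall i, v i = g * w i) /\ coprime_family w.
Proof.
elim: n v => [|n IHn] v.
  exists (v 0), (fun=> 1); split=> [i|a b h]; first by rewrite mulr1 ord1.
  by have := h 0; rewrite mulr1.
have [g [w [vE cw]]] := IHn (fun i => v (lift ord0 i)).
have [h [a [b [v0E gE cab]]]] := gcdA (v 0) g.
exists h, (fun i => if unlift ord0 i is Some j then b * w j else a).
split=> [i|c d H].
  by case: unliftP => [j ->|->] //; rewrite vE gE mulrA.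
apply: cab; first by have := H ord0; rewrite unlift_none.
by apply: cw => j; rewrite -mulrA; have := H (lift ord0 j); rewrite liftK.
Qed.

Implicit Types p q r : {poly A}.

Definition primitive p := coprime_family (fun i : nat => p`_i).
Definition coef_dvd a p := forall i, rdvd a p`_i.

Lemma coef_dvdP a p : coef_dvd a p <-> exists q, p = a *: q.
Proof.
split=> [|[q ->] i]; last by rewrite coefZ; exists q`_i.
move=> /choice [f fE]; exists (\poly_(i < size p) f i).
apply/polyP => i; rewrite coefZ coef_poly.
by case: ltnP => [_|/leq_sizeP/(_ i (leqnn i)) ->] //; rewrite mulr0.
Qed.

Lemma primitive_neq0 p : primitive p -> p != 0.
Proof. by move=> /coprime_family_neq0[i pi]; apply/eqP => p0; rewrite p0 coef0 in pi. Qed.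

Lemma primitive_dvd p a : primitive p -> coef_dvd a p -> rdvd a 1.
Proof. by move=> pp ap; apply: pp => i; rewrite mul1r. Qed.

Lemma content_decomp p : p != 0 ->
  exists2 c, c != 0 & exists2 q, p = c *: q & primitive q.
Proof.
move=> p0; case sp : (size p) => [|n].
  by move/eqP: sp; rewrite size_poly_eq0 (negbTE p0).
have [g [w [pE cw]]] := gcd_family (fun i : 'I_n.+1 => p`_i).
have pE' : p = g *: \poly_(i < n.+1) w (inord i).
  apply/polyP => i; rewrite coefZ coef_poly.
  case: ltnP => [lt_in|]; last by rewrite -sp mulr0 => /(nth_default _).
  by rewrite -pE inordK.
exists g; first by apply: contraNneq p0 => g0; rewrite pE' g0 scale0r.
exists (\poly_(i < n.+1) w (inord i)) => // a b h; apply: cw => i.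
by have := h i; rewrite coef_poly ltn_ord inord_val.
Qed.

(** The content of [p] divides [p], so it is a unit here, and a unit multiple of a primitive
    polynomial is primitive. *)
Lemma primitive_unit p : p != 0 ->
  (forall u, coef_dvd u p -> rdvd u 1) -> primitive p.
Proof.
move=> p0 h; have [c c0 [q pE pq]] := content_decomp p0.
have [|c' c1] := h c; first by move=> i; rewrite pE coefZ; exists q`_i.
move=> a b ab; apply: pq => i; have := ab i; rewrite pE coefZ => hd.
have ->: b * q`_i = b * (c * q`_i) * c' by rewrite -[LHS]mulr1 c1; ring.
exact: rdvd_mulr.
Qed.

Lemma coef_dvdB a p q : coef_dvd a p -> coef_dvd a q -> coef_dvd a (p - q).
Proof. by move=> ap aq i; rewrite coefB; apply: rdvdB. Qed.

Lemma coef_dvdD a p q : coef_dvd a p -> coef_dvd a q -> coef_dvd a (p + q).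
Proof. by move=> ap aq i; rewrite coefD; apply: rdvdD. Qed.

Lemma coef_dvdZ a b p : rdvd a b -> coef_dvd a (b *: p).
Proof. by move=> ab i; rewrite coefZ; apply: rdvd_mulr. Qed.

Lemma coef_dvdMr a p q : coef_dvd a p -> coef_dvd a (p * q).
Proof.
by move=> /coef_dvdP[r ->]; apply/coef_dvdP; exists (r * q); rewrite scalerAl.
Qed.

(* Peeling off leading terms reduces the primitivity of a product to
   polynomials of smaller degree. *)
Lemma primitiveM p q : primitive p -> primitive q -> primitive (p * q).
Proof.
have [n] := ubnP (size p + size q); elim: n p q => // n IHn p q sz pp pq.
have lead_split r : r != 0 -> exists2 r' : {poly A}, (size r' < size r)%N &
    r = r' + lead_coef r *: 'X^((size r).-1).
  move=> r0; exists (r - lead_coef r *: 'X^((size r).-1)); last by rewrite subrK.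
  rewrite [X in (_ < X)%N](polySpred r0) ltnS.
  apply/leq_sizeP => j; rewrite coefB coefZ coefXn leq_eqVlt => /orP[/eqP <-|].
    by rewrite eqxx mulr1 subrr.
  move=> lt; rewrite gtn_eqF // mulr0 subr0 nth_default //.
  by rewrite (polySpred r0).
(* Passing to the primitive part of [r] keeps the size, so the induction hypothesis covers its
   product with [s]; then [u] divides the content of [r]. *)
have half r (s : {poly A}) u : (size r + size s < n)%N -> primitive s ->
    coef_dvd u (r * s) -> coef_dvd u r.
  move=> szrs ps; have [->|r0] := eqVneq r 0; first by move=> _ i; rewrite coef0; apply: rdvd0.
  have [c c0 [r1 rE pr1]] := content_decomp r0 => urs.
  suff uc : rdvd u c by rewrite rE; apply: coef_dvdZ.
  have prs : primitive (r1 * s).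
    by apply: IHn => //; rewrite rE size_scale // in szrs.
  apply: prs => i; rewrite -coefZ scalerAl -rE; exact: urs.
(* Removing the leading term of [r], which is divisible by [u], leaves a smaller product still
   divisible by [u], where [half] applies. *)
have sub r (s : {poly A}) u : primitive r -> primitive s -> (size r + size s <= n)%N ->
    rdvd u (lead_coef r) -> coef_dvd u (r * s) -> rdvd u 1.
  move=> pr ps szrs ur urs; apply: (primitive_dvd pr).
  have [r' szr' rE] := lead_split _ (primitive_neq0 pr).
  rewrite rE; apply: coef_dvdD; last exact: coef_dvdZ.
  apply: (half _ s) => //; first by lia.
  have ->: r' * s = r * s - lead_coef r *: 'X^((size r).-1) * s.
    by rewrite [X in _ = X * s - _]rE mulrDl addrK.
  by apply: coef_dvdB => //; apply: coef_dvdMr; apply: coef_dvdZ.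
have p0 := primitive_neq0 pp; have q0 := primitive_neq0 pq.
apply: primitive_unit => [|u upq]; first by rewrite mulf_neq0.
(* Split [u] as [g * u'], where [g] divides the leading coefficient of [p] and [u'] is forced to
   divide that of [q]. Each factor is then a unit by [sub]. *)
have [g [u' [a [uE pE cua]]]] := gcdA u (lead_coef p).
have gpq : coef_dvd g (p * q).
  by move=> i; apply: rdvd_trans (upq i); exists u'.
have [g' g1] : rdvd g 1 by apply: (sub p q) => //; rewrite pE; exists a.
have u'lq : rdvd u' (lead_coef q).
  apply: cua; first by exists (lead_coef q); rewrite mulrC.
  have := upq (size (p * q)).-1; rewrite -lead_coefE lead_coefM pE uE => -[x xE]; exists x.
  have g0 : g != 0 by apply: contraTneq (oner_neq0 A) => g0; rewrite g1 g0 mul0r eqxx.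
  by apply: (mulfI g0); rewrite [RHS]mulrA -xE; ring.
have [u'' u1] : rdvd u' 1.
  apply: (sub q p) => //; first by rewrite addnC.
  by move=> i; rewrite mulrC; apply: rdvd_trans (upq i); exists g; rewrite mulrC.
by exists (g' * u''); rewrite uE mulrACA -g1 -u1 mulr1.
Qed.

Lemma coef_dvd_primitive p q a : primitive q -> coef_dvd a (p * q) -> coef_dvd a p.
Proof.
move=> pq; have [->|p0] := eqVneq p 0; first by move=> _ i; rewrite coef0; apply: rdvd0.
have [c c0 [p1 pE pp1]] := content_decomp p0 => h.
rewrite pE; apply: coef_dvdZ; apply: (primitiveM pp1 pq) => i.
by rewrite -coefZ scalerAl -pE.
Qed.

Lemma primitive_factor p q : primitive (p * q) -> primitive p.
Proof.
move=> ppq a b h; apply: ppq => i; rewrite -coefZ scalerAl.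
by apply: coef_dvdMr => j; rewrite coefZ.
Qed.

(** Pseudo-division gives divisibility only up to a constant [c]. For a primitive divisor the
    constant can be removed: [c] divides [r * q], hence [r]. *)
Lemma primitive_cancel c p q r : c != 0 -> primitive q ->
  c *: p = r * q -> exists p', p = p' * q.
Proof.
move=> c0 pq E; have /coef_dvdP[r' rE] : coef_dvd c r.
  by apply: (coef_dvd_primitive pq); apply/coef_dvdP; exists p.
exists r'; apply: (@mulfI _ c%:P); first by rewrite polyC_eq0.
by rewrite !mul_polyC E rE scalerAl.
Qed.

(** The gcd is the gcd of the contents times the primitive part [H] of [gcdp]. Coprimality of the
    cofactors is checked separately for the primitive part and the content of a divisor. *)
Lemma gcd_domain_poly : gcd_domain {poly A}.
Proof.
move=> p q.
have [->|p0] := eqVneq p 0.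
  exists q, 0, 1; split; rewrite ?mulr0 ?mulr1 // => c d _.
  by rewrite mulr1.
have [->|q0] := eqVneq q 0.
  by exists p, 1, 0; split; rewrite ?mulr0 ?mulr1 // => c d; rewrite mulr1.
have [c c0 [p1 pE pp1]] := content_decomp p0.
have [d d0 [q1 qE pq1]] := content_decomp q0.
have H0 : gcdp p1 q1 != 0 by rewrite gcdp_eq0 negb_and primitive_neq0.
have [h h0 [H HE pH]] := content_decomp H0.
have [[c1 w1] /= c10 E1] : exists2 cqq, cqq.1 != 0 & cqq.1 *: p1 = cqq.2 * gcdp p1 q1.
  exact/Pdiv.Idomain.dvdpP/dvdp_gcdl.
have [[c2 w2] /= c20 E2] : exists2 cqq, cqq.1 != 0 & cqq.1 *: q1 = cqq.2 * gcdp p1 q1.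
  exact/Pdiv.Idomain.dvdpP/dvdp_gcdr.
have [p2 p1E] : exists p', p1 = p' * H.
  by apply: (primitive_cancel c10 pH (r := h *: w1)); rewrite E1 HE -scalerAr -scalerAl.
have [q2 q1E] : exists q', q1 = q' * H.
  by apply: (primitive_cancel c20 pH (r := h *: w2)); rewrite E2 HE -scalerAr -scalerAl.
(* Bezout over the fraction field with denominators cleared: some combination of the cofactors [p2]
   and [q2] is a nonzero constant. *)
have [[s t] /=] := Bezoutp p1 q1.
move=> /eqpP[[b1 b2] /= /andP[b10 b20] Bz].
have Bz2 : b1 *: (s * p2 + t * q2) = (b2 * h)%:P.
  apply: (mulIf (primitive_neq0 pH)).
  by rewrite mul_polyC -scalerAl mulrDl -!mulrA -p1E -q1E Bz HE scalerA.
have pp2 : primitive p2 by apply: (@primitive_factor p2 H); rewrite -p1E.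
have pq2 : primitive q2 by apply: (@primitive_factor q2 H); rewrite -q1E.
have [g [c' [d' [cE dE ccd]]]] := gcdA c d.
have c'0 : c' != 0 by apply: contraNneq c0 => z; rewrite cE z mulr0.
have d'0 : d' != 0 by apply: contraNneq d0 => z; rewrite dE z mulr0.
exists (g *: H), (c' *: p2), (d' *: q2); split.
- by rewrite pE p1E cE -scalerAr -scalerAl scalerA [H * p2]mulrC [c' * g]mulrC.
- by rewrite qE q1E dE -scalerAr -scalerAl scalerA [H * q2]mulrC [d' * g]mulrC.
move=> P E; have [->|P0] := eqVneq P 0.
  move=> [x xE] _; exists 0; apply/eqP; rewrite mul0r.
  move/eqP: xE; rewrite mul0r mulf_eq0 => /orP[//|].
  by rewrite -mul_polyC mulf_eq0 polyC_eq0 (negbTE c'0) (negbTE (primitive_neq0 pp2)).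
have [y y0 [P1 P_E pP1]] := content_decomp P0.
move=> [x1 Ex1] [x2 Ex2].
(* By the Bezout identity the primitive part [P1] of [P] divides a nonzero constant multiple of [E],
   hence [E]. *)
have [W EW] : exists W, E = W * P1.
  apply: (@primitive_cancel (b2 * h * c' * d') _ _
    (b1 *: (y *: (d' *: (x1 * s) + c' *: (x2 * t))))) => //.
    by rewrite !mulf_neq0.
  have -> : (b2 * h * c' * d') *: E = (c' * d') *: ((b2 * h)%:P * E).
    by rewrite mul_polyC scalerA; congr (_ *: _); ring.
  rewrite -Bz2.
  have E1' : E * p2 * c'%:P = P1 * y%:P * x1.
    move: Ex1; rewrite P_E -!mul_polyC => Ex1.
    by rewrite -mulrA [p2 * _]mulrC Ex1 [y%:P * _]mulrC.
  have E2' : E * q2 * d'%:P = P1 * y%:P * x2.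
    move: Ex2; rewrite P_E -!mul_polyC => Ex2.
    by rewrite -mulrA [q2 * _]mulrC Ex2 [y%:P * _]mulrC.
  rewrite -!mul_polyC polyCM.
  transitivity (b1%:P * (s * d'%:P * (E * p2 * c'%:P) + t * c'%:P * (E * q2 * d'%:P))); first by ring.
  by rewrite E1' E2'; ring.
have yW (z : A) (Q x : {poly A}) : primitive Q -> E * (z *: Q) = P * x -> coef_dvd y (z *: W).
  move=> pQ EQ; apply: (coef_dvd_primitive pQ); apply/coef_dvdP; exists x.
  apply: (mulIf (primitive_neq0 pP1)); rewrite -scalerAl mulrC scalerAr.
  move: EQ; rewrite EW P_E -!mul_polyC => EQ.
  transitivity (W * P1 * (z%:P * Q)); first by ring.
  by rewrite EQ; ring.
(* The content [y] of [P] divides both [c' *: W] and [d' *: W], and [c'], [d'] are coprime. *)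
have /coef_dvdP[V VE] : coef_dvd y W.
  move=> i; apply: ccd; rewrite mulrC -coefZ; [exact: (yW c' p2 x1)|exact: (yW d' q2 x2)].
by exists V; rewrite EW VE P_E -scalerAl -scalerAl [V * _]mulrC.
Qed.

End GcdDomain.

Lemma gcd_domain_iso (A B : comNzRingType) (f : {rmorphism A -> B}) (g : B -> A) :
  cancel f g -> cancel g f -> gcd_domain B -> gcd_domain A.
Proof.
move=> fK gK gcdB a b; have [d [a' [b' [aE bE cab]]]] := gcdB (f a) (f b).
exists (g d), (g a'), (g b'); split; try by apply: (can_inj fK); rewrite rmorphM !gK.
move=> c e [x xE] [y yE].
have [||z zE] := cab (f c) (f e).
- by exists (f x); rewrite -rmorphM -xE rmorphM gK.
- by exists (f y); rewrite -rmorphM -yE rmorphM gK.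
by exists (g z); apply: (can_inj fK); rewrite rmorphM gK.
Qed.

Lemma gcd_domain_field (K : fieldType) : gcd_domain K.
Proof.
move=> a b; have [->|a0] := eqVneq a 0.
  exists b, 0, 1; split; rewrite ?mulr0 ?mulr1 // => c d _.
  by rewrite mulr1.
exists a, 1, (a^-1 * b); split; rewrite ?mulr1 //; first by rewrite mulrA divff ?mul1r.
by move=> c d; rewrite mulr1.
Qed.

(** * Multivariate polynomials as univariate ones over one variable fewer *)

Section MPolyIso.

Variables (n : nat) (K : idomainType).

(** The inverse of [muni]. *)
Definition mmulti_eval (p : {poly {mpoly K[n]}}) : {mpoly K[n.+1]} :=
  (map_poly (@mwiden n K) p).['X_ord_max].

Lemma muni_mpolyX (m : 'X_{1..n.+1}) :
  muni ('X_[m] : {mpoly K[n.+1]}) =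
  'X_[[multinom m (widen_ord (leqnSn n) i) | i < n]] *: 'X^(m ord_max).
Proof. by rewrite muniE msuppX big_seq1 mcoeffX eqxx scale1r. Qed.

Lemma mnm_split (m : 'X_{1..n.+1}) :
  (mnmwiden [multinom m (widen_ord (leqnSn n) i) | i < n] + U_(ord_max) *+ m ord_max)%MM = m.
Proof.
apply/mnmP => i; rewrite mnmDE mulmnE mnm1E.
have [<-|/eqP] := eqVneq ord_max i; first by rewrite mnmwiden_ordmax mul1n add0n.
move=> neq; rewrite mul0n addn0.
have lt_in : (i < n)%N.
  rewrite ltn_neqAle -ltnS ltn_ord andbT; apply/eqP => e.
  by apply: neq; apply/val_inj.
have -> : i = widen_ord (leqnSn n) (Ordinal lt_in) by apply/val_inj.
by rewrite mnmwiden_widen mnmE.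
Qed.

Lemma mmulti_evalD p q : mmulti_eval (p + q) = mmulti_eval p + mmulti_eval q.
Proof. by rewrite /mmulti_eval rmorphD hornerD. Qed.

Lemma mmulti_evalZ c p : mmulti_eval (c *: p) = mwiden c * mmulti_eval p.
Proof. by rewrite /mmulti_eval -mul_polyC rmorphM /= map_polyC hornerM hornerC. Qed.

Lemma mmulti_evalXn d : mmulti_eval 'X^d = 'X_ord_max ^+ d.
Proof. by rewrite /mmulti_eval map_polyXn hornerXn. Qed.

Lemma mmulti_muni : cancel (@muni n K) mmulti_eval.
Proof.
move=> p; elim/mpolyind: p => [|c m p _ _ IHp].
  by rewrite muni0 /mmulti_eval rmorph0 horner0.
rewrite muniD mmulti_evalD; congr (_ + _); last exact: IHp.
rewrite muniZ muni_mpolyX !mmulti_evalZ mmulti_evalXn.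
by rewrite mwidenC mwidenX mul_mpolyC mpolyXn -mpolyXD mnm_split.
Qed.

Lemma muni_mwiden (p : {mpoly K[n]}) : muni (mwiden p) = p%:P.
Proof.
elim/mpolyind: p => [|c m p _ _ IHp]; first by rewrite mwiden0 muni0 polyC0.
rewrite mwidenD muniD polyCD; congr (_ + _); last exact: IHp.
rewrite mwidenZ muniZ mwidenX muni_mpolyX mnmwiden_ordmax expr0 alg_polyC -mul_polyC -polyCM mul_mpolyC.
congr (_ *: 'X_[_])%:P; apply/mnmP => i; by rewrite mnmE mnmwiden_widen.
Qed.

Lemma muni_mmulti : cancel mmulti_eval (@muni n K).
Proof.
elim/poly_ind => [|p c IHp]; first by rewrite /mmulti_eval rmorph0 horner0 muni0.
have -> : mmulti_eval (p * 'X + c%:P) = mmulti_eval p * 'X_ord_max + mwiden c.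
  by rewrite /mmulti_eval rmorphD rmorphM /= map_polyX map_polyC hornerMXaddC.
rewrite muniD muniM muni_mwiden; congr (_ * _ + _); first exact: IHp.
rewrite muni_mpolyX mnm1E eqxx expr1.
rewrite (_ : [multinom _ | _ < _] = 0%MM) ?mpolyX0 ?scale1r //.
apply/mnmP => j; rewrite mnmE mnm1E mnm0E; apply/eqP; rewrite eqb0.
by apply/eqP => /(congr1 val) /= e; have := ltn_ord j; rewrite -e ltnn.
Qed.

End MPolyIso.

Lemma gcd_domain_mpoly (n : nat) (K : fieldType) : gcd_domain {mpoly K[n]}.
Proof.
elim: n => [|n IHn].
  apply: (@gcd_domain_iso _ K (mcoeff 0%MM) (@mpolyC 0 K)); last exact: gcd_domain_field.
    exact: mpolyKC.
  exact: mpolyCK.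
apply: (@gcd_domain_iso _ {poly {mpoly K[n]}} (@muni n K) (@mmulti_eval n K)).
- exact: mmulti_muni.
- exact: muni_mmulti.
exact: gcd_domain_poly.
Qed.

(** * Homogeneous components and the Koszul complex *)

Section HomogeneousPart.

Variable k : closedFieldType.

Local Notation R := {mpoly k[3]}.
Implicit Types (p q r : R) (i j : int).

Lemma mcoeff_pihomog d p m :
  (pihomog mdeg d p)@_m = if mdeg m == d then p@_m else 0.
Proof.
elim/mpolyind: p => [|c m' p _ _ IHp]; first by rewrite raddf0 mcoeff0 if_same.
rewrite linearP /= mcoeffD mcoeffZ IHp pihomogX mcoeffD mcoeffZ mcoeffX.
case: (eqVneq m' m) => [->|m'm].
  by case: eqP => _; rewrite ?mcoeffX ?eqxx // mcoeff0 mulr0 addr0.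
rewrite mulr0 add0r; case: (mdeg m' == d); rewrite ?mcoeffX ?(negbTE m'm) ?mcoeff0 mulr0 add0r //.
Qed.

(** Defined in every integer degree, with value 0 in negative ones, so that degree shifts carry no
    side condition. *)
Definition hpart j p : R := if j is Posz d then pihomog mdeg d p else 0.

Lemma hpart0 j : hpart j 0 = 0.
Proof. by case: j => // d; rewrite /hpart raddf0. Qed.

Lemma hpartD j p q : hpart j (p + q) = hpart j p + hpart j q.
Proof. by case: j => d /=; rewrite ?raddfD ?addr0. Qed.

Lemma hpart_sum (I : Type) (r : seq I) (P : pred I) (F : I -> R) j :
  hpart j (\sum_(i <- r | P i) F i) = \sum_(i <- r | P i) hpart j (F i).
Proof. by apply: (big_morph _ (hpartD j) (hpart0 j)). Qed.

Lemma grad_poly_hpart j p : grad_poly j (hpart j p).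
Proof. by case: j => //= d; apply: pihomogP. Qed.

Lemma hpart_id j p : grad_poly j p -> hpart j p = p.
Proof. by case: j => //= d; apply: pihomog_dE. Qed.

Lemma grad_polyD j p q : grad_poly j p -> grad_poly j q -> grad_poly j (p + q).
Proof. by case: j => [d|d] /=; [apply: dhomogD|move=> -> ->; rewrite addr0]. Qed.

Lemma grad_poly0 j : grad_poly j (0 : R).
Proof. by case: j => //= d; apply: rpred0. Qed.

Lemma grad_polyN j p : grad_poly j p -> grad_poly j (- p).
Proof. by case: j => [d|d] /=; [rewrite rpredN|move->; rewrite oppr0]. Qed.

Lemma grad_poly_sum (I : Type) (r : seq I) (P : pred I) (F : I -> R) j :
  (forall a, grad_poly j (F a)) -> grad_poly j (\sum_(i <- r | P i) F i).
Proof. by move=> h; apply: big_ind => //; [apply: grad_poly0|move=> *; apply: grad_polyD]. Qed.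

Lemma grad_polyM i j p q :
  grad_poly i p -> grad_poly j q -> grad_poly (i + j) (p * q).
Proof.
case: i j => [a|a] [b|b].
- exact: dhomogM.
- by move=> _ ->; rewrite mulr0; apply: grad_poly0.
- by move=> -> _; rewrite mul0r; apply: grad_poly0.
- by move=> -> _; rewrite mul0r; apply: grad_poly0.
Qed.

Lemma grad_polyX (i : 'I_3) : grad_poly 1 ('X_i : R).
Proof. by rewrite /= dhomogX; apply/eqP; rewrite /= mdeg1. Qed.

Lemma grad_polyC (c : k) : grad_poly 0 (c%:MP : R).
Proof. by rewrite /= -alg_mpolyC; apply: rpredZ; apply: dhomog1. Qed.

Lemma grad_poly0P p : grad_poly 0 p -> p = (p@_0)%:MP.
Proof.
move=> p0; apply/mpolyP => m; rewrite mcoeffC.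
have [->|m0] := eqVneq m 0%MM; first by rewrite mulr1.
by rewrite mulr0; apply: (dhomog_nemf_coeff p0); rewrite mdeg_eq0.
Qed.

Lemma hpart_neq i j p : grad_poly i p -> i != j -> hpart j p = 0.
Proof.
case: i j => [a|a] [b|b] //=; last by move=> ->; rewrite raddf0.
by move=> pa ab; apply: pihomog_ne0 pa => //; apply: contraNneq ab => ->.
Qed.

Lemma hpart_partition p : p = \sum_(d < msize p) hpart d p.
Proof. exact: pihomog_partitionE (leqnn _). Qed.

Lemma hpartM i j p q : grad_poly i p -> hpart j (p * q) = p * hpart (j - i) q.
Proof.
move=> pi; rewrite {1}(hpart_partition q) mulr_sumr hpart_sum.
case ji : (j - i) => [d|d]; last first.
  rewrite /= mulr0 big1 // => a _.
  apply: (hpart_neq (i := i + a%:Z)); first exact: grad_polyM pi (grad_poly_hpart _ _).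
  by lia.
have -> : j = i + d%:Z by rewrite -ji; lia.
transitivity (\sum_(a < msize q) p * hpart d (hpart a q)); last first.
  by rewrite -mulr_sumr -hpart_sum -hpart_partition.
apply: eq_bigr => a _.
have [ad|ad] := eqVneq (a%:Z) d%:Z.
  rewrite ad (hpart_id (grad_poly_hpart d q)) hpart_id //.
  exact: grad_polyM pi (grad_poly_hpart _ _).
rewrite !(hpart_neq _ ad) ?mulr0; [|exact: grad_poly_hpart..].
apply: (hpart_neq (i := i + a%:Z)); last by rewrite (inj_eq (addrI _)).
by apply: grad_polyM pi (grad_poly_hpart _ _).
Qed.

Lemma hpartMr i j p q : grad_poly i q -> hpart j (p * q) = hpart (j - i) p * q.
Proof. by move=> qi; rewrite mulrC (hpartM _ _ qi) mulrC. Qed.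

Lemma grad_poly_divl i j p q :
  p != 0 -> grad_poly i p -> grad_poly j (p * q) -> grad_poly (j - i) q.
Proof.
move=> p0 pi /hpart_id; rewrite (hpartM _ _ pi) => /(mulfI p0) <-.
exact: grad_poly_hpart.
Qed.

(* Since [c] is invertible as a power series, [q] has the same order as
   [c * q], so its degree is at least that of [c * q]. *)
Lemma homog_factor_const d p c : p \is d.-homog -> p != 0 ->
  rdvd c p -> c@_0 != 0 -> c = (c@_0)%:MP.
Proof.
move=> pd p0 [q pE] c0; apply: msize1_polyC.
have q0 : q != 0 by apply: contraNneq p0 => q0; rewrite pE q0 mulr0.
have cn0 : c != 0 by apply: contraNneq c0 => ->; rewrite mcoeff0.
have qm0 : q@_(mlast q) != 0 by rewrite -mcoeff_msupp mlast_supp.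
have lastd : mdeg (mlast q) = d.
  apply: (dhomog_mf pd); rewrite mcoeff_msupp pE.
  suff -> : (c * q)@_(mlast q) = c@_0 * q@_(mlast q) by rewrite mulf_neq0.
  rewrite -mcoeffCM; apply/eqP; rewrite -subr_eq0 -mcoeffB -mulrBl; apply/eqP.
  rewrite mcoeffM big1 // => -[[m1 ?] [m2 ?]] /= /eqP mE.
  have [->|m10] := eqVneq m1 0%MM.
    by rewrite mcoeffB mcoeffC eqxx mulr1 subrr mul0r.
  rewrite (@mcoeff_lt_mlast _ _ q m2) ?mulr0 // mE.
  by apply: lt_mdeg_ltmc; rewrite mdegD -[X in (X < _)%N]add0n ltn_add2r lt0n mdeg_eq0.
have : (d < msize q)%N by rewrite -lastd msize_mdeg_lt ?mlast_supp.
have := msizeM cn0 q0; rewrite -pE.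
have : msize p = d.+1.
  have [m mp] : exists m, m \in msupp p.
    by exists (mlead p); apply: mlead_supp.
  have := dhomog_msize pd => pd'; have := dhomog_uniq p0 pd pd'.
  by move=> ->; rewrite prednK // lt0n msize_poly_eq0.
by move=> ->; move: (msize c) (msize q) => a b; lia.
Qed.

End HomogeneousPart.

Section Koszul.

Variable k : closedFieldType.

Local Notation R := {mpoly k[3]}.

Definition i0 : 'I_3 := @Ordinal 3 0 isT.
Definition i1 : 'I_3 := @Ordinal 3 1 isT.
Definition i2 : 'I_3 := @Ordinal 3 2 isT.

Lemma ord3P (i : 'I_3) : [\/ i = i0, i = i1 | i = i2].
Proof.
by case: i => -[|[|[|//]]] lt; [apply: Or31|apply: Or32|apply: Or33]; apply/val_inj.
Qed.

Lemma sum_ord3 (V : nmodType) (F : 'I_3 -> V) : \sum_i F i = F i0 + F i1 + F i2.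
Proof.
rewrite !big_ord_recl big_ord0 addr0 addrA.
by congr (F _ + F _ + F _); apply/val_inj.
Qed.

Definition fam3 (T : Type) (a b c : T) (i : 'I_3) : T :=
  match val i with 0%N => a | 1%N => b | _ => c end.

Definition vanish (i : 'I_3) (p : R) : R :=
  p \mPo [tuple if j == i then 0 else 'X_j | j < 3].

Lemma vanishX i : vanish i 'X_i = 0.
Proof. by rewrite /vanish comp_mpolyXU -tnth_nth tnth_mktuple eqxx. Qed.

Lemma vanishXne i j : j != i -> vanish i 'X_j = 'X_j.
Proof. by move=> /negbTE ji; rewrite /vanish comp_mpolyXU -tnth_nth tnth_mktuple ji. Qed.

Lemma vanishM i p q : vanish i (p * q) = vanish i p * vanish i q.
Proof. exact: rmorphM. Qed.

Lemma vanishD i p q : vanish i (p + q) = vanish i p + vanish i q.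
Proof. exact: raddfD. Qed.

Lemma vanish0 i : vanish i 0 = 0.
Proof. exact: raddf0. Qed.

Lemma mpoly_closure (P : R -> Prop) : (forall c, P c%:MP) -> (forall i, P 'X_i) ->
  (forall p q, P p -> P q -> P (p + q)) -> (forall p q, P p -> P q -> P (p * q)) ->
  forall p, P p.
Proof.
move=> PC PX PD PM p; elim/mpolyind: p => [|c m p _ _ Pp]; first by rewrite -mpolyC0; apply: PC.
apply: (PD) => //; rewrite -mul_mpolyC; apply: (PM) => //.
rewrite mpolyXE_id; apply: big_ind => [||i _]; [by rewrite -mpolyC1; apply: PC|exact: PM|].
elim: (m i) => [|e IHe]; first by rewrite expr0 -mpolyC1; apply: PC.
by rewrite exprS; apply: PM.
Qed.

Lemma vanish_mod i p : exists q, p = vanish i p + 'X_i * q.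
Proof.
elim/mpoly_closure: p => [c|j|p q [p' pE] [q' qE]|p q [p' pE] [q' qE]].
- by exists 0; rewrite mulr0 addr0 /vanish comp_mpolyC.
- have [->|ji] := eqVneq j i; first by exists 1; rewrite vanishX add0r mulr1.
  by exists 0; rewrite mulr0 addr0 vanishXne.
- by exists (p' + q'); rewrite vanishD {1}pE {1}qE; ring.
exists (vanish i p * q' + p' * vanish i q + 'X_i * p' * q').
by rewrite vanishM {1}pE {1}qE; ring.
Qed.

Lemma const_mod (p : R) : exists q : 'I_3 -> R, p = (p@_0)%:MP + \sum_i 'X_i * q i.
Proof.
elim/mpoly_closure: p => [c|j|p q [p' pE] [q' qE]|p q [p' pE] [q' qE]].
- exists (fun=> 0); rewrite mcoeffC eqxx mulr1 big1 ?addr0 // => i _.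
  by rewrite mulr0.
- exists (fun i => (i == j)%:R); rewrite mcoeffX mnm1_eq0 mpolyC0 add0r.
  rewrite (bigD1 j) //= eqxx mulr1 big1 ?addr0 // => i /negbTE ->.
  by rewrite mulr0.
- exists (fun i => p' i + q' i); rewrite mcoeffD mpolyCD {1}pE {1}qE.
  rewrite addrACA -big_split; congr (_ + _); apply: eq_bigr => i _.
  by rewrite mulrDr.
exists (fun i => p' i * q + (p@_0)%:MP * q' i).
have -> : (p * q)@_0 = p@_0 * q@_0.
  by case: (mcoeff0_is_multiplicative 3 k) => h _; apply: h.
rewrite (eq_bigr (fun i => ('X_i * p' i) * q + (p@_0)%:MP * ('X_i * q' i))); last first.
  by move=> i _; ring.
rewrite big_split -mulr_suml -mulr_sumr /= mpolyCM.
by rewrite [in LHS]pE mulrDl [in LHS]addrC addrCA -mulrDr -qE addrC.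
Qed.

Lemma mpolyX_neq0 (i : 'I_3) : ('X_i : R) != 0.
Proof. by rewrite -msize_poly_eq0 msizeX. Qed.

(** Setting ['X_i] to zero leaves ['X_j * vanish i q = 0] in a domain. *)
Lemma X_regular (i j : 'I_3) (p q : R) : i != j -> 'X_i * p = 'X_j * q ->
  exists r, q = 'X_i * r.
Proof.
move=> ij E; have [r rE] := vanish_mod i q; exists r; rewrite rE.
suff -> : vanish i q = 0 by rewrite add0r.
have : vanish i ('X_i * p) = vanish i ('X_j * q) by rewrite E.
rewrite !vanishM vanishX mul0r vanishXne 1?eq_sym // => /esym/eqP.
by rewrite mulf_eq0 (negbTE (mpolyX_neq0 _)) => /eqP.
Qed.

Variable M : lmodType R.

Definition crossX (P : 'I_3 -> M) : 'I_3 -> M :=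
  fam3 ('X_i1 *: P i2 - 'X_i2 *: P i1) ('X_i2 *: P i0 - 'X_i0 *: P i2)
       ('X_i0 *: P i1 - 'X_i1 *: P i0).

(* Exactness of the Koszul complex of (x, y, z) with coefficients in [M] at
   the two middle terms, where it reads M --> M^3 --crossX--> M^3 --> M. *)
Definition koszul_left := forall v : 'I_3 -> M,
  (forall i j, 'X_i *: v j = 'X_j *: v i) -> exists t, forall i, v i = 'X_i *: t.

Definition koszul_right := forall v : 'I_3 -> M,
  \sum_i 'X_i *: v i = 0 -> exists P, forall i, v i = crossX P i.

End Koszul.

Section KoszulRing.

Variable k : closedFieldType.

Local Notation R := {mpoly k[3]}.

Lemma sum_crossX (M : lmodType R) (P : 'I_3 -> M) : \sum_i 'X_i *: crossX P i = 0.
Proof.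
rewrite sum_ord3 /crossX /fam3 /= !scalerBr !scalerA.
rewrite ['X_i1 * 'X_i0]mulrC ['X_i2 * 'X_i0]mulrC ['X_i2 * 'X_i1]mulrC.
by rewrite [X in X + _]addrC subrKA subrKA subrr.
Qed.

Lemma koszul_left_ring : koszul_left R^o.
Proof.
move=> v h; have [t tE] : exists r, v i0 = 'X_i0 * r.
  by apply: (@X_regular _ i0 i1 (v i1)) => //; apply: h.
exists t => i; apply: (mulfI (mpolyX_neq0 k i0)).
have := h i0 i; rewrite /GRing.scale /= => ->; rewrite tE; ring.
Qed.

(** Modulo the first two variables the relation says that the third one times [v i2] is zero, so
    [v i2 = 'X_i1 * q1 + 'X_i0 * q0]. After substitution ['X_i1] divides [v i0 + 'X_i2 * q0], with
    quotient [A], and [(- q1, q0, A)] is a preimage. *)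
Lemma koszul_right_ring : koszul_right R^o.
Proof.
move=> v; rewrite sum_ord3 /GRing.scale /= => h.
have [q0 q0E] := vanish_mod i0 (v i2).
have [q1 q1E] := vanish_mod i1 (vanish i0 (v i2)).
have z0 : vanish i1 (vanish i0 (v i2)) = 0.
  have /eqP := congr1 (vanish i1 \o vanish i0) h; rewrite /= !vanishD !vanishM.
  rewrite !vanishX !vanish0 mul0r add0r !(@vanishXne _ i0) // vanishX mul0r add0r.
  by rewrite (@vanishXne _ i1) // mulf_eq0 (negbTE (mpolyX_neq0 _ _)) => /eqP.
have v2E : v i2 = 'X_i1 * q1 + 'X_i0 * q0 by rewrite q0E q1E z0 add0r.
have [A AE] : exists A, v i0 + 'X_i2 * q0 = 'X_i1 * A.
  apply: (@X_regular _ i1 i0 (- (v i1 + 'X_i2 * q1))) => //.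
  move: h; rewrite v2E => h; apply/eqP; rewrite eq_sym -subr_eq0 -[X in _ == X]h; apply/eqP; ring.
exists (fam3 (- q1) q0 A) => i; case: (ord3P i) => ->; rewrite /crossX /fam3 /= /GRing.scale /=.
- by rewrite -AE; ring.
- apply: (mulfI (mpolyX_neq0 k i1)).
  have -> : 'X_i1 * v i1 = - ('X_i0 * (v i0 + 'X_i2 * q0)) - 'X_i1 * 'X_i2 * q1.
    by apply/eqP; rewrite -subr_eq0 -[X in _ == X]h v2E; apply/eqP; ring.
  by rewrite AE; ring.
- by rewrite v2E; ring.
Qed.

End KoszulRing.

(** * Hilbert's basis theorem *)

Definition ideal_like (A : comNzRingType) (I : A -> Prop) :=
  I 0 /\ forall a x y, I x -> I y -> I (a * x + y).

Definition submod_like (A : comNzRingType) (M : lmodType A) (U : M -> Prop) :=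
  U 0 /\ forall a x y, U x -> U y -> U (a *: x + y).

(* That [s] generates [I] is expressed by minimality among ideals. *)
Definition noetherian (A : comNzRingType) := forall I : A -> Prop, ideal_like I ->
  exists2 s : seq A, (forall g, g \in s -> I g) &
    forall J, ideal_like J -> (forall g, g \in s -> J g) -> forall x, I x -> J x.

Definition noetherian_module (A : comNzRingType) (M : lmodType A) :=
  forall U : M -> Prop, submod_like U ->
  exists2 s : seq M, (forall g, g \in s -> U g) &
    forall J, submod_like J -> (forall g, g \in s -> J g) -> forall x, U x -> J x.

Section SubmodLike.

Variables (A : comNzRingType) (M : lmodType A) (U : M -> Prop).
Hypothesis subU : submod_like U.

Lemma submod_like0 : U 0. Proof. by case: subU. Qed.

Lemma submod_likeD x y : U x -> U y -> U (x + y).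
Proof. by move=> Ux Uy; have [_ h] := subU; rewrite -[x]scale1r; apply: h. Qed.

Lemma submod_likeZ a x : U x -> U (a *: x).
Proof. by move=> Ux; have [U0 h] := subU; rewrite -[a *: x]addr0; apply: h. Qed.

Lemma submod_likeB x y : U x -> U y -> U (x - y).
Proof. by move=> Ux Uy; rewrite -scaleN1r; apply: submod_likeD => //; apply: submod_likeZ. Qed.

End SubmodLike.

Section IdealLike.

Variables (A : comNzRingType) (I : A -> Prop).
Hypothesis idI : ideal_like I.

Lemma ideal_like0 : I 0. Proof. by case: idI. Qed.

Lemma ideal_likeD x y : I x -> I y -> I (x + y).
Proof. by move=> Ix Iy; have [_ h] := idI; rewrite -[x]mul1r; apply: h. Qed.

Lemma ideal_likeM a x : I x -> I (a * x).
Proof. by move=> Ix; have [I0 h] := idI; rewrite -[a * x]addr0; apply: h. Qed.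

Lemma ideal_likeB x y : I x -> I y -> I (x - y).
Proof. by move=> Ix Iy; rewrite -mulN1r; apply: ideal_likeD => //; apply: ideal_likeM. Qed.

End IdealLike.

(** The first coordinates of [U] form a finitely generated ideal, and the members with first
    coordinate zero are shorter rows. Lifts of generators of the former join generators of the
    latter. *)
Lemma noetherian_rows (A : comNzRingType) n :
  noetherian A -> noetherian_module 'rV[A]_n.
Proof.
move=> noethA; elim: n => [|n IHn] U subU.
  by exists [::] => // J subJ _ x _; rewrite thinmx0; apply: submod_like0.
pose hd (u : 'rV[A]_(1 + n)) := u 0 (lshift n 0).
have hdE a (u v : 'rV[A]_(1 + n)) : hd (a *: u + v) = a * hd u + hd v.
  by rewrite /hd !mxE.
pose L a := exists2 u, U u & hd u = a.
have idL : ideal_like L.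
  split; first by exists 0; [apply: submod_like0|rewrite /hd mxE].
  move=> a x y [u Uu <-] [v Uv <-]; exists (a *: u + v) => //.
  by case: subU => _; apply.
have [s1 s1L s1gen] := noethA L idL.
pose tl (v : 'rV[A]_n) : 'rV[A]_(1 + n) := row_mx 0 v.
have tlE a u v : tl (a *: u + v) = a *: tl u + tl v.
  by rewrite /tl scale_row_mx add_row_mx scaler0 addr0.
have tlK (y : 'rV[A]_(1 + n)) : hd y = 0 -> exists z, y = tl z.
  move=> y0; exists (rsubmx y); rewrite -[LHS]hsubmxK /tl; congr row_mx.
  by apply/rowP => i; rewrite ord1 !mxE.
have submod_tl V : submod_like V -> submod_like (fun v => V (tl v)).
  move=> subV; split; first by rewrite /tl row_mx0; apply: submod_like0.
  by move=> a u v Uu Uv; rewrite tlE; case: subV => _; apply.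
have [s2 s2U s2gen] := IHn _ (submod_tl U subU).
have /choice [l lP] : forall a, exists u, a \in s1 -> U u /\ hd u = a.
  move=> a; case: (boolP (a \in s1)) => [/s1L[u]|]; last by exists 0.
  by exists u.
exists (map l s1 ++ map tl s2).
  move=> g; rewrite mem_cat => /orP[/mapP[a as1 ->]|/mapP[v vs2 ->]].
    by have [] := lP a as1.
  exact: s2U.
move=> J subJ sJ x Ux.
(* The ideal of first coordinates of members of both [U] and [J] contains [s1], so [x] has the same
   first coordinate as some such [u]. *)
have /s1gen : ideal_like (fun a => exists u, [/\ U u, J u & hd u = a]).
  split; first by exists 0; split; [apply: submod_like0..|rewrite /hd mxE].
  move=> a y z [u [Uu Ju <-]] [v [Uv Jv <-]]; exists (a *: u + v); split => //.
    by case: subU => _; apply.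
  by case: subJ => _; apply.
case/(_ _ (hd x)) => [a as1|| u [Uu Ju ux]]; last 1 first.
- have [z zE] : exists z, x - u = tl z.
    by apply: tlK; rewrite -scaleN1r addrC hdE ux mulN1r addNr.
  rewrite -(subrK u x); apply: submod_likeD => //; rewrite zE.
  apply: (s2gen _ (submod_tl J subJ)) => [v vs2|].
    by apply: sJ; rewrite mem_cat map_f ?orbT.
  by rewrite -zE; apply: submod_likeB.
- by have [Ul hl] := lP a as1; exists (l a); split=> //; apply: sJ; rewrite mem_cat map_f.
- by exists x.
Qed.

(** Leading coefficients in all degrees together form one ideal, whose finitely many generators
    occur in degrees at most [N]. They lower the degree of any member of [I] of size above [N]; the
    members of size at most [N] form a submodule of a module of rows. *)
Theorem noetherian_poly (A : comNzRingType) : noetherian A -> noetherian {poly A}.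
Proof.
move=> noethA I idI.
(* Bounding the size instead of fixing the degree admits [a = 0], which makes this an ideal in
   [a]. *)
pose lead (K : {poly A} -> Prop) n a := exists p, [/\ K p, (size p <= n.+1)%N & p`_n = a].
have lead_ideal K n : ideal_like K -> ideal_like (lead K n).
  move=> idK; split; first by exists 0; rewrite size_poly0 coef0; split=> //; apply: ideal_like0.
  move=> a x y [p [Kp sp <-]] [q [Kq sq <-]]; exists (a%:P * p + q); split.
  - by case: idK => _; apply.
  - rewrite (leq_trans (size_polyD _ _)) // geq_max sq andbT.
    by rewrite mul_polyC (leq_trans (size_scale_leq _ _)).
  - by rewrite coefD coefCM.
have lead_shift K n m a : ideal_like K -> (n <= m)%N -> lead K n a -> lead K m a.
  move=> idK nm [p [Kp sp <-]]; exists ('X^(m - n) * p); split.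
  - exact: ideal_likeM.
  - by rewrite (leq_trans (size_polyMleq _ _)) // size_polyXn; lia.
  - by rewrite coefXnM ltnNge leq_subr /= subKn.
pose L a := exists n, lead I n a.
have idL : ideal_like L.
  split; first by exists 0%N; apply: ideal_like0; apply: lead_ideal.
  move=> a x y [n xn] [m ym]; exists (n + m)%N; case: (lead_ideal I (n + m)%N idI) => _; apply.
    by apply: lead_shift xn => //; apply: leq_addr.
  by apply: lead_shift ym => //; apply: leq_addl.
have [s1 s1L s1gen] := noethA L idL.
have /choice [l lP] : forall a, exists np : nat * {poly A}, a \in s1 ->
    [/\ I np.2, (size np.2 <= np.1.+1)%N & np.2`_np.1 = a].
  move=> a; case: (boolP (a \in s1)) => [/s1L[n [p pP]]|]; last by exists (0%N, 0).
  by exists (n, p).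
pose N := \max_(a <- s1) (l a).1.
pose U (v : 'rV[A]_N) := I (rVpoly v).
have submodU K : ideal_like K -> submod_like (fun v : 'rV[A]_N => K (rVpoly v)).
  move=> idK; split; first by rewrite linear0; apply: ideal_like0.
  by move=> a u v Ku Kv; rewrite linearP /= -mul_polyC; case: idK => _; apply.
have [s2 s2U s2gen] := noetherian_rows noethA (submodU I idI).
exists (map (fun a => (l a).2) s1 ++ map rVpoly s2).
  move=> g; rewrite mem_cat => /orP[/mapP[a /lP[] Il _ _ -> //]|/mapP[v vs2 ->]].
  exact: s2U.
move=> J idJ sJ p; have [n] := ubnP (size p).
elim: n p => // n IHn p; rewrite ltnS => sp Ip.
have [spN|Nsp] := leqP (size p) N.
  rewrite -(poly_rV_K spN); apply: (s2gen _ (submodU J idJ)); last by rewrite poly_rV_K.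
  by move=> v vs2; apply: sJ; rewrite mem_cat map_f ?orbT.
have p0 : (0 < size p)%N by apply: leq_trans Nsp.
have idIJ : ideal_like (fun q => I q /\ J q).
  split; first by split; apply: ideal_like0.
  by move=> a x y [Ix Jx] [Iy Jy]; case: idI idJ => _ hI [_ hJ]; split; [apply: hI|apply: hJ].
(* The generators in [s1] are leading coefficients of members of both [I] and [J], so this
   intersection already has every leading coefficient needed to reduce [p]. *)
have [q [[Iq Jq] sq qp]] : lead (fun q => I q /\ J q) (size p).-1 (lead_coef p).
  apply: (s1gen _ (lead_ideal _ _ idIJ)); last by exists (size p).-1, p; rewrite prednK.
  move=> a as1; have [Il sl la] := lP a as1.
  apply: (@lead_shift _ (l a).1) => //.
    have : ((l a).1 <= N)%N by apply: leq_bigmax_seq.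
    by move: Nsp; clear; lia.
  exists (l a).2; split=> //; split=> //; apply: sJ; rewrite mem_cat.
  by apply/orP; left; apply/mapP; exists a.
rewrite -(subrK q p); apply: ideal_likeD => //; apply: IHn; last exact: ideal_likeB.
apply: leq_trans sp; rewrite -[X in (_ < X)%N](prednK p0) ltnS.
apply/leq_sizeP => j; rewrite leq_eqVlt => /orP[/eqP <-|lt].
  by rewrite coefB qp -lead_coefE subrr.
rewrite prednK // in lt sq; rewrite coefB !nth_default ?subrr //.
exact: leq_trans sq lt.
Qed.

Lemma noetherian_field (K : fieldType) : noetherian K.
Proof.
move=> I idI; have [[a [a0 Ia]]|h] := pselect (exists a, a != 0 /\ I a).
  exists [:: a] => [g|J idJ sJ x _]; first by rewrite inE => /eqP ->.
  rewrite -(divfK a0 x); apply: ideal_likeM => //; apply: sJ; exact: mem_head.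
exists [::] => // J idJ _ x Ix; have [->|x0] := eqVneq x 0; first exact: ideal_like0.
by case: h; exists x.
Qed.

Lemma noetherian_iso (A B : comNzRingType) (f : {rmorphism A -> B}) (g : B -> A) :
  cancel f g -> cancel g f -> noetherian B -> noetherian A.
Proof.
move=> fK gK noethB I idI.
have gM : forall a x y, g (a * x + y) = g a * g x + g y.
  by move=> a x y; apply: (can_inj fK); rewrite rmorphD rmorphM !gK.
have g0 : g 0 = 0 by apply: (can_inj fK); rewrite rmorph0 gK.
have idg K : ideal_like K -> ideal_like (K \o g).
  move=> [K0 KM]; split; rewrite /= ?g0 // => a x y Kx Ky.
  by rewrite gM; apply: KM.
have [s sI sgen] := noethB _ (idg I idI).
exists (map g s) => [a /mapP[b bs ->]|J idJ sJ x Ix]; first exact: sI.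
rewrite -[x]fK; apply: (sgen _ (idg J idJ)); last by rewrite /= fK.
by move=> b bs; apply: sJ; apply: map_f.
Qed.

Lemma noetherian_mpoly (n : nat) (K : fieldType) : noetherian {mpoly K[n]}.
Proof.
elim: n => [|n IHn].
  apply: (@noetherian_iso _ K (mcoeff 0%MM) (@mpolyC 0 K)); last exact: noetherian_field.
    exact: mpolyKC.
  exact: mpolyCK.
apply: (@noetherian_iso _ {poly {mpoly K[n]}} (@muni n K) (@mmulti_eval n K)).
- exact: mmulti_muni.
- exact: muni_mmulti.
exact: noetherian_poly.
Qed.

(** * Minimal graded resolutions *)

Section LinearCombinations.

Variables (R : comNzRingType) (M : lmodType R).

Lemma lincomb0 n (g : 'I_n -> M) : lincomb g 0 = 0.
Proof. by rewrite /lincomb big1 // => i _; rewrite mxE scale0r. Qed.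

Lemma lincombP n (g : 'I_n -> M) a u v :
  lincomb g (a *: u + v) = a *: lincomb g u + lincomb g v.
Proof.
rewrite /lincomb scaler_sumr -big_split; apply: eq_bigr => i _ /=.
by rewrite !mxE scalerDl scalerA.
Qed.

Lemma lincombD n (g : 'I_n -> M) u v : lincomb g (u + v) = lincomb g u + lincomb g v.
Proof. by have := lincombP g 1 u v; rewrite !scale1r. Qed.

Lemma lincombZ n (g : 'I_n -> M) a u : lincomb g (a *: u) = a *: lincomb g u.
Proof. by rewrite -[a *: u]addr0 lincombP lincomb0 addr0. Qed.

Lemma lincombB n (g : 'I_n -> M) u v : lincomb g (u - v) = lincomb g u - lincomb g v.
Proof. by rewrite lincombD -[- v]scaleN1r lincombZ scaleN1r. Qed.

Lemma lincomb_sum (I : Type) (r : seq I) (P : pred I) n (g : 'I_n -> M) F :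
  lincomb g (\sum_(i <- r | P i) F i) = \sum_(i <- r | P i) lincomb g (F i).
Proof. exact: (big_morph _ (lincombD g) (lincomb0 g)). Qed.

Lemma lincomb_delta n (g : 'I_n -> M) i : lincomb g (delta_mx 0 i) = g i.
Proof.
rewrite /lincomb (bigD1 i) //= mxE !eqxx scale1r big1 ?addr0 // => j /negbTE ji.
by rewrite mxE ji andbF scale0r.
Qed.

Lemma lincomb_mulmx n m (g : 'I_m -> M) (A : 'M_(n, m)) v :
  lincomb g (v *m A) = lincomb (fun i => lincomb g (row i A)) v.
Proof.
rewrite mulmx_sum_row lincomb_sum.
by apply: eq_bigr => i _; rewrite lincombZ.
Qed.

Lemma lincomb_row n m (A : 'M[R]_(n, m)) v : lincomb (fun i => row i A) v = v *m A.
Proof. by rewrite mulmx_sum_row. Qed.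

Lemma lincomb_submod n (g : 'I_n -> M) : submod_like (fun x => exists v, x = lincomb g v).
Proof.
split; first by exists 0; rewrite lincomb0.
by move=> a x y [u ->] [v ->]; exists (a *: u + v); rewrite lincombP.
Qed.

Lemma submod_lincomb (U : M -> Prop) n (g : 'I_n -> M) v : submod_like U ->
  (forall i, U (g i)) -> U (lincomb g v).
Proof.
move=> subU Ug; apply: big_ind => [|x y|i _]; first exact: submod_like0.
  exact: submod_likeD.
exact: submod_likeZ.
Qed.

Definition irredundant n (g : 'I_n -> M) :=
  forall i (v : 'rV_n), v 0 i = 0 -> lincomb g v <> g i.

End LinearCombinations.

Lemma lincomb_map (R : comNzRingType) (M N : lmodType R) (h : {linear M -> N})
  n (g : 'I_n -> M) v : h (lincomb g v) = lincomb (h \o g) v.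
Proof. by rewrite /lincomb linear_sum; apply: eq_bigr => i _; rewrite linearZ_LR. Qed.

Section GradedRows.

Variable k : closedFieldType.

Local Notation R := {mpoly k[3]}.

Definition hrow n (a : 'rV[int]_n) (j : int) (v : 'rV[R]_n) : 'rV[R]_n :=
  \row_i hpart (j - a 0 i) (v 0 i).

(** A grading is only a predicate here, with no projections onto degrees. This is the substitute:
    the homogeneous components of a relation among homogeneous elements are relations. *)
Definition homog_rel (M : lmodType R) (G : grading M) :=
  forall n (g : 'I_n -> M) (b : 'rV[int]_n) (v : 'rV[R]_n) j,
    (forall i, G (b 0 i) (g i)) -> lincomb g v = 0 -> lincomb g (hrow b j v) = 0.

Lemma grad_free_hrow n (a : 'rV[int]_n) j v : grad_free a j (hrow a j v).
Proof. by move=> i; rewrite mxE; apply: grad_poly_hpart. Qed.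

Lemma hpart_shift_partition (p : R) (s : int) (m : nat) :
  s <= 0 -> (msize p)%:Z <= m%:Z + s -> p = \sum_(c < m) hpart (c%:Z + s) p.
Proof.
move=> s0 ms; rewrite {1}(hpart_partition p).
transitivity (\sum_(c < m) \sum_(d < msize p) hpart (c%:Z + s) (hpart d p)); last first.
  by apply: eq_bigr => c _; rewrite -hpart_sum -hpart_partition.
rewrite exchange_big; apply: eq_bigr => d _ /=.
have [e eE] : exists e : nat, d%:Z = e%:Z + s by exists `|d%:Z - s|%N; lia.
have em : (e < m)%N by have := ltn_ord d; lia.
rewrite (bigD1 (Ordinal em)) //= -eE hpart_id; last exact: grad_poly_hpart.
rewrite big1 ?addr0 // => c ce; apply: (hpart_neq (grad_poly_hpart d%:Z p)).
by apply: contra ce => /eqP ce; apply/eqP/val_inj => /=; lia.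
Qed.

Lemma hrow_partition n (a : 'rV[int]_n) v : exists s m,
  v = \sum_(c < m) hrow a (c%:Z + s) v.
Proof.
(* [N] bounds the shifts and the degrees at once, so all components of [v] sit in degrees from [- N]
   to below [N]. *)
pose N := (\sum_i (`|a 0%R i| + msize (v 0%R i)))%N.
exists (- N%:Z), (2 * N)%N; apply/rowP => i; rewrite summxE.
have : (`|a 0%R i| + msize (v 0%R i) <= N)%N by rewrite /N (bigD1 i) //= leq_addr.
move=> hN; rewrite {1}(@hpart_shift_partition (v 0 i) (- N%:Z - a 0 i) (2 * N)); try lia.
by apply: eq_bigr => c _; rewrite mxE addrA.
Qed.

Lemma homog_rel_rows n (a : 'rV[int]_n) : homog_rel (grad_free a : grading 'rV[R]_n).
Proof.
move=> m g b v j gb /rowP v0; apply/rowP => l; have := v0 l.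
rewrite /lincomb !summxE mxE => /(congr1 (hpart (j - a 0 l))).
rewrite hpart0 hpart_sum => E; rewrite -[RHS]E; apply: eq_bigr => i _.
rewrite !mxE (hpartMr _ _ (gb i l)); congr (hpart _ _ * _); lia.
Qed.

(** If [v 0 i] had a nonzero constant term, the component of the relation in the degree of [g i]
    would have a nonzero constant as its [i]-th coefficient, and [g i] could be solved for. *)
Lemma irredundant_rel (M : lmodType R) (G : grading M) n (g : 'I_n -> M)
    (b : 'rV[int]_n) (v : 'rV[R]_n) :
  homog_rel G -> (forall i, G (b 0 i) (g i)) -> irredundant g -> lincomb g v = 0 ->
  forall i, (v 0 i)@_0 = 0.
Proof.
move=> hG gb irr v0 i; apply/eqP; case: eqP => // /eqP ci.
have [w w0 wi] : exists2 w : 'rV[R]_n, lincomb g w = 0 & w 0 i = ((v 0 i)@_0)%:MP.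
  exists (hrow b (b 0 i) v); first exact: hG.
  rewrite mxE subrr (grad_poly0P (grad_poly_hpart 0 _)); congr mpolyC.
  by rewrite mcoeff_pihomog mdeg0 eqxx.
case: (irr i (delta_mx 0 i - ((v 0 i)@_0)^-1%:MP *: w)).
  by rewrite !mxE !eqxx wi -mpolyCM mulVf // mpolyC1 subrr.
by rewrite lincombB lincomb_delta lincombZ w0 scaler0 subr0.
Qed.

Definition hom_gens (M : lmodType R) (G : grading M) (U : M -> Prop) n
    (b : 'rV[int]_n) (g : 'I_n -> M) :=
  [/\ forall i, U (g i), forall i, G (b 0 i) (g i)
    & forall x, U x -> exists v, x = lincomb g v].

(** A generating system with the least number of elements is irredundant. *)
Lemma irredundant_hom_gens (M : lmodType R) (G : grading M) (U : M -> Prop) :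
  (exists n (b : 'rV[int]_n) g, hom_gens G U b g) ->
  exists n (b : 'rV[int]_n) g, hom_gens G U b g /\ irredundant g.
Proof.
move=> exg; have exn : exists n, `[< exists (b : 'rV[int]_n) g, hom_gens G U b g >].
  by have [n h] := exg; exists n; apply/asboolP.
case: (ex_minnP exn) => -[|n] /asboolP[b [g gg]] nmin; exists _, b, g; split=> //.
  by move=> [].
move=> i v vi gi; have /nmin : `[< exists (b : 'rV[int]_n) g, hom_gens G U b g >]; last by rewrite ltnn.
have drop w : lincomb g w = w 0 i *: g i + lincomb (g \o lift i) (\row_j w 0 (lift i j)).
  by rewrite /lincomb (bigD1_ord i) //=; congr (_ + _); apply: eq_bigr => j _; rewrite mxE.
apply/asboolP; exists (\row_j b 0 (lift i j)), (g \o lift i).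
have [Ug gb ggen] := gg; split=> [j|j|x /ggen[w ->]] /=; rewrite ?mxE //.
rewrite drop -gi drop vi scale0r add0r -lincombP; by eexists.
Qed.

(** Finitely many generators exist by the basis theorem; each is replaced by its finitely many
    homogeneous components. *)
Lemma graded_submod_hom_gens n (a : 'rV[int]_n) (U : 'rV[R]_n -> Prop) :
  submod_like U -> (forall j v, U v -> U (hrow a j v)) ->
  exists m (b : 'rV[int]_m) g, hom_gens (grad_free a) U b g.
Proof.
move=> subU hU; have [s sU sgen] := noetherian_rows (@noetherian_mpoly 3 k) subU.
have /choice [c cP] : forall u : 'rV[R]_n, exists t : int * nat,
    u = \sum_(i < t.2) hrow a (i%:Z + t.1) u.
  by move=> u; have [x [m E]] := hrow_partition a u; exists (x, m).
pose l := flatten [seq [seq (i%:Z + (c u).1, u) | i <- iota 0 (c u).2] | u <- s].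
have lP t : t \in l -> U t.2.
  by case/flattenP => _ /mapP[u us ->] /mapP[i _ ->] /=; apply: sU.
pose x i := tnth (in_tuple l) i.
pose g i := hrow a (x i).1 (x i).2.
exists (size l), (\row_i (x i).1), g; split.
- by move=> i; apply: hU; apply: lP; apply: mem_tnth.
- by move=> i; rewrite mxE; apply: grad_free_hrow.
apply: (sgen) => [|u us]; first exact: lincomb_submod.
have /choice [v vE] : forall i : 'I_(c u).2,
    exists v, hrow a (i%:Z + (c u).1) u = lincomb g v.
  move=> i; have /tnthP[j jE] : (i%:Z + (c u).1, u) \in in_tuple l.
    apply/flattenP; exists [seq (i%:Z + (c u).1, u) | i <- iota 0 (c u).2].
      by apply: map_f.
    by apply/mapP; exists (val i); rewrite // mem_iota add0n ltn_ord.
  by exists (delta_mx 0 j); rewrite lincomb_delta /g /x -jE.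
exists (\sum_i v i); rewrite lincomb_sum; apply: etrans (cP u) _.
by under [RHS]eq_bigr do rewrite -vE.
Qed.

Lemma koszul_right_rows n : koszul_right 'rV[R]_n.
Proof.
move=> v /rowP h; have /choice [P PE] : forall j, exists P : 'I_3 -> R,
    forall i, v i 0 j = @crossX k R^o P i.
  move=> j; apply: koszul_right_ring.
  suff : \sum_i 'X_i * v i 0 j = 0 :> R by [].
  by have := h j; rewrite summxE mxE => E; rewrite -[RHS]E; apply: eq_bigr => i _; rewrite mxE.
exists (fun i => \row_j P j i) => i; apply/rowP => j; rewrite PE.
by case: (ord3P i) => ->; rewrite /crossX /fam3 /= !mxE.
Qed.

Lemma koszul_left_rows n : koszul_left 'rV[R]_n.
Proof.
move=> v h; have /choice [t tE] : forall j, exists t : R, forall i, v i 0 j = 'X_i * t.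
  move=> j; apply: (@koszul_left_ring k (fun i => v i 0 j)) => i i'.
  by have /rowP/(_ j) := h i i'; rewrite !mxE.
by exists (\row_j t j) => i; apply/rowP => j; rewrite !mxE tE.
Qed.

(* By iteration, a member of [U] lies in (x, y, z)^s R^n for all s. *)
Lemma krull_intersection n (U : 'rV[R]_n -> Prop) :
  (forall v, U v -> exists2 u : 'I_3 -> 'rV[R]_n,
      (forall i, U (u i)) & v = \sum_i 'X_i *: u i) ->
  forall v, U v -> v = 0.
Proof.
move=> h v Uv; apply/rowP => l; rewrite mxE; apply/mpolyP => m; rewrite mcoeff0.
have [s] := ubnP (mdeg m); elim: s m v Uv => // s IHs m v Uv; rewrite ltnS => ms.
have [u Uu ->] := h v Uv; rewrite summxE raddf_sum /= big1 // => i _.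
rewrite mxE; case mi : (m i) => [|e].
  rewrite mcoeffM big1 // => -[[m1 ?] [m2 ?]] /= /eqP mE.
  rewrite mcoeffX; case: eqP => [e|_]; last by rewrite mul0r.
  by move: mi; rewrite mE -e mnmDE mnm1E eqxx.
have mU : (U_(i) <= m)%MM by rewrite lep1mP mi.
rewrite -(submK mU) addmC mulrC [X in _@_X]addmC addmC mcoeffMX; apply: IHs => //.
have := mdegD (m - U_(i))%MM U_(i)%MM; rewrite (submK mU) mdeg1 addn1 => e'.
by move: ms; rewrite e'.
Qed.

(** [koszul_left M] amounts to the vanishing of Tor_2(M, k), which forces the module of relations to
    be free. The proof is the corresponding diagram chase: relations among the rows of [A] equal (x,
    y, z) times themselves, so they vanish by [krull_intersection]. *)
Lemma minimal_resolution (M : lmodType R) (G : grading M) m (a : 'rV[int]_m)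
    (g : 'I_m -> M) :
  homog_rel G -> koszul_left M -> (forall i, G (a 0 i) (g i)) ->
  generates g -> irredundant g ->
  exists n (b : 'rV[int]_n) (A : 'M[R]_(n, m)),
  [/\ forall i, grad_free a (b 0 i) (row i A),
      injective (fun v : 'rV[R]_n => v *m A),
      forall v, lincomb g v = 0 <-> exists w, w *m A = v
    & forall i j, (A i j)@_0 = 0].
Proof.
move=> hG kM ga ggen girr; pose K v := lincomb g v = 0.
have subK : submod_like K.
  split; first exact: lincomb0.
  by move=> c x y; rewrite /K lincombP => -> ->; rewrite scaler0 addr0.
have [n [b [w [[wK wb wgen] wirr]]]] : exists n (b : 'rV_n) w,
    hom_gens (grad_free a) K b w /\ irredundant w.
  apply: irredundant_hom_gens; apply: graded_submod_hom_gens => // j v.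
  exact: hG.
pose A := \matrix_i w i; have wA v : lincomb w v = v *m A.
  by rewrite mulmx_sum_row; apply: eq_bigr => i _; rewrite rowK.
have rel0 (v : 'rV[R]_n) : v *m A = 0 -> v = 0.
  move: v; apply: (@krull_intersection n (fun v => v *m A = 0)) => v v0.
  have vc := irredundant_rel (homog_rel_rows (a := a)) wb wirr (etrans (wA v) v0).
  have /choice [u uE] : forall i, exists q : 'I_3 -> R, v 0 i = \sum_l 'X_l * q l.
    move=> i; have [q qE] := const_mod (v 0 i); exists q.
    by rewrite {1}qE vc mpolyC0 add0r.
  pose u' l : 'rV[R]_n := \row_i u i l.
  have vE : v = \sum_l 'X_l *: u' l.
    by apply/rowP => i; rewrite uE summxE; apply: eq_bigr => l _; rewrite !mxE.
  (* The rows [u' l *m A] satisfy the Koszul relation in a free module, so they come from some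
     [P]. *)
  have [P PE] : exists P, forall l, u' l *m A = crossX P l.
    apply: koszul_right_rows; apply: etrans v0; rewrite vE mulmx_suml.
    by apply: eq_bigr => l _; rewrite scalemxAl.
  have Kcross l : lincomb g (crossX P l) = 0.
    rewrite -PE lincomb_mulmx; apply: big1 => i _.
    by rewrite rowK [lincomb g _]wK scaler0.
  (* The values [lincomb g (P l)] form a Koszul cycle in [M], hence a boundary. Subtracting
     ['X_l *: t'] with [t'] over [t] turns each [P l] into a relation without changing its
     [crossX]. *)
  have [t tE] : exists t, forall l, lincomb g (P l) = 'X_l *: t.
    apply: kM; have e i j : lincomb g ('X_i *: P j - 'X_j *: P i) = 0 ->
        'X_i *: lincomb g (P j) = 'X_j *: lincomb g (P i).
      by rewrite lincombB !lincombZ => /eqP; rewrite subr_eq0 => /eqP.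
    have e12 := e _ _ (Kcross i0); have e20 := e _ _ (Kcross i1).
    have e01 := e _ _ (Kcross i2).
    by move=> i j; case: (ord3P i) => ->; case: (ord3P j) => ->.
  have [t' t'E] := ggen t.
  have /choice [y yE] : forall l, exists y, P l - 'X_l *: t' = lincomb w y.
    by move=> l; apply: wgen; rewrite /K lincombB lincombZ -t'E tE subrr.
  have cE : crossX P =1 crossX (fun l => lincomb w (y l)).
    have key (x y' : R) (p q : 'rV[R]_m) :
        x *: p - y' *: q = x *: (p - y' *: t') - y' *: (q - x *: t').
      by rewrite !scalerBr !scalerA [y' * x]mulrC opprB addrA subrK.
    by move=> l; rewrite /crossX /fam3; case: (ord3P l) => -> /=; rewrite -!yE; apply: key.
  (* The correction by [crossX y] makes each term a relation and does not change the sum, since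
     [sum_crossX] vanishes. *)
  exists (fun l => u' l - crossX y l) => [l|].
    rewrite mulmxBl PE cE; apply/eqP; rewrite subr_eq0; apply/eqP.
    by rewrite /crossX /fam3; case: (ord3P l) => -> /=; rewrite mulmxBl -!scalemxAl !wA.
  under eq_bigr do rewrite scalerBr.
  by rewrite sumrB sum_crossX subr0.
exists n, b, A; split=> [i|u v|v|i j].
- by rewrite rowK.
- by move=> /eqP; rewrite -subr_eq0 -mulmxBl => /eqP/rel0/eqP; rewrite subr_eq0 => /eqP.
- split=> [/wgen[y ->]|[y <-]]; first by exists y; rewrite wA.
  by rewrite -wA; apply: (submod_lincomb y subK).
have := irredundant_rel (v := w i) hG ga girr (wK i) j.
by rewrite mxE.
Qed.

End GradedRows.

(** * The gradient of a reduced form *)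

Section Gradient.

Variable k : closedFieldType.

Local Notation R := {mpoly k[3]}.

Lemma euler_coef (p : R) m : (\sum_i 'X_i * p^`M(i))@_m = p@_m *+ mdeg m.
Proof.
rewrite raddf_sum mdegE -sumrMnr; apply: eq_bigr => i _ /=.
case mi : (m i) => [|e].
  rewrite mulr0n mcoeffM big1 // => -[[m1 ?] [m2 ?]] /= /eqP mE.
  rewrite mcoeffX; case: eqP => [e|_]; last by rewrite mul0r.
  by move: mi; rewrite mE -e mnmDE mnm1E eqxx.
have mU : (U_(i) <= m)%MM by rewrite lep1mP mi.
rewrite -{1}(submK mU) addmC mulrC [X in _@_X]addmC addmC mcoeffMX mcoeff_mderiv submK //.
by rewrite mnmBE mnm1E eqxx mi subn1.
Qed.

Lemma euler_formula (p : R) d : p \is d.-homog -> \sum_i 'X_i * p^`M(i) = p *+ d.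
Proof.
move=> pd; apply/mpolyP => m; rewrite euler_coef mcoeffMn.
have [<- //|md] := eqVneq (mdeg m) d.
by rewrite (dhomog_nemf_coeff pd md) !mul0rn.
Qed.

Lemma mderiv_homog (p : R) d i : p \is d.+1.-homog -> p^`M(i) \is d.-homog.
Proof.
move=> pd; apply/dhomogP => m; rewrite mcoeff_msupp mcoeff_mderiv => h.
have : (m + U_(i))%MM \in msupp p.
  by rewrite mcoeff_msupp; apply: contraNneq h => ->; rewrite mul0rn.
by move/(dhomog_mf pd) => /=; rewrite mdegD mdeg1 addn1 => -[].
Qed.

(** A nonzero partial derivative has smaller degree than [p]. *)
Lemma rdvd_mderiv_eq0 (p : R) i : p != 0 -> rdvd p p^`M(i) -> p^`M(i) = 0.
Proof.
move=> p0 [q pE]; apply/eqP; apply: contraT => d0.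
have q0 : q != 0 by apply: contraNneq d0 => q0; rewrite pE q0 mulr0.
have : (mlead p^`M(i) + U_(i))%MM \in msupp p.
  have := mlead_supp d0; rewrite !mcoeff_msupp mcoeff_mderiv.
  by apply: contraNneq => ->; rewrite mul0rn.
move/msize_mdeg_lt; rewrite mdegD mdeg1 addn1 (mlead_deg d0) pE.
rewrite (msizeM p0 q0) => h.
have : (0 < msize q)%N by rewrite lt0n msize_poly_eq0.
by move: h; move: (msize p) (msize q) => a b; lia.
Qed.

(** Take roots of the coefficients, which exist in a closed field, and divide the exponents by [e];
    Frobenius is additive. *)
Lemma mpoly_pth_root (p : R) e : e \in [pchar k] ->
  (forall m i, m \in msupp p -> (e %| m i)%N) -> exists q, p = q ^+ e.
Proof.
move=> eP pe; have e0 : (0 < e)%N by apply: prime_gt0; case/andP: eP.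
have ePR : e \in [pchar R].
  by rewrite !inE in eP *; case/andP: eP => -> /eqP z; rewrite -mpolyC_nat z mpolyC0 eqxx.
have /choice [r rE] : forall a : k, exists b, b ^+ e = a.
  (* [solve_monicpoly] solves [b ^+ e = \sum_(i < e) c i * b ^+ i]; only the constant coefficient is
     taken nonzero. *)
  move=> a; have [b bE] := @solve_monicpoly k e (fun i => if i == 0%N then a else 0) e0.
  exists b; rewrite bE -(prednK e0) big_ord_recl /= expr0 mulr1 big1 ?addr0 // => i _.
  by rewrite mul0r.
exists (\sum_(m <- msupp p) r p@_m *: 'X_[[multinom (m i %/ e)%N | i < 3]]).
rewrite -(pFrobenius_autE ePR) raddf_sum /= {1}[p]mpolyE.
apply: eq_big_seq => m mp; rewrite pFrobenius_autE exprZn rE mpolyXn.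
congr (_ *: 'X_[_]); apply/mnmP => i; rewrite mulmnE mnmE divnK //.
exact: pe.
Qed.

(** Every exponent that occurs in [p] is zero in [k]. So either all are zero, or the characteristic
    is a prime dividing all of them and [p] is a power. *)
Lemma zero_gradient (p : R) : (forall i, p^`M(i) = 0) ->
  p = (p@_0)%:MP \/ exists2 e, (1 < e)%N & exists q, p = q ^+ e.
Proof.
move=> dp; have supp0 m i : m \in msupp p -> (m i)%:R = 0 :> k.
  move=> mp; case mi : (m i) => [//|a].
  have mU : (U_(i) <= m)%MM by rewrite lep1mP mi.
  have := congr1 (mcoeff (m - U_(i))%MM) (dp i).
  rewrite mcoeff_mderiv submK // mnmBE mnm1E eqxx mi subn1 mcoeff0 /= => /eqP.
  by rewrite -[p@_m *+ _]mulr_natr mulf_eq0 -mi => /orP[|/eqP //]; rewrite mcoeff_eq0 mp.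
have [[m [i [mp mi]]]|h] := pselect (exists m i, m \in msupp p /\ m i != 0%N).
  right; have [e eP] : exists e, e \in [pchar k].
    by apply: (@natf0_pchar _ (m i)); rewrite ?lt0n // supp0.
  exists e; first by apply: prime_gt1; case/andP: eP.
  by apply: (mpoly_pth_root eP) => m' i' /supp0 z; rewrite (dvdn_pcharf eP) z.
left; apply/mpolyP => m; rewrite mcoeffC.
have [->|m0] := eqVneq m 0%MM; first by rewrite mulr1.
rewrite mulr0; apply: memN_msupp_eq0; apply/negP => mp.
case/negP: m0; apply/eqP/mnmP => i; rewrite mnm0E; apply/eqP; apply: contraT => mi.
by case: h; exists m, i.
Qed.

Lemma rdvd1_factor (I : Type) (v w : I -> R) D : (forall i, v i = D * w i) ->
  coprime_family w -> rdvd D 1 -> coprime_family v.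
Proof.
move=> vE cw [D' D1] a b h; apply: cw => i.
have -> : b * w i = b * v i * D' by rewrite vE -[LHS]mulr1 D1; ring.
exact: rdvd_mulr.
Qed.

Lemma const_rdvd1 (p : R) : p != 0 -> p = (p@_0)%:MP -> rdvd p 1.
Proof.
move=> p0 pE; exists ((p@_0)^-1)%:MP; rewrite {1}pE -mpolyCM mulfV ?mpolyC1 //.
by rewrite -(mpolyC_eq0 3) -pE.
Qed.

(** Let [D] be the gcd of the partial derivatives and [f = h * D] by Euler. Reducedness makes [D]
    and [h] coprime; differentiating the product shows that [D] divides its own derivatives, so
    these vanish. Then [D] is constant or a proper power, and reducedness settles the latter case
    too. *)
Lemma gradient_coprime (f : R) d : f != 0 -> f \is d.+1.-homog -> reduced f ->
  (forall p, p \in [pchar k] -> ~~ (p %| d.+1)%N) ->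
  coprime_family (fun i => f^`M(i)).
Proof.
move=> f0 fd fred hchar.
have d0 : (d.+1%:R : k) != 0.
  apply/negP => z; have [p pP] := natf0_pchar (ltn0Sn d) z.
  by have := hchar p pP; rewrite (dvdn_pcharf pP) z.
have [D [w [fE cw]]] := gcd_family (@gcd_domain_mpoly 3 k) (fun i => f^`M(i)).
have eul := euler_formula fd.
have [h hE] : rdvd D f.
  exists ((d.+1%:R^-1)%:MP * \sum_i 'X_i * w i).
  have <- : (d.+1%:R^-1)%:MP * (f *+ d.+1) = f.
    by rewrite -[f *+ _]mulr_natl -mpolyC_nat mulrA -mpolyCM mulVf // mpolyC1 mul1r.
  rewrite -eul !mulr_sumr; apply: eq_bigr => i _; rewrite fE; ring.
have D0 : D != 0 by apply: contraNneq f0 => z; rewrite hE z mul0r.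
have h0 : h != 0 by apply: contraNneq f0 => z; rewrite hE z mulr0.
apply: (rdvd1_factor fE cw).
have [g [D' [h' [DE h'E cDh]]]] := @gcd_domain_mpoly 3 k D h.
have g1 : rdvd g 1.
  (* With [g] the gcd of [D] and [h], the square of [g * D' * h'] is a multiple of [f]; reducedness
     then leaves one factor [g] too many on the right, which must be a unit. *)
  have [u uE] : exists u, g * D' * h' = u * f.
    by apply: (fred _ 2); exists (D' * h'); rewrite hE DE h'E; ring.
  exists u; have gz : g * D' * h' != 0.
    rewrite -DE mulf_neq0 //; apply: contraNneq h0 => z.
    by rewrite h'E z mulr0.
  by apply: (mulfI gz); rewrite mulr1 {1}uE hE DE h'E; ring.
have DDi i : rdvd D D^`M(i).
  have cDh' : coprime_pair D h.
    have [g' gg] := g1; move=> c e [x xE] [y yE]; apply: cDh.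
      by exists (x * g'); rewrite mulrA -xE DE -[LHS]mulr1 gg; ring.
    by exists (y * g'); rewrite mulrA -yE h'E -[LHS]mulr1 gg; ring.
  apply: cDh'; first by exists D^`M(i); rewrite mulrC.
  exists (w i - h^`M(i)).
  by rewrite mulrBr -fE hE mderivM; ring.
have [Dc|[e e1 [E EE]]] := zero_gradient (fun i => rdvd_mderiv_eq0 D0 (DDi i)).
  exact: const_rdvd1.
(* [E ^+ e = D], so [(E * h) ^+ e] is a multiple of [f]. Hence [E ^+ e * h] divides [E * h], and
   [1 < e] makes [E] a unit. *)
have [u uE] : exists u, E * h = u * f.
  apply: (fred _ e); exists (h ^+ e.-1).
  rewrite exprMn -EE hE -[in LHS](prednK (ltnW e1)) exprS; ring.
have E1 : rdvd E 1.
  exists (u * E ^+ e.-2); have Ez : E * h != 0.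
    rewrite mulf_neq0 //; apply: contraNneq D0 => z.
    by rewrite EE z expr0n; move: e1; case: (e).
  apply: (mulfI Ez); rewrite mulr1 {1}uE hE EE.
  have -> : E ^+ e = E * E * E ^+ e.-2 by case: (e) e1 => [|[|n]] // _; rewrite !exprS; ring.
  by ring.
have [E' EE'] := E1; exists (E' ^+ e); by rewrite EE -exprMn -EE' expr1n.
Qed.

End Gradient.

(** * Syzygies of the gradient and the ideal of a minimal generator *)

Section Parallel.

Variable A : idomainType.

(** [v j] divides [w j * v i] for every [i], hence [w j]. *)
Lemma coprime_parallel (I : Type) (v w : I -> A) : coprime_family v ->
  (forall i j, w i * v j = w j * v i) -> exists r, forall i, w i = r * v i.
Proof.
move=> cv wv; have [j /eqP vj] := coprime_family_neq0 cv.
have [r rE] : rdvd (v j) (w j).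
  by apply: cv => i; exists (w i); rewrite -wv mulrC.
by exists r => i; apply: (mulIf vj); rewrite wv rE; ring.
Qed.

End Parallel.

Section Syzygies.

Variable k : closedFieldType.

Local Notation R := {mpoly k[3]}.

Variables (f : R) (d : nat).
Hypothesis f_form : f \is (d.+1).-homog.

Local Notation phi i := (f^`M(i)).

Lemma syzP (s : syz f) : \sum_i syz_val s 0 i * phi i = 0.
Proof. by case: s => s /= /eqP. Qed.

Lemma syz_exists (v : 'I_3 -> R) : \sum_i v i * phi i = 0 ->
  exists s : syz f, forall i, syz_val s 0 i = v i.
Proof.
move=> h; have hP : \row_i v i \in syz_pred f.
  by rewrite inE; apply/eqP; rewrite -[RHS]h; apply: eq_bigr => i _; rewrite mxE.
by exists (Syz hP) => i /=; rewrite mxE.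
Qed.

Lemma syz_valP a (s t : syz f) : syz_val (a *: s + t) = a *: syz_val s + syz_val t.
Proof. by []. Qed.

Lemma syz_valZ a (s : syz f) : syz_val (a *: s) = a *: syz_val s.
Proof. by []. Qed.

Lemma syz_val_lincomb n (g : 'I_n -> syz f) v :
  syz_val (lincomb g v) = lincomb (fun i => syz_val (g i)) v.
Proof.
rewrite /lincomb; apply: (big_morph (@syz_val k f) (id1 := 0) (op1 := +%R)) => //.
Qed.

Lemma syz_ext (s t : syz f) : (forall i, syz_val s 0 i = syz_val t 0 i) -> s = t.
Proof. by move=> h; apply/val_inj/rowP => i; apply: h. Qed.

Lemma grad_syz_rows j (s : syz f) : grad_syz j s <-> grad_free (0 : 'rV_3) j (syz_val s).
Proof. by split=> h i; have := h i; rewrite mxE subr0. Qed.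

Lemma homog_rel_syz : homog_rel (@grad_syz k f).
Proof.
move=> n g b v j gb /(congr1 (@syz_val k f)); rewrite syz_val_lincomb => v0.
apply/val_inj; rewrite [val _]syz_val_lincomb.
by apply: (homog_rel_rows (a := 0)) v0 => i; apply/grad_syz_rows.
Qed.

(** Exactness passes from rows to syzygies because [R] is a domain: if ['X_i *: t] is a syzygy, so
    is [t]. *)
Lemma koszul_left_syz : koszul_left (syz f).
Proof.
move=> v h; have [t tE] : exists t, forall i, syz_val (v i) = 'X_i *: t.
  by apply: koszul_left_rows => i j; rewrite -!syz_valZ h.
have [s sE] : exists s : syz f, forall i, syz_val s 0 i = t 0 i.
  apply: syz_exists; apply: (mulfI (mpolyX_neq0 k i0)); rewrite mulr0; apply: etrans (syzP (v i0)).
  by rewrite mulr_sumr; apply: eq_bigr => i _; rewrite tE mxE mulrA.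
by exists s => i; apply: syz_ext => j; rewrite tE syz_valZ !mxE sE.
Qed.

Lemma hsyz_exists j (s : syz f) : exists t : syz f,
  forall i, syz_val t 0 i = hpart j (syz_val s 0 i).
Proof.
apply: syz_exists; have := congr1 (hpart (j + d%:Z)) (syzP s).
rewrite hpart0 hpart_sum => E; rewrite -[RHS]E; apply: eq_bigr => i _.
by rewrite (hpartMr (i := d%:Z)) ?addrK //; apply: mderiv_homog.
Qed.

Lemma minimal_irredundant (M : lmodType R) (G : grading M) n (g : 'I_n -> M) :
  minimal_hom_generators G g -> irredundant g.
Proof.
case=> _ ggen gmin i v vi gi; apply: (gmin i) => x; have [w ->] := ggen x.
exists (w + w 0 i *: (v - delta_mx 0 i)); split.
  by rewrite !mxE !eqxx vi sub0r mulrN1 subrr.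
by rewrite lincombD lincombZ lincombB lincomb_delta gi subrr scaler0 addr0.
Qed.

Lemma minimal_degrees (M : lmodType R) (G : grading M) n (g : 'I_n -> M) :
  minimal_hom_generators G g -> exists b : 'rV[int]_n, forall i, G (b 0 i) (g i).
Proof.
by case=> /choice[b bP] _ _; exists (\row_i b i) => i; rewrite mxE.
Qed.

Variables (eps : syz f) (e : nat).
Hypothesis eps_deg : grad_syz e%:Z eps.

Local Notation E i := (syz_val eps 0 i).

(** Dividing [eps] by the gcd [c] of its coordinates gives a syzygy [s] with [eps = c *: s].
    Minimality forbids [c] to vanish at the origin, and a factor of a form that does not vanish
    there is constant. *)
Lemma minimal_generator_coprime : minimal_hom_generator (@grad_syz k f) eps ->
  coprime_family (fun i => E i).
Proof.
case=> n [g [gmin [i0' gi]]]; have irr := minimal_irredundant gmin.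
have [b gb] := minimal_degrees gmin; have [_ ggen _] := gmin.
have [c [w [Ew cw]]] := gcd_family (@gcd_domain_mpoly 3 k) (fun i => E i).
have eps0 : eps <> 0.
  by rewrite -gi => z; apply: (irr i0' 0); rewrite ?mxE // lincomb0.
have [j Ej] : exists j, E j != 0.
  apply: contrapT => h; apply: eps0; apply: syz_ext => i.
  by rewrite /= mxE; apply/eqP; apply: contraT => Ei; case: h; exists i.
have c0 : c != 0 by apply: contraNneq Ej => z; rewrite Ew z mul0r.
have [s sE] : exists s : syz f, forall i, syz_val s 0 i = w i.
  apply: syz_exists; apply: (mulfI c0); rewrite mulr0; apply: etrans (syzP eps).
  by rewrite mulr_sumr; apply: eq_bigr => i _; rewrite Ew mulrA.
have epsE : eps = c *: s by apply: syz_ext => i; rewrite syz_valZ mxE sE Ew.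
have cc : c@_0 != 0.
  apply/eqP => cc; have [v vE] := ggen s.
  (* If [c] vanished at the origin, this relation would have constant term -1 at [eps], against
     irredundancy. *)
  have rel : lincomb g (c *: v - delta_mx 0 i0') = 0.
    by rewrite lincombB lincombZ lincomb_delta -vE -epsE gi subrr.
  have := irredundant_rel homog_rel_syz gb irr rel i0'.
  rewrite !mxE !eqxx mcoeffB mcoeff1 eqxx.
  rewrite (_ : (c * v 0 i0')@_0 = c@_0 * (v 0 i0')@_0); last first.
    by case: (mcoeff0_is_multiplicative 3 k) => h _; apply: h.
  by rewrite cc mul0r sub0r => /eqP; rewrite oppr_eq0 oner_eq0.
apply: (rdvd1_factor Ew cw); apply: const_rdvd1 => //.
apply: (homog_factor_const (p := E j) (d := e)) => //; first exact: eps_deg.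
by exists (w j); rewrite Ew.
Qed.

Definition cross (u v : 'rV[R]_3) : 'I_3 -> R :=
  fam3 (u 0 i1 * v 0 i2 - u 0 i2 * v 0 i1) (u 0 i2 * v 0 i0 - u 0 i0 * v 0 i2)
       (u 0 i0 * v 0 i1 - u 0 i1 * v 0 i0).

Lemma crossP a u v w i : cross u (a *: v + w) i = a * cross u v i + cross u w i.
Proof. by case: (ord3P i) => ->; rewrite /cross /fam3 /= !mxE; ring. Qed.

(** This is (u x v) x grad f = 0, by the identity (u x v) x w = (u . w) v - (v . w) u; [key] is its
    [a]-th coordinate. *)
Lemma cross_parallel (s t : syz f) i j :
  cross (syz_val s) (syz_val t) i * phi j = cross (syz_val s) (syz_val t) j * phi i.
Proof.
have := (syzP s, syzP t); rewrite !sum_ord3 => -[hs ht].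
set u := syz_val s in hs *; set v := syz_val t in ht *.
have key a x y : x - y = v 0 a * (u 0 i0 * phi i0 + u 0 i1 * phi i1 + u 0 i2 * phi i2)
    - u 0 a * (v 0 i0 * phi i0 + v 0 i1 * phi i1 + v 0 i2 * phi i2) -> x = y.
  by rewrite hs ht !mulr0 subrr => /eqP; rewrite subr_eq0 => /eqP.
by case: (ord3P i) => ->; case: (ord3P j) => -> //; rewrite /cross /fam3 /=;
  do [apply: (key i0); ring | apply: (key i1); ring | apply: (key i2); ring
     | symmetry; apply: (key i0); ring | symmetry; apply: (key i1); ring
     | symmetry; apply: (key i2); ring].
Qed.

Hypothesis phi_coprime : coprime_family (fun i => phi i).
Hypothesis eps_coprime : coprime_family (fun i => E i).

Lemma eps_torsion_free c : c *: eps = 0 -> c = 0.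
Proof.
move=> /(congr1 (@syz_val k f))/rowP c0; have [i /eqP Ei] := coprime_family_neq0 eps_coprime.
by have := c0 i; rewrite syz_valZ !mxE => /eqP; rewrite mulf_eq0 (negbTE Ei) orbF => /eqP.
Qed.

(* Two syzygies are both orthogonal to the gradient, so their cross product
   is a multiple of it. *)
Lemma rho_exists : exists rho : {linear syz f -> R^o},
  forall s i, cross (syz_val eps) (syz_val s) i = rho s * phi i.
Proof.
have /choice [rho rhoE] : forall s : syz f, exists r : R^o,
    forall i, cross (syz_val eps) (syz_val s) i = r * phi i.
  by move=> s; apply: coprime_parallel => // i j; apply: cross_parallel.
have rhoL : linear rho.
  move=> a s t; have [i /eqP phi0] := coprime_family_neq0 phi_coprime.
  by apply: (mulIf phi0); rewrite -rhoE syz_valP crossP !rhoE mulrDl mulrA.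
pose rhoX := HB.pack_for {linear syz f -> R^o} rho
  (GRing.isLinear.Build R (syz f) R^o _ rho rhoL).
by exists rhoX.
Qed.

Variable rho : {linear syz f -> R^o}.
Hypothesis rhoE : forall s i, cross (syz_val eps) (syz_val s) i = rho s * phi i.

Lemma rho_eqP s r i : phi i != 0 -> cross (syz_val eps) (syz_val s) i = r * phi i -> rho s = r.
Proof. by move=> phi0; rewrite rhoE => /(mulIf phi0). Qed.

Lemma rho_ker s : rho s = 0 <-> exists c, s = c *: eps.
Proof.
split=> [s0|[c ->]]; last first.
  have [i /eqP phi0] := coprime_family_neq0 phi_coprime.
  apply: (rho_eqP phi0); rewrite mul0r syz_valZ.
  by case: (ord3P i) => ->; rewrite /cross /fam3 /= !mxE; ring.
have h i : cross (syz_val eps) (syz_val s) i = 0 by rewrite rhoE s0 mul0r.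
have [|r rE] := coprime_parallel (w := fun i => syz_val s 0 i) eps_coprime.
  have := (h i0, h i1, h i2); rewrite /cross /fam3 /= => -[[/eqP h0 /eqP h1] /eqP h2].
  rewrite !subr_eq0 in h0 h1 h2.
  move: h0 h1 h2 => /eqP h0 /eqP h1 /eqP h2 i j.
  by case: (ord3P i) => ->; case: (ord3P j) => -> //; rewrite ![_ * E _]mulrC.
by exists r; apply: syz_ext => i; rewrite rE syz_valZ mxE.
Qed.

Lemma rho_eps : rho eps = 0.
Proof. by apply/rho_ker; exists 1; rewrite scale1r. Qed.

Lemma rho_homog j s : grad_syz j s -> grad_poly (e%:Z - d%:Z + j) (rho s).
Proof.
move=> sj; have [i /eqP phi0] := coprime_family_neq0 phi_coprime.
have -> : e%:Z - d%:Z + j = (e%:Z + j) - d%:Z by lia.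
apply: (grad_poly_divl (p := phi i) (i := d%:Z)) => //; first exact: mderiv_homog.
rewrite mulrC -rhoE.
have h a b : grad_poly (e%:Z + j) (E a * syz_val s 0 b) by apply: grad_polyM.
by case: (ord3P i) => ->; rewrite /cross /fam3 /=; apply: grad_polyD => //; apply: grad_polyN.
Qed.

(** The witness is the Koszul syzygy grad f x e_i: its cross product with [eps] is (eps . e_i) grad
    f - (eps . grad f) e_i, and the second term vanishes. *)
Lemma rho_koszul i : exists s : syz f, grad_syz d%:Z s /\ rho s = E i.
Proof.
pose v := fam3 (fam3 0 (phi i2) (- phi i1)) (fam3 (- phi i2) 0 (phi i0))
               (fam3 (phi i1) (- phi i0) 0) i.
have [s sE] : exists s : syz f, forall j, syz_val s 0 j = v j.
  apply: syz_exists; rewrite sum_ord3 /v.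
  by case: (ord3P i) => ->; rewrite /fam3 /=; ring.
exists s; split.
  have h a : grad_poly d%:Z (phi a) by apply: mderiv_homog.
  move=> j; rewrite sE /v /fam3.
  by case: (ord3P i) => ->; case: (ord3P j) => -> /=;
    do ?[exact: (grad_poly0 k d%:Z) | exact: h | exact: (grad_polyN (h _))].
have [j /eqP phi0] := coprime_family_neq0 phi_coprime; apply: (rho_eqP phi0).
have := syzP eps; rewrite sum_ord3 => eps0.
have key x y : x - y = - (E i0 * phi i0 + E i1 * phi i1 + E i2 * phi i2) -> x = y.
  by rewrite eps0 oppr0 => /eqP; rewrite subr_eq0 => /eqP.
by rewrite /v in sE; case: (ord3P i) sE => -> sE; case: (ord3P j) => ->;
  rewrite /cross /fam3 /= !sE /fam3 /=; do [ring | apply: key; ring].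
Qed.

Lemma rho_image_coprime a b : (forall s, rdvd a (b * rho s)) -> rdvd a b.
Proof.
by move=> h; apply: eps_coprime => i; have [s [_ <-]] := rho_koszul i; apply: h.
Qed.

(** Lift each ['X_i * t] to a syzygy [del i]. The expressions [crossX del] lie in the kernel
    [R eps]; their coefficients form a Koszul cycle in [R], hence a boundary [crossX P]. After
    subtracting [P l *: eps] the lifts are compatible, and [koszul_left_syz] divides them by the
    variables. *)
Lemma rho_image_depth (t : R) : (forall i, exists s, rho s = 'X_i * t) ->
  exists s, rho s = t.
Proof.
move=> /choice[del delE].
have /choice [c cE] : forall l, exists c, crossX del l = c *: eps.
  move=> l; apply/rho_ker.
  by case: (ord3P l) => ->; rewrite /crossX /fam3 /= linearB !linearZ /= !delE /GRing.scale /=; ring.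
have [P PE] : exists P, forall l, c l = @crossX k R^o P l.
  apply: koszul_right_ring; apply: eps_torsion_free.
  apply: etrans (sum_crossX del); rewrite scaler_suml; apply: eq_bigr => l _.
  by rewrite cE scalerA.
have [s sE] : exists s, forall l, del l - P l *: eps = 'X_l *: s.
  apply: koszul_left_syz; have key a b c' : 'X_a *: del b - 'X_b *: del a = c' *: eps ->
      c' = 'X_a * P b - 'X_b * P a ->
      'X_a *: (del b - P b *: eps) = 'X_b *: (del a - P a *: eps).
    have swap (x y z w : syz f) : x - y - (z - w) = (x - z) - (y - w).
      by rewrite !opprB addrACA [RHS]addrACA [- z + - y]addrC.
    move=> E1 E2; apply/eqP; rewrite -subr_eq0 !scalerBr swap E1 E2.
    by rewrite scalerBl !scalerA subrr.
  have e0 := key _ _ _ (cE i0) (PE i0); have e1 := key _ _ _ (cE i1) (PE i1).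
  have e2 := key _ _ _ (cE i2) (PE i2).
  by move=> i j; case: (ord3P i) => ->; case: (ord3P j) => ->.
exists s; apply: (mulfI (mpolyX_neq0 k i0)); rewrite -delE.
have P0 : rho (P i0 *: eps) = 0 by apply/rho_ker; exists (P i0).
by have := congr1 rho (sE i0); rewrite linearB P0 subr0 linearZ.
Qed.

End Syzygies.

(** * Dimensions of graded pieces *)

Section KDim.

Variable k : closedFieldType.

Local Notation R := {mpoly k[3]}.

Section Defs.

Variable M : lmodType R.

Definition ksub (S : M -> Prop) :=
  S 0 /\ forall (c : k) x y, S x -> S y -> S (c%:MP *: x + y).

Definition kcomb n (g : 'I_n -> M) (v : 'rV[k]_n) : M := \sum_i (v 0 i)%:MP *: g i.

(** Dimension is a relation given by an explicit basis: graded pieces are predicates on an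
    [R]-module rather than vector space types, and [k] acts through constant polynomials. *)
Definition kdim (S : M -> Prop) (n : nat) := exists g : 'I_n -> M,
  [/\ forall i, S (g i), forall v, kcomb g v = 0 -> v = 0
    & forall x, S x -> exists v, x = kcomb g v].

Lemma kcombP n (g : 'I_n -> M) c u v : kcomb g (c *: u + v) = c%:MP *: kcomb g u + kcomb g v.
Proof.
rewrite /kcomb scaler_sumr -big_split; apply: eq_bigr => i _ /=.
by rewrite !mxE mpolyCD mpolyCM scalerDl scalerA.
Qed.

Lemma kcomb0 n (g : 'I_n -> M) : kcomb g 0 = 0.
Proof. by rewrite /kcomb big1 // => i _; rewrite mxE mpolyC0 scale0r. Qed.

Lemma kcombD n (g : 'I_n -> M) u v : kcomb g (u + v) = kcomb g u + kcomb g v.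
Proof. by have := kcombP g 1 u v; rewrite mpolyC1 !scale1r. Qed.

Lemma kcombZ n (g : 'I_n -> M) c u : kcomb g (c *: u) = c%:MP *: kcomb g u.
Proof. by have := kcombP g c u 0; rewrite kcomb0 !addr0. Qed.

Lemma kcomb_delta n (g : 'I_n -> M) i : kcomb g (delta_mx 0 i) = g i.
Proof.
rewrite /kcomb (bigD1 i) //= mxE !eqxx mpolyC1 scale1r big1 ?addr0 // => j /negbTE ji.
by rewrite mxE ji andbF mpolyC0 scale0r.
Qed.

Lemma kcomb_mulmx m n (g : 'I_n -> M) (A : 'M[k]_(m, n)) v :
  kcomb g (v *m A) = kcomb (fun i => kcomb g (row i A)) v.
Proof.
rewrite mulmx_sum_row (big_morph (kcomb g) (kcombD g) (kcomb0 g)).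
by apply: eq_bigr => i _; rewrite kcombZ.
Qed.

Lemma ksub0 S : ksub S -> S 0. Proof. by case. Qed.

Lemma ksub_kcomb S n (g : 'I_n -> M) v : ksub S -> (forall i, S (g i)) -> S (kcomb g v).
Proof.
move=> [S0 SP] Sg; apply: (big_ind S) => // [x y Sx Sy|i _].
  by have := SP 1 x y Sx Sy; rewrite mpolyC1 scale1r.
by rewrite -[_ *: _]addr0; apply: SP.
Qed.

Lemma kdim_le S T m n : (forall x, S x -> T x) -> kdim S m -> kdim T n -> (m <= n)%N.
Proof.
move=> ST [g [Sg gfree _]] [h [_ _ hspan]].
have /choice [r rE] : forall i, exists r, g i = kcomb h r.
  by move=> i; apply/hspan/ST.
pose A := \matrix_i r i.
have gA v : kcomb g v = kcomb h (v *m A).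
  by rewrite kcomb_mulmx; apply: eq_bigr => i _; rewrite rowK rE.
suff /eqP <- : row_free A by apply: rank_leq_col.
rewrite -kermx_eq0; apply/eqP/row_matrixP => i; rewrite row0.
by apply: gfree; rewrite gA -row_mul mulmx_ker row0 kcomb0.
Qed.

Lemma kdim_uniq S m n : kdim S m -> kdim S n -> m = n.
Proof. by move=> Sm Sn; apply/eqP; rewrite eqn_leq (kdim_le _ Sm Sn) ?(kdim_le _ Sn Sm). Qed.

Lemma kdim_ext S T n : (forall x, S x <-> T x) -> kdim S n -> kdim T n.
Proof.
move=> ST [g [Sg gf gs]]; exists g; split=> // [i|x /ST/gs //].
exact/ST.
Qed.

(** A complement of the space of linear relations among the [g i] maps isomorphically onto [S]. *)
Lemma kdim_span S n (g : 'I_n -> M) : ksub S -> (forall i, S (g i)) ->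
  (forall x, S x -> exists v, x = kcomb g v) -> exists m, kdim S m.
Proof.
move=> Ssub Sg gspan; pose K (v : 'rV[k]_n) := kcomb g v = 0.
have Ksub : submod_like K.
  split; first exact: kcomb0.
  by move=> c x y; rewrite /K kcombP => -> ->; rewrite scaler0 addr0.
(* Finite generation over the field presents the relations as the row space of a matrix [A], for
   which complements are available. *)
have [s sK sgen] := noetherian_rows (@noetherian_field k) Ksub.
pose A : 'M_(size s, n) := \matrix_i s`_i.
have KA v : K v <-> (v <= A)%MS.
  split=> [Kv|/submxP[w ->]]; last first.
    rewrite mulmx_sum_row; apply: (big_ind K) => [|x y|i _]; first exact: submod_like0.
      exact: submod_likeD.
    by apply: submod_likeZ => //; rewrite rowK; apply: sK; rewrite mem_nth.
  apply: (sgen (fun v => (v <= A)%MS)) Kv.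
    split; first exact: sub0mx.
    by move=> c x y xA yA; apply: addmx_sub => //; apply: scalemx_sub.
  move=> x /(nthP 0)[i lt <-]; have := row_sub (Ordinal lt) A; by rewrite rowK.
pose B := row_base (A^C)%MS; exists (\rank (A^C)%MS), (fun i => kcomb g (row i B)); split.
- by move=> i; apply: ksub_kcomb.
- move=> v; rewrite -kcomb_mulmx => /KA vA.
  have vB : (v *m B <= A^C)%MS by rewrite -(eq_row_base (A^C)%MS) submxMl.
  have /eqP : (v *m B <= (0 : 'M_n))%MS by rewrite -(capmx_compl A) sub_capmx vA.
  move/eqP; rewrite submx0 => /eqP vB0.
  have Bfree : row_free B by apply: row_base_free.
  by apply: (row_free_inj Bfree); rewrite vB0 mul0mx.
move=> x /gspan[v ->].
have /sub_addsmxP[[w1 w2] /= vE] : (v <= A + A^C)%MS by rewrite submx_full ?addsmx_compl_full.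
have : (w2 *m A^C <= B)%MS by rewrite (eq_row_base (A^C)%MS) submxMl.
move=> /submxP[w w2E]; exists w; rewrite -kcomb_mulmx -w2E vE kcombD.
have -> : kcomb g (w1 *m A) = 0 by apply/KA; apply: submxMl.
by rewrite add0r.
Qed.

Lemma kdim_sub S T n : ksub S -> (forall x, S x -> T x) -> kdim T n ->
  exists m, kdim S m.
Proof.
move=> Ssub ST [g [Tg gfree gspan]]; pose K (v : 'rV[k]_n) := S (kcomb g v).
have Ksub : submod_like K.
  split; first by rewrite /K kcomb0; case: Ssub.
  by move=> c x y Kx Ky; rewrite /K kcombP; case: Ssub => _; apply.
have [s sK sgen] := noetherian_rows (@noetherian_field k) Ksub.
apply: (@kdim_span _ (size s) (fun i => kcomb g s`_i)) => // [i|x Sx].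
  by apply: sK; rewrite mem_nth.
have [v vE] := gspan x (ST x Sx); rewrite vE in Sx *.
apply: (sgen (fun v => exists w, kcomb g v = kcomb (fun i : 'I_(size s) => kcomb g s`_i) w)) Sx.
  split; first by exists 0; rewrite !kcomb0.
  by move=> c x' y [u uE] [w wE]; exists (c *: u + w); rewrite !kcombP uE wE.
move=> y /(nthP 0)[i lt <-]; exists (delta_mx 0 (Ordinal lt)).
by rewrite kcomb_delta.
Qed.

End Defs.

Definition klinear (M N : lmodType R) (h : M -> N) :=
  forall (c : k) x y, h (c%:MP *: x + y) = c%:MP *: h x + h y.

Section Exactness.

Variables (M N : lmodType R) (h : M -> N).
Hypothesis hL : klinear h.

Lemma klinear0 : h 0 = 0.
Proof. by have := hL (-1) 0 0; rewrite scaler0 addr0 mpolyCN mpolyC1 scaleN1r addNr. Qed.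

Lemma klinearD x y : h (x + y) = h x + h y.
Proof. by have := hL 1 x y; rewrite mpolyC1 !scale1r. Qed.

Lemma klinearB x y : h (x - y) = h x - h y.
Proof. by have := klinearD (x - y) y; rewrite subrK => ->; rewrite addrK. Qed.

Lemma klinear_kcomb n (g : 'I_n -> M) v : h (kcomb g v) = kcomb (h \o g) v.
Proof.
rewrite /kcomb (big_morph h klinearD klinear0); apply: eq_bigr => i _.
by have := hL (v 0 i) (g i) 0; rewrite klinear0 !addr0.
Qed.

Variable S : M -> Prop.
Hypothesis Ssub : ksub S.

Lemma kdim_image n : kdim S n -> exists m, kdim (fun y => exists2 x, S x & y = h x) m.
Proof.
move=> [g [Sg gfree gspan]]; apply: (@kdim_span _ _ n (h \o g)).
- split; first by exists 0; rewrite ?klinear0 //; apply: ksub0.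
  by move=> c _ _ [x Sx ->] [y Sy ->]; exists (c%:MP *: x + y); rewrite ?hL //; case: Ssub => _; apply.
- by move=> i; exists (g i).
- by move=> _ [x /gspan[v ->] ->]; exists v; rewrite klinear_kcomb.
Qed.

Lemma kdim_image_inj n : (forall x, S x -> h x = 0 -> x = 0) -> kdim S n ->
  kdim (fun y => exists2 x, S x & y = h x) n.
Proof.
move=> hinj [g [Sg gfree gspan]]; exists (h \o g); split.
- by move=> i; exists (g i).
- by move=> v; rewrite -klinear_kcomb => /hinj z; apply: gfree; apply: z; apply: ksub_kcomb.
- by move=> _ [x /gspan[v ->] ->]; exists v; rewrite klinear_kcomb.
Qed.

Lemma kdim_extension a c : kdim (fun x => S x /\ h x = 0) a ->
  kdim (fun y => exists2 x, S x & y = h x) c -> kdim S (a + c).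
Proof.
move=> [g [gK gfree gspan]] [t [tS tfree tspan]].
have /choice [l lP] : forall j, exists x, S x /\ t j = h x.
  by move=> j; have [x Sx tj] := tS j; exists x.
pose G i := match split i with inl i' => g i' | inr j => l j end.
have GE v : kcomb G v = kcomb g (lsubmx v) + kcomb l (rsubmx v).
  rewrite /kcomb big_split_ord; congr (_ + _); apply: eq_bigr => i _.
    by rewrite mxE /G -[lshift c i]/(unsplit (inl i)) unsplitK.
  by rewrite mxE /G -[rshift a i]/(unsplit (inr i)) unsplitK.
have hg u : h (kcomb g u) = 0.
  by rewrite klinear_kcomb /kcomb big1 // => i _; rewrite /= (gK i).2 scaler0.
have hl u : h (kcomb l u) = kcomb t u.
  by rewrite klinear_kcomb; apply: eq_bigr => j _; rewrite /= -(lP j).2.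
exists G; split.
- by move=> i; rewrite /G; case: split => j; [apply: (gK j).1|apply: (lP j).1].
- move=> v; rewrite GE => E; have /(congr1 h) := E.
  rewrite klinearD hg hl klinear0 add0r => /tfree r0.
  move: E; rewrite r0 kcomb0 addr0 => /gfree l0.
  by rewrite -[v]hsubmxK r0 l0 row_mx0.
move=> x Sx; have [w wE] : exists w, h x = kcomb t w by apply: tspan; exists x.
have [u uE] : exists u, x - kcomb l w = kcomb g u.
  apply: gspan; rewrite klinearB hl wE subrr; split=> //.
  have Sl : S (kcomb l w) by apply: ksub_kcomb => // j; apply: (lP j).1.
  by case: Ssub => _ /(_ (-1) _ _ Sl Sx); rewrite mpolyCN mpolyC1 scaleN1r addrC.
by exists (row_mx u w); rewrite GE row_mxKl row_mxKr -uE subrK.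
Qed.

Lemma kdim_exact n a c : kdim S n -> kdim (fun x => S x /\ h x = 0) a ->
  kdim (fun y => exists2 x, S x & y = h x) c -> n = (a + c)%N.
Proof. by move=> Sn Ka Ic; apply: (kdim_uniq Sn); apply: kdim_extension. Qed.

End Exactness.

End KDim.

(** * Hilbert functions *)

Section GradedDimension.

Variable k : closedFieldType.

Local Notation R := {mpoly k[3]}.

Definition rdim (j : int) : nat := if j is Posz t then 'C(t + 2, t) else 0.

Lemma rdimE (t : nat) : (2 * rdim t)%:Z = (t%:Z + 1) * (t%:Z + 2).
Proof.
have := bin_ffact t.+2 2; rewrite !ffactnS ffactn0 muln1 /= => h.
rewrite /rdim addn2 -bin_sub 1?ltnW // -[X in 'C(_, X)]/(2 + t - t)%N addnK.
by move: h; rewrite (_ : 2`! = 2%N) //; lia.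
Qed.

Lemma kdim_homog j : kdim (fun p : R^o => grad_poly j p) (rdim j).
Proof.
case: j => [t|t] /=; last first.
  exists (fun=> 0); split=> [i|v _|x ->]; first by case: i.
    by apply/rowP => -[].
  by exists 0; rewrite kcomb0.
have <- : \dim {:dhomog 3 k t} = 'C(t + 2, t) by rewrite dimvf.
pose X := vbasis {:dhomog 3 k t}.
have combE v : kcomb (fun i => (X`_i : dhomog 3 k t) : R^o) v = (\sum_i v 0 i *: X`_i : dhomog 3 k t) :> R.
  rewrite raddf_sum; apply: eq_bigr => i _; by rewrite /GRing.scale /= mul_mpolyC.
exists (fun i => (X`_i : dhomog 3 k t) : R^o); split.
- by move=> i; apply: dhomog_is_dhomog.
- move=> v; rewrite combE => /(@val_inj _ _ _ _ (0 : dhomog 3 k t)) v0.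
  apply/rowP => i; rewrite mxE; move/freeP: (basis_free (vbasisP {:dhomog 3 k t})).
  by apply.
move=> p ph; pose q : dhomog 3 k t := DHomog ph.
exists (\row_i coord X i q); rewrite combE.
transitivity (q : R) => //; congr mpoly_of_dhomog.
rewrite {1}(coord_vbasis (memvf q)); apply: eq_bigr => i _; by rewrite mxE.
Qed.

Lemma ksub_grad_poly j : ksub (fun p : R^o => grad_poly j p).
Proof.
split; first exact: grad_poly0.
move=> c x y xj yj; apply: grad_polyD => //.
by rewrite -[j]add0r; apply: grad_polyM => //; apply: grad_polyC.
Qed.

Lemma ksub_grad_free n (a : 'rV[int]_n) j : ksub (fun v : 'rV[R]_n => grad_free a j v).
Proof.
split; first by move=> i; rewrite mxE; apply: grad_poly0.
by move=> c x y xj yj i; rewrite !mxE; apply: (ksub_grad_poly _).2.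
Qed.

Lemma kdim_grad_free n (a : 'rV[int]_n) j :
  kdim (fun v : 'rV[R]_n => grad_free a j v) (\sum_i rdim (j - a 0 i)%R)%N.
Proof.
elim: n a => [|n IHn] a.
  rewrite big_ord0; exists (fun=> 0); split=> [[]//|v _|x _]; first by apply/rowP => -[].
  by exists 0; rewrite kcomb0 [x]thinmx0.
pose h (v : 'rV[R]_(1 + n)) : R^o := v 0 ord0.
have hL : klinear h by move=> c x y; rewrite /h !mxE.
rewrite big_ord_recl addnC; apply: (kdim_extension hL (ksub_grad_free a j)); last first.
  apply: kdim_ext (kdim_homog (j - a 0 ord0)) => p; split=> [pj|[v va ->]]; last exact: va.
  exists (\row_i if unlift ord0 i is Some _ then 0 else p); last by rewrite /h mxE unlift_none.
  by move=> i; rewrite mxE; case: unliftP => [l ->|-> //]; apply: grad_poly0.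
pose u (v : 'rV[R]_n) : 'rV[R]_(1 + n) := \row_i if unlift ord0 i is Some l then v 0 l else 0.
have uL : klinear u.
  by move=> c x y; apply/rowP => i; rewrite !mxE; case: unliftP => [l _|_]; rewrite ?mxE // mulr0 addr0.
have u0 v l : u v 0 (lift ord0 l) = v 0 l by rewrite mxE liftK.
have := kdim_image_inj uL (ksub_grad_free (\row_l a 0 (lift ord0 l)) j) _ (IHn _).
under eq_bigr do rewrite mxE.
move=> H; apply: kdim_ext (H _); last first.
  by move=> v _ v0; apply/rowP => l; rewrite -u0 v0 !mxE.
move=> x; split=> [[v va ->]|[xa x0]].
  split; last by rewrite /h mxE unlift_none.
  move=> i; case: (unliftP ord0 i) => [l ->|->]; last by rewrite mxE unlift_none; apply: grad_poly0.
  by rewrite u0; have := va l; rewrite mxE.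
exists (\row_l x 0 (lift ord0 l)); first by move=> l; rewrite !mxE; apply: xa.
apply/rowP => i; case: (unliftP ord0 i) => [l ->|->]; first by rewrite u0 mxE.
by rewrite [RHS]mxE unlift_none.
Qed.

Lemma hilbert_value_kdim (I : {pred R}) (t u : nat) :
  ksub (fun p : R^o => p \in I /\ grad_poly t p) ->
  kdim (fun p : R^o => p \in I /\ grad_poly t p) u -> hilbert_value I t (rdim t - u).
Proof.
move=> Isub [g [gI gfree gspan]].
have [X XE] : exists X : u.-tuple (dhomog 3 k t), forall i : 'I_u, (X`_i : R) = g i.
  exists [tuple (DHomog (gI i).2 : dhomog 3 k t) | i < u] => i.
  by rewrite -tnth_nth tnth_mktuple.
have combE v : kcomb g v = (\sum_i v 0 i *: X`_i : dhomog 3 k t) :> R.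
  rewrite raddf_sum; apply: eq_bigr => i _; rewrite /GRing.scale /= mul_mpolyC.
  by rewrite XE.
exists <<X>>%VS; split.
  move=> p; split=> [/coord_span pE|pI].
    have -> : (p : R) = kcomb g (\row_i coord X i p).
      rewrite combE {1}pE; congr mpoly_of_dhomog; apply: eq_bigr => i _; by rewrite mxE.
    by have [] := ksub_kcomb (\row_i coord X i p) Isub gI.
  have [v vE] : exists v, (p : R) = kcomb g v.
    by apply: gspan; split=> //; apply: dhomog_is_dhomog.
  have -> : p = \sum_i v 0 i *: X`_i by apply: val_inj; rewrite /= -combE.
  apply: memv_suml => i _; apply: memvZ; apply: memv_span; apply: mem_nth.
  by rewrite size_tuple.
have Xfree : free X.
  apply/freeP => c c0; have /gfree/rowP h : kcomb g (\row_i c i) = 0.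
    rewrite combE (_ : \sum_i _ = 0) // -[RHS]c0.
    by apply: eq_bigr => i _; rewrite mxE.
  by move=> i; have := h i; rewrite !mxE.
by move: Xfree; rewrite /free size_tuple => /eqP ->; rewrite dimvf.
Qed.

End GradedDimension.

Lemma rdim_third_difference (s : int) : exists N : nat, forall n : nat, (N <= n)%N ->
  (rdim (n.+3%:Z + s))%:Z = 3 * (rdim (n.+2%:Z + s))%:Z - 3 * (rdim (n.+1%:Z + s))%:Z + (rdim (n%:Z + s))%:Z.
Proof.
exists `|s|%N => n hn; have [m mE] : exists m : nat, n%:Z + s = m%:Z.
  by exists (absz (n%:Z + s)); lia.
have e3 : n.+3%:Z + s = m.+3%:Z by lia.
have e2 : n.+2%:Z + s = m.+2%:Z by lia.
have e1 : n.+1%:Z + s = m.+1%:Z by lia.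
rewrite e3 e2 e1 mE; have := (rdimE m, rdimE m.+1, rdimE m.+2, rdimE m.+3).
case=> -[[E0 E1] E2] E3; lia.
Qed.

(* Eventually a quadratic polynomial, expressed by third differences. *)
Definition quadratic_like (u : nat -> int) := exists N : nat, forall n, (N <= n)%N ->
  u n.+3 = 3 * u n.+2 - 3 * u n.+1 + u n.

Lemma quadratic_likeD u v : quadratic_like u -> quadratic_like v ->
  quadratic_like (fun n => u n + v n).
Proof.
move=> [N uN] [M vM]; exists (maxn N M) => n; rewrite geq_max => /andP[hN hM].
by rewrite uN // vM //; ring.
Qed.

Lemma quadratic_likeN u : quadratic_like u -> quadratic_like (fun n => - u n).
Proof. by move=> [N uN]; exists N => n hN; rewrite uN //; ring. Qed.

Lemma quadratic_like_rdim s : quadratic_like (fun n => (rdim (n%:Z + s))%:Z).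
Proof. exact: rdim_third_difference. Qed.

Lemma quadratic_like_sum m (s : 'I_m -> int) :
  quadratic_like (fun n => (\sum_i rdim (n%:Z + s i)%R)%N%:Z).
Proof.
elim: m s => [|m IHm] s; first by exists 0%N => n _; rewrite !big_ord0.
have [N h] := quadratic_likeD (quadratic_like_rdim (s ord0)) (IHm (fun i => s (lift ord0 i))).
by exists N => n /h; rewrite !big_ord_recl !PoszD.
Qed.

Lemma bounded_arithmetic (u : nat -> int) (C B : int) N :
  (forall n, (N <= n)%N -> u n.+1 = u n + C) -> (forall n, (N <= n)%N -> `|u n| <= B) -> C = 0.
Proof.
move=> uC uB; have uE m : u (N + m)%N = u N + m%:Z * C.
  elim: m => [|m IHm]; first by rewrite addn0 mul0r addr0.
  by rewrite addnS uC ?leq_addr // IHm; lia.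
(* Over 2|B| + 1 steps a nonzero [C] moves the sequence by more than 2|B|, the largest distance
   between values bounded by [B]. *)
have := uE (`|B| + `|B| + 1)%N; have := uB _ (leqnn N).
have := uB _ (leq_addr (`|B| + `|B| + 1)%N N).
move: (u N) (u _) => x y; have [//|C0] := eqVneq C 0.
by nia.
Qed.

(** First differences are eventually arithmetic and bounded, hence constant; then the sequence
    itself is arithmetic and bounded, hence constant. *)
Lemma bounded_quadratic (u : nat -> int) (B : int) N : quadratic_like u ->
  (forall n, (N <= n)%N -> 0 <= u n <= B) ->
  exists c M, forall n, (M <= n)%N -> u n = c.
Proof.
move=> [M uM] uB; pose K := maxn N M.
have kM n : (K <= n)%N -> (M <= n)%N by apply: leq_trans; apply: leq_maxr.
have kN n : (K <= n)%N -> (N <= n)%N by apply: leq_trans; apply: leq_maxl.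
pose w n := u n.+1 - u n; pose C := w K.+1 - w K.
have wC n : (K <= n)%N -> w n.+1 = w n + C.
  move=> Kn; rewrite -(subnKC Kn); elim: (n - K)%N => [|m IHm]; first by rewrite addn0 /C; ring.
  have := uM (K + m)%N (kM _ (leq_addr _ _)); move: IHm; rewrite !addnS /w; lia.
have wB n : (K <= n)%N -> `|w n| <= B.
  move=> Kn; have := uB n (kN _ Kn); have := uB n.+1 (kN _ (leqW Kn)); rewrite /w; lia.
have C0 := bounded_arithmetic wC wB.
have w0 : w K = 0.
  apply: (@bounded_arithmetic u (w K) B K) => n Kn; last by have := uB n (kN _ Kn); lia.
  suff <- : w n = w K by rewrite /w; ring.
  rewrite -(subnKC Kn); elim: (n - K)%N => [|m IHm]; first by rewrite addn0.
  by rewrite addnS wC ?leq_addr // IHm C0 addr0.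
exists (u K), K => n Kn; rewrite -(subnKC Kn); elim: (n - K)%N => [|m IHm]; first by rewrite addn0.
rewrite addnS; suff : w (K + m)%N = 0 by rewrite /w IHm => /eqP; rewrite subr_eq0 => /eqP.
elim: m {IHm} => [|m IHm]; first by rewrite addn0.
by rewrite addnS wC ?leq_addr // IHm C0.
Qed.

(** The cumulative function is eventually linear with slope [c]. Positivity of [c] makes its degree
    exactly one, where the factorial is 1. *)
Lemma has_mult_const (k : closedFieldType) (I : {pred {mpoly k[3]}}) (h : nat -> nat) c N :
  (forall t, hilbert_value I t (h t)) -> (forall t, (N <= t)%N -> h t = c) -> (0 < c)%N ->
  has_mult I c.
Proof.
move=> hI hc c0; exists h; split=> //.
(* The sum up to [n] is its part below [N] plus [c] times [n + 1 - N]; [K] collects what does not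
   depend on [n]. *)
pose K : rat := (\sum_(t < N) h t)%N%:R - c%:R * N%:R + c%:R.
exists (c%:R *: 'X + K%:P).
have cn0 : (c%:R : rat) != 0 by rewrite Num.Theory.pnatr_eq0 -lt0n.
have sz : size (c%:R *: 'X + K%:P) = 2%N.
  by rewrite size_polyDl size_scale ?size_polyX // (leq_ltn_trans (size_polyC_leq1 _)).
split; last by rewrite /lead_coef sz /= coefD coefZ coefX coefC mulr1 addr0 mulr1.
have sumE m : (\sum_(t < N + m) h t = \sum_(t < N) h t + c * m)%N.
  elim: m => [|m IHm]; first by rewrite addn0 muln0 addn0.
  by rewrite addnS big_ord_recr /= IHm hc ?leq_addr // mulnS addnA addnAC.
exists N => n Nn; rewrite hornerD hornerZ hornerX hornerC -(subnKC (leqW Nn)) sumE natrD natrM.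
rewrite natrB ?(leqW Nn) // -natr1 /K; ring.
Qed.

Section HilbertFunctions.

Variable k : closedFieldType.

Local Notation R := {mpoly k[3]}.

Lemma hrow_lincomb n m (c : 'rV[int]_n) (g : 'I_m -> 'rV[R]_n) (b : 'rV[int]_m)
    (v : 'rV[R]_m) j : (forall i, grad_free c (b 0 i) (g i)) ->
  hrow c j (lincomb g v) = lincomb g (hrow b j v).
Proof.
move=> gb; apply/rowP => l; rewrite mxE /lincomb !summxE hpart_sum.
apply: eq_bigr => i _; rewrite !mxE (hpartMr _ _ (gb i l)); congr (hpart _ _ * _); lia.
Qed.

Lemma hrow_id n (a : 'rV[int]_n) j (v : 'rV[R]_n) : grad_free a j v -> hrow a j v = v.
Proof. by move=> va; apply/rowP => i; rewrite mxE hpart_id. Qed.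

Lemma lincomb_klinear (M : lmodType R) n (g : 'I_n -> M) : klinear (lincomb g).
Proof. by move=> c x y; apply: lincombP. Qed.

Variables (f : R) (d : nat).
Hypothesis f_form : f \is (d.+1).-homog.
Hypothesis phi_coprime : coprime_family (fun i => f^`M(i)).

Lemma ksub_grad_syz j : ksub (fun s : syz f => grad_syz j s).
Proof.
split; first by move=> i; rewrite /= mxE; apply: grad_poly0.
move=> c x y xj yj i; rewrite syz_valP !mxE; by apply: (ksub_grad_poly k j).2; [apply: xj|apply: yj].
Qed.

(** The resolution of length one expresses each dimension as a difference of two sums of values of
    [rdim]. *)
Lemma syz_dimension m (g : 'I_m -> syz f) (a : 'rV[int]_m) :
  (forall i, grad_syz (a 0 i) (g i)) -> generates g -> irredundant g ->
  exists sigma : nat -> nat, (forall t : nat, kdim (fun s : syz f => grad_syz t s) (sigma t)) /\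
    forall s, quadratic_like (fun n => (sigma (n + s)%N)%:Z).
Proof.
move=> ga ggen girr.
have [n [b [A [Ab Ainj Aker _]]]] :=
  minimal_resolution (homog_rel_syz (f := f)) (koszul_left_syz (f := f)) ga ggen girr.
have kerE t v : grad_free a t v /\ lincomb g v = 0 <->
    exists2 w, grad_free b t w & v = w *m A.
  split=> [[va /Aker[w wE]]|[w wb ->]].
    exists (hrow b t w); first exact: grad_free_hrow.
    by rewrite -(hrow_id va) -wE -!lincomb_row (hrow_lincomb _ _ Ab).
  split; last by apply/Aker; exists w.
  by rewrite -(hrow_id wb) -lincomb_row -(hrow_lincomb _ _ Ab); apply: grad_free_hrow.
have imE t (s : syz f) : grad_syz t s <-> exists2 v, grad_free a t v & s = lincomb g v.
  have ga' i : grad_free (0 : 'rV_3) (a 0 i) (syz_val (g i)) by apply/grad_syz_rows.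
  split=> [st|[v va ->]].
    have [v vE] := ggen s; exists (hrow a t v); first exact: grad_free_hrow.
    apply/val_inj; rewrite [RHS]syz_val_lincomb -(hrow_lincomb _ _ ga').
    rewrite -syz_val_lincomb -vE hrow_id //; exact/grad_syz_rows.
  apply/grad_syz_rows; rewrite syz_val_lincomb -(hrow_id va) -(hrow_lincomb _ _ ga').
  exact: grad_free_hrow.
have mulL : klinear (fun w : 'rV[R]_n => w *m A).
  by move=> c x y; rewrite mulmxDl scalemxAl.
have dims (t : nat) : exists u, kdim (fun s : syz f => grad_syz t s) u /\
    (\sum_i rdim (t%:Z - a 0 i)%R = \sum_i rdim (t%:Z - b 0 i)%R + u)%N.
  have [u uP] := kdim_image (lincomb_klinear g) (ksub_grad_free k a t) (kdim_grad_free k a t).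
  exists u; split; first by apply: kdim_ext uP => s; rewrite imE.
  apply: (kdim_exact (lincomb_klinear g) (ksub_grad_free k a t) (kdim_grad_free k a t)) => //.
  apply: kdim_ext (kdim_image_inj mulL (ksub_grad_free k b t) _ (kdim_grad_free k b t)).
    by move=> v; rewrite kerE.
  by move=> w _ w0; apply: Ainj; rewrite w0 mul0mx.
have [sigma sigmaP] := choice dims; exists sigma; split=> [t|s]; first by case: (sigmaP t).
have := quadratic_likeD (quadratic_like_sum (fun i => s%:Z - a 0 i))
  (quadratic_likeN (quadratic_like_sum (fun i => s%:Z - b 0 i))).
move=> [N h]; exists N => t /h; have E u : (sigma (u + s)%N)%:Z =
    (\sum_i rdim (u%:Z + (s%:Z - a 0 i))%R)%N%:Z - (\sum_i rdim (u%:Z + (s%:Z - b 0 i))%R)%N%:Z.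
  have [_ h2] := sigmaP (u + s)%N.
  have e l (c : 'rV[int]_l) : (\sum_i rdim ((u + s)%N%:Z - c 0 i)%R =
      \sum_i rdim (u%:Z + (s%:Z - c 0 i))%R)%N.
    by apply: eq_bigr => i _; rewrite PoszD addrA.
  by rewrite -!e h2 PoszD addrC addKr.
by rewrite !E.
Qed.

Lemma gradient_ideal_dimension (t u : nat) : kdim (fun s : syz f => grad_syz t s) u ->
  exists2 v, kdim (fun p : R^o => p \in gradient_ideal f /\ grad_poly (t + d)%N p) v &
    (3 * rdim t = u + v)%N.
Proof.
move=> su; pose h (v : 'rV[R]_3) : R^o := \sum_i v 0 i * f^`M(i).
have hL : klinear h.
  move=> c x y; rewrite /h /GRing.scale /= mulr_sumr -big_split; apply: eq_bigr => i _ /=.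
  by rewrite !mxE; ring.
have S0 := kdim_grad_free k (0 : 'rV[int]_3) t.
have [v vP] := kdim_image hL (ksub_grad_free k _ t) S0.
exists v.
  apply: kdim_ext vP => p; split=> [[x xt ->]|[/asboolP[c pE] pt]].
    split; first by apply/asboolP; exists (fun i => x 0 i).
    rewrite PoszD; apply: grad_poly_sum => i; apply: grad_polyM; last exact: mderiv_homog.
    by have := xt i; rewrite mxE subr0.
  exists (\row_i hpart t (c i)).
    by move=> i; rewrite !mxE subr0; apply: grad_poly_hpart.
  rewrite -(hpart_id pt) pE hpart_sum; apply: eq_bigr => i _.
  rewrite mxE (hpartMr (i := d%:Z)); last exact: mderiv_homog.
  by rewrite PoszD addrK.
have -> : (3 * rdim t = \sum_i rdim (t%:Z - (0 : 'rV[int]_3) 0 i)%R)%N.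
  by under eq_bigr do rewrite mxE subr0; rewrite sum_nat_const card_ord.
apply: (kdim_exact hL (ksub_grad_free k _ t) S0) => //.
have vL : klinear (@syz_val k f) by [].
apply: kdim_ext (kdim_image_inj vL (ksub_grad_syz t) _ su); last first.
  by move=> s _ s0; apply: val_inj.
move=> x; split=> [[s st ->]|[xt x0]]; first by split; [exact/grad_syz_rows|exact: syzP].
have [s sE] := syz_exists (v := fun i => x 0 i) x0.
have sx : x = syz_val s by apply/rowP => i; rewrite sE.
by exists s => //; apply/grad_syz_rows; rewrite -sx.
Qed.

Variables (eps : syz f) (e : nat).
Hypothesis eps_deg : grad_syz e%:Z eps.
Hypothesis eps_coprime : coprime_family (fun i => syz_val eps 0 i).
Variable rho : {linear syz f -> R^o}.
Hypothesis rhoE : forall s i,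
  cross (syz_val eps) (syz_val s) i = rho s * f^`M(i).

Lemma rho_hpart j s t : (forall i, syz_val t 0 i = hpart j (syz_val s 0 i)) ->
  rho t = hpart (e%:Z - d%:Z + j) (rho s).
Proof.
move=> tE; have [i /eqP phi0] := coprime_family_neq0 phi_coprime.
apply: (rho_eqP rhoE phi0).
have -> : e%:Z - d%:Z + j = (e%:Z + j) - d%:Z by lia.
rewrite -(hpartMr (i := d%:Z)) -?rhoE; last exact: mderiv_homog.
have hE a b : hpart (e%:Z + j) (syz_val eps 0 a * syz_val s 0 b) =
    syz_val eps 0 a * syz_val t 0 b.
  by rewrite (hpartM (i := e%:Z)) // tE; congr (_ * hpart _ _); lia.
have hN p : hpart (e%:Z + j) (- p) = - hpart (e%:Z + j) p.
  by apply/eqP; rewrite -subr_eq0 opprK -hpartD addNr hpart0.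
by case: (ord3P i) => ->; rewrite /cross /fam3 /= hpartD hN !hE.
Qed.

Definition rho_image : {pred R} := [pred p | `[< exists s, rho s = p >]].

Lemma rho_image_dimension (t u r : nat) : (t + e = r + d)%N ->
  kdim (fun s : syz f => grad_syz t s) u ->
  exists2 v, kdim (fun p : R^o => p \in rho_image /\ grad_poly r p) v &
    (u = rdim (t%:Z - e%:Z) + v)%N.
Proof.
move=> tr su; have rhoL : klinear rho by move=> c x y; rewrite linearP.
have degE : e%:Z - d%:Z + t%:Z = r%:Z by lia.
have [v vP] := kdim_image rhoL (ksub_grad_syz t) su; exists v.
  apply: kdim_ext vP => p; split=> [[s st ->]|[/asboolP[s sE] pr]].
    split; first by apply/asboolP; exists s.
    by rewrite -degE; apply: (rho_homog f_form eps_deg phi_coprime rhoE).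
  have [s' s'E] := hsyz_exists f_form t%:Z s; exists s'.
    by move=> i; rewrite s'E; apply: grad_poly_hpart.
  by rewrite (rho_hpart s'E) sE degE hpart_id.
apply: (kdim_exact rhoL (ksub_grad_syz t) su) => //.
have epsL : klinear (fun c : R^o => c *: eps).
  by move=> c x y; rewrite scalerDl -scalerA.
apply: kdim_ext (kdim_image_inj epsL (ksub_grad_poly k _) _ (kdim_homog k (t%:Z - e%:Z))).
  move=> s; split=> [[c ct ->]|[st /(rho_ker phi_coprime eps_coprime rhoE)[c cE]]].
    split; last by apply/(rho_ker phi_coprime eps_coprime rhoE); exists c.
    move=> i; rewrite syz_valZ mxE; have -> : t%:Z = (t%:Z - e%:Z) + e%:Z by lia.
    exact: grad_polyM.
  exists c => //; have [i /eqP Ei] := coprime_family_neq0 eps_coprime.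
  apply: (grad_poly_divl Ei (eps_deg i)).
  by have := st i; rewrite cE syz_valZ mxE mulrC.
by move=> c _; apply: (eps_torsion_free eps_coprime).
Qed.

Lemma ksub_ideal (I : {pred R}) t : (forall a x y, x \in I -> y \in I -> a * x + y \in I) ->
  0 \in I -> ksub (fun p : R^o => p \in I /\ grad_poly t p).
Proof.
move=> IP I0; split; first by split=> //; apply: grad_poly0.
by move=> c x y [xI xt] [yI yt]; split; [apply: IP|apply: (ksub_grad_poly k t).2].
Qed.

Lemma ksub_gradient_ideal t : ksub (fun p : R^o => p \in gradient_ideal f /\ grad_poly t p).
Proof.
apply: ksub_ideal; last by apply/asboolP; exists (fun=> 0); rewrite big1 // => i _; rewrite mul0r.
move=> b _ _ /asboolP[x ->] /asboolP[y ->]; apply/asboolP; exists (fun i => b * x i + y i).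
by rewrite mulr_sumr -big_split; apply: eq_bigr => i _ /=; ring.
Qed.

Lemma ksub_rho_image t : ksub (fun p : R^o => p \in rho_image /\ grad_poly t p).
Proof.
apply: ksub_ideal; last by apply/asboolP; exists 0; rewrite linear0.
move=> b _ _ /asboolP[x <-] /asboolP[y <-]; apply/asboolP; exists (b *: x + y).
by rewrite linearP.
Qed.

Lemma hilbert_functions m (g : 'I_m -> syz f) (a : 'rV[int]_m) :
  (forall i, grad_syz (a 0 i) (g i)) -> generates g -> irredundant g ->
  exists uJ uI : nat -> nat,
  [/\ forall t : nat, kdim (fun p : R^o => p \in gradient_ideal f /\ grad_poly t p) (uJ t),
      forall t : nat, kdim (fun p : R^o => p \in rho_image /\ grad_poly t p) (uI t) &
      exists cJ cI N, (forall t : nat, (N <= t)%N ->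
          (rdim t - uJ t)%N = cJ /\ (rdim t - uI t)%N = cI) /\
        cJ%:Z + cI%:Z = d%:Z ^+ 2 + e%:Z * (e%:Z - d%:Z)].
Proof.
move=> ga ggen girr; have [sg [sgP sgQ]] := syz_dimension ga ggen girr.
have /choice[uJ uJP] : forall t : nat, exists u,
    kdim (fun p : R^o => p \in gradient_ideal f /\ grad_poly t p) u.
  by move=> t; apply: (kdim_sub (ksub_gradient_ideal t) _ (kdim_homog k t)) => p [].
have /choice[uI uIP] : forall t : nat, exists u,
    kdim (fun p : R^o => p \in rho_image /\ grad_poly t p) u.
  by move=> t; apply: (kdim_sub (ksub_rho_image t) _ (kdim_homog k t)) => p [].
exists uJ, uI; split=> //.
have leJ (t : nat) : (uJ t <= rdim t)%N.
  by apply: (kdim_le _ (uJP t) (kdim_homog k t)) => p [].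
have leI (t : nat) : (uI t <= rdim t)%N.
  by apply: (kdim_le _ (uIP t) (kdim_homog k t)) => p [].
have EJ n : (3 * rdim (n + d)%N = sg (n + d) + uJ (n + d + d))%N.
  have [v vP ->] := gradient_ideal_dimension (sgP (n + d)%N).
  by rewrite (kdim_uniq vP (uJP _)).
have EI n : (sg (n + d) = rdim ((n + d)%N%:Z - e%:Z) + uI (n + e))%N.
  have [|v vP ->] := @rho_image_dimension (n + d)%N _ (n + e)%N _ (sgP (n + d)%N); first by lia.
  by rewrite (kdim_uniq vP (uIP _)).
pose B := d%:Z ^+ 2 + e%:Z * (e%:Z - d%:Z).
(* Both counts start from syzygies of degree [n + d]. They give R/I in degree [n + e] and R/J_f in
   degree [n + 2d]; the shift by [d] keeps both degrees natural. *)
pose A n := (rdim (n + e)%N)%:Z - (uI (n + e)%N)%:Z.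
pose A' n := (rdim (n + d + d)%N)%:Z - (uJ (n + d + d)%N)%:Z.
have AA' n : (e <= n)%N -> A n + A' n = B.
  move=> en; have := EJ n; have := EI n; have [x xE] : exists x : nat, (n + d)%N%:Z - e%:Z = x%:Z.
    by exists (n + d - e)%N; lia.
  rewrite xE /A /A' /B; have := (rdimE x, rdimE (n + d)%N, rdimE (n + e)%N, rdimE (n + d + d)%N).
  case=> -[[r1 r2] r3] r4 i1 i2.
  have xd : x%:Z = n%:Z + d%:Z - e%:Z by rewrite -xE; lia.
  rewrite [in RHS]xd in r1; rewrite expr2; lia.
have Aquad : quadratic_like A.
  have [N h] := quadratic_likeD (quadratic_like_rdim e%:Z)
    (quadratic_likeD (quadratic_likeN (sgQ d)) (quadratic_like_rdim (d%:Z - e%:Z))).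
  exists N => n /h; have AE u : A u = (rdim (u%:Z + e%:Z))%:Z +
      (- (sg (u + d)%N)%:Z + (rdim (u%:Z + (d%:Z - e%:Z)))%:Z).
    rewrite /A [u%:Z + (_ - _)]addrA -!PoszD (EI u).
    by rewrite (PoszD (rdim _)) opprD addrAC addNr add0r.
  by rewrite !AE.
(* [A' n] is nonnegative, so [B] bounds [A n]. *)
have [|c [M cM]] := @bounded_quadratic A B e Aquad.
  move=> n en; have := AA' n en; have := leI (n + e)%N; have := leJ (n + d + d)%N.
  by rewrite /A /A'; lia.
have c0 : 0 <= c.
  by rewrite -(cM M) // /A; have := leI (M + e)%N; lia.
have cB : c <= B.
  rewrite -(cM (M + e)%N) ?leq_addr // -(AA' (M + e)%N) ?leq_addl //.
  by rewrite /A'; have := leJ (M + e + d + d)%N; lia.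
exists (absz (B - c)), (absz c), (M + e + d + d)%N; split=> [t tN|]; last by rewrite -/B; lia.
have [n nE] : exists n, t = (n + d + d)%N by exists (t - d - d)%N; lia.
have [n' n'E] : exists n', t = (n' + e)%N by exists (t - e)%N; lia.
have hn : (M + e <= n)%N by lia.
have := AA' n (leq_trans (leq_addl _ _) hn); rewrite (cM n (leq_trans (leq_addr _ _) hn)).
have := cM n'; rewrite /A /A' -nE -n'E; have := leI t; have := leJ t.
by split; lia.
Qed.

End HilbertFunctions.

(** * Projective zeros *)

Section ProjectiveZeros.

Variable k : closedFieldType.

Local Notation R := {mpoly k[3]}.

(** Otherwise a basis of [S] together with the [v i] would be more than [r] independent vectors of
    [T]. *)
Lemma kdim_dependent (S T : R^o -> Prop) u r m (v : 'I_m -> R^o) :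
  (forall x, S x -> T x) -> kdim S u -> kdim T r -> (r - u < m)%N ->
  ksub S -> ksub T -> (forall i, T (v i)) ->
  exists2 w : 'rV[k]_m, w != 0 & S (kcomb v w).
Proof.
move=> ST Su Tr rum Ssub Tsub Tv; apply: contrapT => h.
have [g [gS gfree gspan]] := Su.
pose G i := match split i with inl i' => g i' | inr j => v j end.
have GE x : kcomb G x = kcomb g (lsubmx x) + kcomb v (rsubmx x).
  rewrite /kcomb big_split_ord; congr (_ + _); apply: eq_bigr => i _.
    by rewrite mxE /G -[lshift m i]/(unsplit (inl i)) unsplitK.
  by rewrite mxE /G -[rshift u i]/(unsplit (inr i)) unsplitK.
have TG i : T (G i) by rewrite /G; case: split => j //; apply: ST.
suff kG : kdim (fun p => exists x, p = kcomb G x) (u + m).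
  have : (u + m <= r)%N by apply: (kdim_le _ kG Tr) => _ [x ->]; apply: ksub_kcomb.
  by move: rum; clear; lia.
exists G; split=> [i|x|//]; first by exists (delta_mx 0 i); rewrite kcomb_delta.
rewrite GE => E; have r0 : rsubmx x = 0.
  apply/eqP; apply: contrapT => /negP r0; apply: h; exists (rsubmx x) => //.
  have -> : kcomb v (rsubmx x) = kcomb g (- lsubmx x).
    rewrite -scaleN1r kcombZ mpolyCN mpolyC1 scaleN1r; apply/eqP.
    by rewrite -subr_eq0 opprK addrC E.
  exact: ksub_kcomb.
move: E; rewrite r0 kcomb0 addr0 => /gfree l0.
by rewrite -[x]hsubmxK r0 l0 row_mx0.
Qed.

Section Homogenization.

Variables i j : 'I_3.

(** The degree [n] is a parameter and may exceed that of [P]; the excess is a power of ['X_i], which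
    saturation removes. *)
Definition homogenize n (P : {poly k}) : R :=
  \sum_(a < n.+1) (P`_a)%:MP * ('X_j ^+ a * 'X_i ^+ (n - a)).

Lemma homogenize_linear n (P : {poly k}) z : (size P <= n.+1)%N ->
  homogenize n.+1 (P * ('X - z%:P)) = ('X_j - z%:MP * 'X_i) * homogenize n P.
Proof.
move=> sP; rewrite /homogenize mulrBl.
have -> : 'X_j * (\sum_(a < n.+1) (P`_a)%:MP * ('X_j ^+ a * 'X_i ^+ (n - a))) =
    \sum_(a < n.+2) (if a == 0%N :> nat then 0 else P`_a.-1)%:MP * ('X_j ^+ a * 'X_i ^+ (n.+1 - a)).
  rewrite [RHS]big_ord_recl /= mpolyC0 mul0r add0r mulr_sumr; apply: eq_bigr => a _.
  by rewrite /= exprS subSS; ring.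
have -> : z%:MP * 'X_i * (\sum_(a < n.+1) (P`_a)%:MP * ('X_j ^+ a * 'X_i ^+ (n - a))) =
    \sum_(a < n.+2) (z * P`_a)%:MP * ('X_j ^+ a * 'X_i ^+ (n.+1 - a)).
  rewrite [RHS]big_ord_recr /= (nth_default _ sP) mulr0 mpolyC0 mul0r addr0 mulr_sumr.
  apply: eq_bigr => a _; rewrite subSn ?leq_ord // exprS mpolyCM; ring.
rewrite -sumrB; apply: eq_bigr => a _; rewrite mulrBr coefB coefMX coefMC mpolyCB.
by rewrite mulrBl [z * _]mulrC.
Qed.

Variable J : R -> Prop.
Hypothesis idJ : ideal_like J.
Hypothesis satJ : forall p, J ('X_i * p) -> J p.

(** Over a closed field the binary form splits into linear factors. Stripping them one by one leads
    from a product in [J] to [q] outside [J], so some factor crosses the border; factors ['X_i]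
    never do, by [satJ]. *)
Lemma linear_zero_divisor n (P : {poly k}) q : P != 0 -> (size P <= n.+1)%N -> ~ J q ->
  J (homogenize n P * q) ->
  exists z r, ~ J (r * q) /\ J (('X_j - z%:MP * 'X_i) * (r * q)).
Proof.
elim: n P => [|n IHn] P P0 sP Jq Jh.
  case: Jq; have P1 : size P = 1%N.
    by apply/eqP; rewrite eqn_leq sP lt0n size_poly_eq0.
  have [c c0 PE] : exists2 c, c != 0 & P = c%:P by apply/size_poly1P; rewrite P1.
  have -> : q = (c^-1)%:MP * (homogenize 0 P * q).
    by rewrite /homogenize big_ord1 PE coefC /= !expr0 !mulr1 mulrA -mpolyCM mulVf // mpolyC1 mul1r.
  exact: ideal_likeM.
have [s1|s1] := eqVneq (size P) 1%N.
  apply: (IHn P) => //; first by rewrite s1.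
  apply: satJ; rewrite mulrA; have [c c0 PE] : exists2 c, c != 0 & P = c%:P by apply/size_poly1P; rewrite s1.
  suff <- : homogenize n.+1 P = 'X_i * homogenize n P by [].
  rewrite /homogenize PE !(big_ord_recl _) /= !coefC /= !big1 ?addr0 => [|a _|a _].
  - by rewrite !subn0 exprS; ring.
  - by rewrite coefC mpolyC0 mul0r.
  - by rewrite coefC mpolyC0 mul0r.
have /closed_rootP[z /factor_theorem[Q QE]] := s1.
have Q0 : Q != 0 by apply: contraNneq P0 => Q0; rewrite QE Q0 mul0r.
have sQ : (size Q <= n.+1)%N.
  by move: sP; rewrite QE size_Mmonic ?monicXsubC // size_XsubC addn2.
rewrite QE homogenize_linear // in Jh.
have [JQ|JQ] := pselect (J (homogenize n Q * q)); first exact: (IHn Q).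
by exists z, (homogenize n Q); split=> //; rewrite mulrA.
Qed.

End Homogenization.

(** Choose a variable ['X_i] with no power in [I] and let [J] be the saturation of [I] by it.
    Boundedness makes binary forms in ['X_j] and ['X_i] dependent modulo [I], which gives linear
    zero divisors modulo [J]. If [q] outside [J] is killed modulo [J] by ['X_j - v_j 'X_i] for every
    [j], then multiplication by a form p of degree t acts on [q] as p(v) ['X_i ^+ t], so p(v) = 0
    for p in [I]. *)
Theorem bounded_Nullstellensatz (I : {pred R}) c N :
  ideal_like (fun p => p \in I) ->
  (forall t, (N <= t)%N -> exists2 u, kdim (fun p : R^o => p \in I /\ grad_poly t%:Z p) u &
     (rdim t%:Z - u)%N = c) -> (0 < c)%N ->
  exists v : 'I_3 -> k, (exists i, v i != 0) /\
    forall p t, p \in I -> p \is t.-homog -> p.@[v] = 0.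
Proof.
move=> idI hc c0.
have Isub (t : int) : ksub (fun p : R^o => p \in I /\ grad_poly t p).
  split; first by split; [exact: (ideal_like0 idI)|apply: grad_poly0].
  move=> b x y [xI xt] [yI yt]; split; first exact: idI.2.
  exact: (ksub_grad_poly k t).2.
have [i iP] : exists i, forall s, 'X_i ^+ s \notin I.
  apply: contrapT => /forallNP h; have /choice[s sI] : forall i, exists s, 'X_i ^+ s \in I.
    by move=> i; apply: contrapT => /forallNP h'; apply: (h i) => s; apply/negP.
  (* A monomial of degree at least the sum of the [s i] contains some ['X_l ^+ s l], so [I] would
     contain all forms of degree [t]. *)
  pose t := (N + \sum_i s i)%N; have [u uP uc] := hc t (leq_addr _ _).
  move: c0; rewrite -uc subn_gt0 ltnNge; apply/negP/negPn.
  apply: (kdim_le _ (kdim_homog k t) uP) => p pt; split=> //.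
  rewrite [p]mpolyE; apply: (big_ind (fun p : R => p \in I)) => [|x y|m _].
  - exact: (ideal_like0 idI).
  - exact: (ideal_likeD idI).
  have [|pm] := boolP (m \in msupp p); last first.
    by rewrite (memN_msupp_eq0 pm) scale0r; exact: (ideal_like0 idI).
  move/(dhomog_mf pt) => /= mt; rewrite -mul_mpolyC; apply: (ideal_likeM idI).
  have [l sl] : exists l, (s l <= m l)%N.
    apply: contrapT => /forallNP hl; have : (mdeg m <= \sum_i s i)%N.
      by rewrite mdegE leq_sum // => l _; rewrite ltnW // ltnNge; apply/negP.
    rewrite mt /t => Ns; have : (\sum_i m i < \sum_i s i)%N.
      rewrite !sum_ord3; have := (hl i0, hl i1, hl i2) => -[[/negP a /negP b] /negP c'].
      by rewrite -!ltnNge in a b c'; lia.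
    by rewrite -mdegE mt /t; lia.
  rewrite mpolyXE_id (bigD1 l) //= -(subnK sl) exprD mulrC mulrA.
  exact: (ideal_likeM idI).
pose J p := exists s, 'X_i ^+ s * p \in I.
have IJ p : p \in I -> J p by exists 0%N; rewrite expr0 mul1r.
have idJ : ideal_like J.
  split; first by apply: IJ; apply: (ideal_like0 idI).
  move=> a x y [s sx] [s' sy]; exists (s + s')%N.
  have -> : 'X_i ^+ (s + s') * (a * x + y) =
      a * 'X_i ^+ s' * ('X_i ^+ s * x) + 'X_i ^+ s * ('X_i ^+ s' * y) by rewrite exprD; ring.
  by apply: (ideal_likeD idI); apply: (ideal_likeM idI).
have satJ p : J ('X_i * p) -> J p.
  by move=> [s sp]; exists s.+1; rewrite exprSr -mulrA.
have J1 : ~ J 1 by move=> [s]; rewrite mulr1 (negbTE (iP s)).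
have step j q : ~ J q -> exists z r, ~ J (r * q) /\ J (('X_j - z%:MP * 'X_i) * (r * q)).
  (* The degree [N + c] is large enough for the bound to hold, and its [n + 1] binary monomials
     exceed [c]. *)
  move=> Jq; pose n := (N + c)%N; have [u uP uc] := hc n (leq_addr _ _).
  pose v (a : 'I_n.+1) : R^o := 'X_j ^+ a * 'X_i ^+ (n - a).
  have vn a : grad_poly n%:Z (v a).
    have Xn l s : grad_poly s%:Z (('X_l : R) ^+ s).
      by have := dhomogMn s (grad_polyX k l); rewrite mul1n.
    rewrite -[X in grad_poly X%:Z _](subnKC (leq_ord a)) PoszD.
    by apply: grad_polyM; apply: Xn.
  have [||w w0 wI] := kdim_dependent _ uP (kdim_homog k n) _ (Isub n) (ksub_grad_poly k n) vn.
  - by move=> x [].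
  - by rewrite uc ltnS leq_addl.
  pose P := \poly_(a < n.+1) w 0 (inord a).
  have PE (a : 'I_n.+1) : P`_a = w 0 a by rewrite coef_poly ltn_ord inord_val.
  apply: (@linear_zero_divisor i j J idJ satJ n P) => //.
  - by apply: contraNneq w0 => P0; apply/eqP/rowP => a; rewrite -PE P0 coef0 mxE.
  - exact: size_poly.
  rewrite mulrC; apply: (ideal_likeM idJ); apply: IJ.
  suff -> : homogenize i j n P = kcomb v w by case: wI.
  by apply: eq_bigr => a _; rewrite PE.
have [z0 [r0 [Jr0 Jz0]]] := step i0 1 J1.
have [z1 [r1 [Jr1 Jz1]]] := step i1 _ Jr0.
have [z2 [r2 [Jr2 Jz2]]] := step i2 _ Jr1.
(* Later multipliers keep the linear relations already obtained, so [q] satisfies all three. *)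
pose q := r2 * (r1 * (r0 * 1)); pose v := fam3 z0 z1 z2.
have Jv j : J (('X_j - (v j)%:MP * 'X_i) * q).
  case: (ord3P j) => ->; rewrite /v /fam3 /=; last by [].
    rewrite (_ : _ * q = r2 * r1 * (('X_i0 - z0%:MP * 'X_i) * (r0 * 1))); last by rewrite /q; ring.
    exact: ideal_likeM.
  rewrite (_ : _ * q = r2 * (('X_i1 - z1%:MP * 'X_i) * (r1 * (r0 * 1)))); last by rewrite /q; ring.
  exact: ideal_likeM.
have Jq : ~ J q by [].
clearbody q.
have vi : v i = 1.
  apply/eqP; apply: contrapT => /negP vi; apply: Jq; apply: satJ.
  have -> : 'X_i * q = ((1 - v i)^-1)%:MP * (('X_i - (v i)%:MP * 'X_i) * q).
    have -> : 'X_i - (v i)%:MP * 'X_i = (1 - v i)%:MP * 'X_i.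
      by rewrite mpolyCB mpolyC1 mulrBl mul1r.
    transitivity (((1 - v i)^-1 * (1 - v i))%:MP * ('X_i * q)).
      by rewrite mulVf ?mpolyC1 ?mul1r // subr_eq0 eq_sym.
    by rewrite mpolyCM; ring.
  exact: ideal_likeM.
exists v; split; first by exists i; rewrite vi oner_eq0.
move=> p t pI pt; apply/eqP; apply: contrapT => /negP pv; apply: Jq.
(* The ideal quotient J : q, modulo which ['X_j] and [v j] times ['X_i] agree. *)
pose K r := J (r * q).
have KM a b a' b' : K (a - a') -> K (b - b') -> K (a * b - a' * b').
  move=> Ka Kb; rewrite /K.
  have -> : (a * b - a' * b') * q = b * ((a - a') * q) + a' * ((b - b') * q) by ring.
  by apply: (ideal_likeD idJ); apply: (ideal_likeM idJ).
have K0 a : K (a - a) by rewrite /K subrr mul0r; apply: ideal_like0.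
have KX m : K ('X_[m] - (\prod_l v l ^+ m l)%:MP * 'X_i ^+ mdeg m).
  rewrite mpolyXE_id rmorph_prod mdegE -prodrXr -big_split /=.
  apply: (big_ind2 (fun a b => K (a - b))) => [|a a' b b'|l _]; [exact: K0|exact: KM|].
  rewrite rmorphXn -exprMn /=; elim: (m l) => [|s IHs]; first by rewrite !expr0; apply: K0.
  by rewrite !exprS; apply: KM => //; apply: Jv.
have Kp : K (p - p.@[v]%:MP * 'X_i ^+ t).
  rewrite mevalE rmorph_sum /= mulr_suml {1}[p]mpolyE -sumrB /K mulr_suml.
  rewrite big_seq; apply: (big_ind J) => [|x y|m mp]; first exact: ideal_like0.
    exact: ideal_likeD.
  have <- := dhomog_mf pt mp; rewrite /= -mul_mpolyC rmorphM /= -mulrA -mulrBr -mulrA.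
  by apply: (ideal_likeM idJ); apply: KX.
have Jpv : J (p.@[v]%:MP * 'X_i ^+ t * q).
  have -> : p.@[v]%:MP * 'X_i ^+ t * q = q * p - (p - p.@[v]%:MP * 'X_i ^+ t) * q by ring.
  by apply: (ideal_likeB idJ) => //; apply: (ideal_likeM idJ); apply: IJ.
have : J ('X_i ^+ t * q).
  have -> : 'X_i ^+ t * q = ((p.@[v])^-1)%:MP * (p.@[v]%:MP * 'X_i ^+ t * q).
    by rewrite !mulrA -mpolyCM mulVf // mpolyC1 mul1r.
  exact: ideal_likeM.
elim: (t) => [|s IHs]; first by rewrite expr0 mul1r.
by rewrite exprS -mulrA => /satJ.
Qed.

End ProjectiveZeros.

(** * Heights of prime ideals *)

Section PrimeIdeals.

Variable R : comNzRingType.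

Lemma idealr_exists (S : {pred R}) : idealr_closed S ->
  exists I : idealr R, (I : {pred R}) =i S.
Proof.
move=> hS; pose I := HB.pack_for (idealr R) (S : R -> bool) (isIdealr.Build R S hS).
by exists I.
Qed.

Lemma prime_idealr_exists (S : {pred R}) : idealr_closed S -> prime_idealr_closed S ->
  exists P : prime_idealr R, (P : {pred R}) =i S.
Proof.
move=> hS pS; pose P := HB.pack_for (prime_idealr R) (S : R -> bool)
  (isIdealr.Build R S hS) (isPrimeIdealrClosed.Build R S pS).
by exists P.
Qed.

(* Only the lowest power of [y] with a nonzero coefficient matters. *)
Lemma lowest_coefficient (Q Q' : prime_idealr R) N y (G : 'I_N -> R) (nz : 'I_N -> Prop) :
  {subset Q <= Q'} -> y \in Q' -> y \notin Q ->
  (forall a, ~ nz a -> G a = 0) -> (exists a, nz a) ->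
  \sum_(a < N) y ^+ a * G a \in Q -> exists2 a, nz a & G a \in Q'.
Proof.
move=> QQ' yQ' yQ Gnz [a0 a0nz] sQ.
have [a anz amin] := @arg_minnP _ a0 (fun a => `[< nz a >]) val (asboolT a0nz).
exists a; first exact/asboolP.
have [r rE] : exists r, \sum_(b < N) y ^+ b * G b = y ^+ a * (G a + y * r).
  exists (\sum_(b | b != a) y ^+ (b - a).-1 * G b).
  rewrite (bigD1 a) //= mulrDr mulrA -exprSr mulr_sumr; congr (_ + _).
  apply: eq_bigr => b ba; have [nb|nb] := pselect (nz b); last by rewrite Gnz // !mulr0.
  rewrite mulrA -exprD; congr (y ^+ _ * _).
  have : (a <= b)%N by apply: amin; apply/asboolP.
  by rewrite leq_eqVlt => /orP[/eqP/val_inj e|]; [rewrite e eqxx in ba|lia].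
have : G a + y * r \in Q.
  move: sQ; rewrite rE prime_idealrM => /orP[|//].
  by elim: (nat_of_ord a) => [|n IHn]; rewrite ?expr0 ?idealr1 // exprS prime_idealrM (negbTE yQ).
move/QQ' => h; have -> : G a = (G a + y * r) - r * y by rewrite [r * y]mulrC addrK.
by apply: rpredB => //; apply: idealMr.
Qed.

End PrimeIdeals.

(** * Chains of primes in k[x,y,z] have length at most three *)

Section KrullDimension.

Variable k : closedFieldType.

Local Notation R := {mpoly k[3]}.

Lemma msize_mul (p q : R) a b : (msize p <= a.+1)%N -> (msize q <= b.+1)%N ->
  (msize (p * q) <= (a + b).+1)%N.
Proof.
move=> pa qb; have [->|p0] := eqVneq p 0; first by rewrite mul0r msize0.
have [->|q0] := eqVneq q 0; first by rewrite mulr0 msize0.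
by rewrite msizeM //; move: pa qb; move: (msize p) (msize q) => x z; lia.
Qed.

Lemma msize_exp (y : R) D a : (msize y <= D.+1)%N -> (msize (y ^+ a) <= (a * D).+1)%N.
Proof.
move=> yD; elim: a => [|a IHa]; first by rewrite expr0 msize1.
by rewrite exprS mulSn; apply: msize_mul.
Qed.

Lemma card_bmultinom B : (#|{: 'X_{1..3 < B.+1}}| <= B.+1 ^ 3)%N.
Proof.
pose h (m : 'X_{1..3 < B.+1}) : 'I_B.+1 * ('I_B.+1 * 'I_B.+1) :=
  (inord (m i0), (inord (m i1), inord (m i2))).
have -> : (B.+1 ^ 3 = #|{: 'I_B.+1 * ('I_B.+1 * 'I_B.+1)}|)%N by rewrite !card_prod card_ord.
apply: (leq_card h) => m m'; have mB (n : 'X_{1..3 < B.+1}) l : (n l < B.+1)%N.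
  by apply: leq_ltn_trans (bmdeg n); rewrite mdegE (bigD1 l) //= leq_addr.
case=> /(congr1 val) /= e0 /(congr1 val) /= e1 /(congr1 val) /= e2.
rewrite !inordK // in e0 e1 e2; apply/val_inj/mnmP => l.
by case: (ord3P l) => ->.
Qed.

(** The N^4 monomials in the [y i] with exponents below [N] lie in the space of polynomials of
    degree at most [B], of dimension at most (B+1)^3. The sum is nested so that lowest coefficients
    can be extracted one variable at a time. *)
Lemma algebraic_dependence (y : 'I_4 -> R) : exists N (w : 'I_N -> 'I_N -> 'I_N -> 'I_N -> k),
  (exists a b c e, w a b c e != 0) /\
  \sum_(a < N) y ord0 ^+ a * (\sum_(b < N) y (inord 1) ^+ b * (\sum_(c < N) y (inord 2) ^+ c *
    (\sum_(e < N) y (inord 3) ^+ e * (w a b c e)%:MP))) = 0.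
Proof.
pose D := (\sum_i msize (y i))%N.
have yD i : (msize (y i) <= D.+1)%N by apply: leqW; rewrite /D (bigD1 i) //= leq_addr.
(* Since B + 1 <= N(4D+1), the dimension is at most N^3 (4D+1)^3, and [N] is chosen just above
   (4D+1)^3 to make this smaller than N^4. *)
pose N := ((4 * D + 1) ^ 3).+1; pose B := (4 * (N * D))%N.
pose T := ('I_N * ('I_N * ('I_N * 'I_N)))%type.
pose mon (x : T) : R := y ord0 ^+ x.1 * (y (inord 1) ^+ x.2.1 *
  (y (inord 2) ^+ x.2.2.1 * y (inord 3) ^+ x.2.2.2)).
have monB x : (msize (mon x) <= B.+1)%N.
  have h i (a : 'I_N) : (msize (y i ^+ a) <= (N * D).+1)%N.
    by apply: leq_trans (msize_exp a (yD i)) _; rewrite ltnS leq_mul2r ltnW ?orbT.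
  have -> : B = (N * D + (N * D + (N * D + N * D)))%N by rewrite /B; lia.
  by rewrite /mon; do 3!apply: msize_mul => //.
pose A := \matrix_(i < #|{: T}|, j < #|{: 'X_{1..3 < B.+1}}|) (mon (enum_val i))@_(bmnm (enum_val j)).
have : kermx A != 0.
  rewrite kermx_eq0; apply/negP => /eqP rk.
  have := rank_leq_col A; rewrite rk leqNgt => /negP; apply.
  apply: leq_ltn_trans (card_bmultinom B) _; rewrite !card_prod card_ord.
  have h1 : (B.+1 <= N * (4 * D + 1))%N by rewrite /B; have : (0 < N)%N by []; lia.
  have h2 : (B.+1 ^ 3 <= (N * (4 * D + 1)) ^ 3)%N by rewrite leq_exp2r.
  apply: leq_ltn_trans h2 _.
  have -> : (N * (N * (N * N)) = N ^ 3 * N)%N by rewrite !expnSr expn0 mul1n !mulnA.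
  by rewrite expnMn ltn_pmul2l ?expn_gt0.
case/rowV0Pn => v /sub_kermxP vA v0.
exists N, (fun a b c e => v 0 (enum_rank ((a, (b, (c, e))) : T))); split.
  have [i vi] : exists i, v 0 i != 0.
    apply: contrapT => /forallNP h; case/negP: v0; apply/eqP/rowP => i; rewrite mxE.
    by apply/eqP; apply: contraT => vi; case: (h i).
  move: vi; rewrite -(enum_valK i); case: (enum_val i) => a [b [c e]] h.
  by exists a, b, c, e.
transitivity (\sum_(x : T) mon x * (v 0 (enum_rank x))%:MP).
  transitivity (\sum_a \sum_(x : 'I_N * ('I_N * 'I_N)) mon (a, x) * (v 0 (enum_rank ((a, x) : T)))%:MP); last first.
    by rewrite pair_bigA; apply: eq_bigr => -[].
  apply: eq_bigr => a _; rewrite mulr_sumr.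
  transitivity (\sum_b \sum_(x : 'I_N * 'I_N) mon (a, (b, x)) * (v 0 (enum_rank ((a, (b, x)) : T)))%:MP); last first.
    by rewrite pair_bigA; apply: eq_bigr => -[].
  apply: eq_bigr => b _; rewrite mulr_sumr mulr_sumr.
  transitivity (\sum_c \sum_e mon (a, (b, (c, e))) * (v 0 (enum_rank ((a, (b, (c, e))) : T)))%:MP); last first.
    by rewrite pair_bigA; apply: eq_bigr => -[].
  apply: eq_bigr => c _; rewrite !mulr_sumr; apply: eq_bigr => e _.
  by rewrite /mon /= !mulrA.
have sB : (msize (\sum_(x : T) mon x * (v 0 (enum_rank x))%:MP) <= B.+1)%N.
  apply: leq_trans (msize_sum _ _ _) _; apply/bigmax_leqP => x _.
  by rewrite mulrC mul_mpolyC; apply: leq_trans (msizeZ_le _ _) _.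
rewrite (mpolywE sB) big1 // => m _; rewrite (_ : _@_m = 0) ?scale0r //.
rewrite raddf_sum /=; have /rowP/(_ (enum_rank m)) := vA; rewrite !mxE => E; rewrite -[RHS]E.
rewrite (reindex _ (onW_bij _ (@enum_val_bij T))) /=.
apply: eq_bigr => i _; rewrite mxE enum_rankK enum_valK.
by rewrite mulrC mul_mpolyC mcoeffZ.
Qed.

(** Pick [y i] in [Q i.+1] outside [Q i]. The dependence puts 0 in [Q 0]; its lowest coefficient in
    the first element lies in [Q 1], the lowest coefficient of that in [Q 2], and so on, until a
    nonzero constant lies in [Q 4]. *)
Theorem no_prime_chain (Q : nat -> prime_idealr R) :
  (forall i, (i < 4)%N -> {subset Q i <= Q i.+1} /\ ~ {subset Q i.+1 <= Q i}) -> False.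
Proof.
move=> QP; have /choice[y yP] : forall i : 'I_4, exists y, y \in Q i.+1 /\ y \notin Q i.
  move=> i; have [_ h] := QP i (ltn_ord i); apply: contrapT => /forallNP h'.
  by apply: h => y yQ; apply: contraT => yn; case: (h' y).
have [N [w [[a' [b' [c' [e' we]]]] E]]] := algebraic_dependence y.
have y1 : (inord 1 : 'I_4) = 1%N :> nat by rewrite inordK.
have y2 : (inord 2 : 'I_4) = 2%N :> nat by rewrite inordK.
have y3 : (inord 3 : 'I_4) = 3%N :> nat by rewrite inordK.
have [Y0 Y0n] := yP ord0; have := yP (inord 1); have := yP (inord 2); have := yP (inord 3).
rewrite y1 y2 y3 => -[Y3 Y3n] [Y2 Y2n] [Y1 Y1n].
have sub i (hi : (i < 4)%N) : {subset Q i <= Q i.+1} := (QP i hi).1.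
have z3 a b c : ~ (exists e, w a b c e != 0) ->
    \sum_(e < N) y (inord 3) ^+ e * (w a b c e)%:MP = 0.
  move=> h; rewrite big1 // => e _; have [->|we'] := eqVneq (w a b c e) 0.
    by rewrite mpolyC0 mulr0.
  by case: h; exists e.
have z2 a b : ~ (exists c e, w a b c e != 0) ->
    \sum_(c < N) y (inord 2) ^+ c * (\sum_(e < N) y (inord 3) ^+ e * (w a b c e)%:MP) = 0.
  by move=> h; rewrite big1 // => c _; rewrite z3 ?mulr0 // => ?; apply: h; exists c.
have z1 a : ~ (exists b c e, w a b c e != 0) -> \sum_(b < N) y (inord 1) ^+ b *
    (\sum_(c < N) y (inord 2) ^+ c * (\sum_(e < N) y (inord 3) ^+ e * (w a b c e)%:MP)) = 0.
  by move=> h; rewrite big1 // => b _; rewrite z2 ?mulr0 // => ?; apply: h; exists b.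
have E0 := idealr0 (Q 0%N); rewrite -E in E0.
have [|a1 w1 E1] := lowest_coefficient (sub 0%N isT) Y0 Y0n z1 _ E0.
  by exists a', b', c', e'.
have [b1 w2 E2] := lowest_coefficient (sub 1%N isT) Y1 Y1n (z2 a1) w1 E1.
have [c1 w3 E3] := lowest_coefficient (sub 2%N isT) Y2 Y2n (z3 a1 b1) w2 E2.
have [|e1 w4 E4] := lowest_coefficient (nz := fun e => w a1 b1 c1 e != 0)
  (sub 3%N isT) Y3 Y3n _ w3 E3.
  by move=> e /negP; rewrite negbK => /eqP ->; rewrite mpolyC0.
have := idealMr ((w a1 b1 c1 e1)^-1)%:MP E4.
by rewrite -mpolyCM mulVf // mpolyC1 idealr1.
Qed.

End KrullDimension.

(** * Codimension of ideals without common factor that vanish at a point *)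

Section CodimensionTwo.

Variable k : closedFieldType.

Local Notation R := {mpoly k[3]}.

(** Primality of [P] and minimality of the degree make [p] irreducible, and irreducible elements of
    a gcd domain are prime. *)
Lemma principal_prime (P : prime_idealr R) (p : R) : p != 0 -> p \in P ->
  (forall q, q \in P -> q != 0 -> (msize p <= msize q)%N) ->
  exists Q : prime_idealr R, forall q, q \in Q <-> rdvd p q.
Proof.
move=> p0 pP pmin; pose S : {pred R} := [pred q | `[< rdvd p q >]].
have SE q : q \in S <-> rdvd p q by split=> [/asboolP|?]; last exact/asboolP.
have p1 : ~ rdvd p 1.
  by move=> [u uE]; have := idealMr u pP; rewrite mulrC -uE idealr1.
have [Q QE] : exists Q : prime_idealr R, (Q : {pred R}) =i S.
  apply: prime_idealr_exists.
    split; [exact/SE/rdvd0|by apply/negP => /SE|].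
    by move=> a u v /SE pu /SE pv; apply/SE/rdvdD => //; apply: rdvd_mull.
  move=> a b /SE[c abE].
  have [g [p' [a' [pE aE cpa]]]] := @gcd_domain_mpoly 3 k p a.
  have g0 : g != 0 by apply: contraNneq p0 => z; rewrite pE z mul0r.
  have p'0 : p' != 0 by apply: contraNneq p0 => z; rewrite pE z mulr0.
  (* A factor of [p] that lies in [P] has the full degree of [p], so the other factor is
     constant. *)
  have unit_of (x y : R) : p = x * y -> x \in P -> rdvd y 1.
    move=> E xP; have x0 : x != 0 by apply: contraNneq p0 => z; rewrite E z mul0r.
    have y0 : y != 0 by apply: contraNneq p0 => z; rewrite E z mulr0.
    apply: const_rdvd1 => //; apply: msize1_polyC.
    have := pmin x xP x0; rewrite {1}E (msizeM x0 y0).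
    have : (0 < msize x)%N by rewrite lt0n msize_poly_eq0.
    by move: (msize x) (msize y) => m n; lia.
  have : g * p' \in P by rewrite -pE.
  rewrite prime_idealrM => /orP[gP|p'P]; apply/orP.
    left; apply/SE; have [u u1] := unit_of _ _ pE gP.
    by exists (u * a'); rewrite aE pE -[LHS]mulr1 u1; ring.
  right; apply/SE; have [u u1] := unit_of p' g (etrans pE (mulrC _ _)) p'P.
  have [t tE] : rdvd p' b.
    apply: cpa; first by exists b; rewrite mulrC.
    exists c; apply: (mulfI g0); transitivity (a * b); first by rewrite aE; ring.
    by rewrite abE pE; ring.
  by exists (u * t); rewrite tE pE -[LHS]mulr1 u1; ring.
by exists Q => q; rewrite QE.
Qed.

Definition coprime_set (I : {pred R}) :=
  forall a b, (forall x, x \in I -> rdvd a (b * x)) -> rdvd a b.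

(** A nonzero [p] of least degree in [P] gives the chain 0 < (p) < P. The last inclusion is strict,
    since otherwise [p] would divide all of [I] and be a unit. *)
Lemma coprime_height_ge2 (I : {pred R}) (P : prime_idealr R) : coprime_set I ->
  {subset I <= P} -> height_ge P 2.
Proof.
move=> cI IP.
have [x [xI x0]] : exists x, x \in I /\ x != 0.
  apply: contrapT => /forallNP h; have [|c /eqP] := cI 0 1; last by rewrite mul0r oner_eq0.
  move=> x xI; have [->|x0] := eqVneq x 0; first by rewrite mulr0; apply: rdvd0.
  by case: (h x).
have exn : exists n, `[< exists q, [/\ q \in P, q != 0 & msize q = n] >].
  by exists (msize x); apply/asboolP; exists x; split=> //; apply: IP.
case: (ex_minnP exn) => n /asboolP[p [pP p0 pn]] nmin.
have pmin q : q \in P -> q != 0 -> (msize p <= msize q)%N.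
  by move=> qP q0; rewrite pn; apply: nmin; apply/asboolP; exists q.
have [Q QE] := principal_prime p0 pP pmin.
have [Z ZE] : exists Z : prime_idealr R, (Z : {pred R}) =i [pred q | q == 0].
  apply: prime_idealr_exists; last by move=> u v; rewrite !inE mulf_eq0.
  split; rewrite ?inE ?eqxx ?oner_eq0 // => a u v; rewrite !inE => /eqP -> /eqP ->.
  by rewrite mulr0 addr0.
exists (fun i => match i with 0 => Z | 1 => Q | _ => P end); split=> // -[|[|//]] _.
- split=> [q|]; first by rewrite ZE => /eqP ->; apply: idealr0.
  have pQ : p \in Q by apply/QE/rdvd_refl.
  by move=> /(_ p pQ); rewrite ZE inE (negbTE p0).
- split=> [q /QE[c ->]|PQ]; first by rewrite mulrC idealMr.
  have [|c cE] := cI p 1; first by move=> y yI; rewrite mul1r; apply/QE/PQ/IP.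
  by have := idealMr c pP; rewrite mulrC -cE idealr1.
Qed.

Variable v : 'I_3 -> k.
Hypothesis v0 : exists i, v i != 0.

(** Restriction to the line through the origin and [v]; the kernel is the homogeneous prime of the
    projective point [v]. *)
Definition on_line (p : R) : {poly k} := mmap (@polyC k) (fun i => v i *: 'X) p.

Lemma on_line_linear p q r : on_line (p * q + r) = on_line p * on_line q + on_line r.
Proof. by rewrite /on_line mmapD; congr (_ + _); apply: rmorphM. Qed.

Lemma on_lineM p q : on_line (p * q) = on_line p * on_line q.
Proof. by have := on_line_linear p q 0; rewrite addr0 => ->; rewrite /on_line mmap0 addr0. Qed.

Lemma on_line_eval1 p : (on_line p).[1] = p.@[v].
Proof.
elim/mpoly_closure: p => [c|i|p q IHp IHq|p q IHp IHq].
- by rewrite /on_line mmapC hornerC mevalC.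
- by rewrite /on_line mmapX mmap1U mevalXU hornerZ hornerX mulr1.
- by rewrite /on_line mmapD hornerD -/(on_line _) IHp -/(on_line _) IHq mevalD.
- by rewrite on_lineM hornerM IHp IHq mevalM.
Qed.

Lemma on_line_homog p t : p \is t.-homog -> on_line p = p.@[v] *: 'X^t.
Proof.
move=> pt; rewrite /on_line mevalE scaler_suml {1}/mmap big_seq [RHS]big_seq.
apply: eq_bigr => m mp; have /= <- := dhomog_mf pt mp.
rewrite mul_polyC -scalerA; congr (_ *: _).
rewrite /mmap1 mdegE -prodrXr -scaler_prod; apply: eq_bigr => i _.
by rewrite exprZn.
Qed.

(** This prime is strictly contained in the maximal ideal [M] of the affine point [v], as [v] is
    nonzero. A chain of length three ending in it would extend by [M] to one of length four. *)
Lemma point_prime : exists P : prime_idealr R,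
  (forall p, p \in P <-> on_line p = 0) /\ ~ height_ge P 3.
Proof.
have on1 : on_line 1 = 1 by rewrite /on_line -mpolyC1 mmapC.
have on0 : on_line 0 = 0 by rewrite /on_line mmap0.
have [P PE] : exists P : prime_idealr R, (P : {pred R}) =i [pred p | on_line p == 0].
  apply: prime_idealr_exists; last by move=> p q; rewrite !inE on_lineM mulf_eq0.
  split; rewrite ?inE ?on0 ?on1 ?oner_eq0 ?eqxx // => a p q.
  by rewrite !inE on_line_linear => /eqP -> /eqP ->; rewrite mulr0 addr0.
have [M ME] : exists M : prime_idealr R, (M : {pred R}) =i [pred p | p.@[v] == 0].
  apply: prime_idealr_exists; last by move=> p q; rewrite !inE mevalM mulf_eq0.
  split; rewrite ?inE ?meval0 ?meval1 ?oner_eq0 ?eqxx // => a p q.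
  by rewrite !inE mevalD mevalM => /eqP -> /eqP ->; rewrite mulr0 addr0.
exists P; split=> [p|[Q [Q3 QP]]]; first by rewrite PE inE; split=> /eqP.
pose Q' i := if (i < 4)%N then Q i else M.
apply: (@no_prime_chain k Q') => -[|[|[|[|//]]]] _; try exact: QP.
rewrite /Q' /=; split=> [p|]; first by rewrite Q3 PE ME !inE -on_line_eval1 => /eqP ->; rewrite horner0.
have [i vi] := v0; move=> /(_ ('X_i - (v i)%:MP)).
rewrite ME Q3 PE !inE mevalB mevalXU mevalC subrr eqxx => /(_ isT).
rewrite /on_line mmapB mmapX mmap1U mmapC subr_eq0 => /eqP/(congr1 (coefp 1)).
by rewrite /= coefZ coefX coefC mulr1 => /eqP; rewrite (negbTE vi).
Qed.

Lemma has_codim2 (I : {pred R}) : coprime_set I ->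
  (forall p n, p \in I -> pihomog mdeg n p \in I) ->
  (forall p t, p \in I -> p \is t.-homog -> p.@[v] = 0) -> has_codim I 2.
Proof.
move=> cI hI zI; split=> [P IP|]; first exact: coprime_height_ge2 cI IP.
have [P [PE P3]] := point_prime; exists P; split=> // p pI.
rewrite (hpart_partition p); apply: rpred_sum => i _; apply/PE.
by rewrite (on_line_homog (pihomogP _ _ _)) (zI _ i) ?scale0r ?pihomogP //; apply: hI.
Qed.

End CodimensionTwo.

(** * Freeness *)

Section FreeModules.

Variables (R : comNzRingType) (M : lmodType R).

Lemma pack_linear (N N' : lmodType R) (h : N -> N') : linear h ->
  exists h' : {linear N -> N'}, h' =1 h.
Proof.
move=> hL; pose h' := HB.pack_for {linear N -> N'} h (GRing.isLinear.Build R N N' _ h hL).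
by exists h'.
Qed.

(** A basis may be infinite, so coordinates are a finite support together with a function that
    vanishes off it. *)
Definition coordinates (B : M -> Prop) (x : M) (sc : seq M * (M -> R)) :=
  [/\ uniq sc.1, forall y, y \in sc.1 -> B y, forall y, y \notin sc.1 -> sc.2 y = 0
    & x = \sum_(y <- sc.1) sc.2 y *: y].

Lemma sum_support (N : lmodType R) (h : M -> N) (s s' : seq M) (c : M -> R) :
  uniq s -> uniq s' -> {subset s <= s'} -> (forall y, y \notin s -> c y = 0) ->
  \sum_(y <- s') c y *: h y = \sum_(y <- s) c y *: h y.
Proof.
move=> us us' ss' c0; rewrite (bigID (mem s)) /= [X in _ + X]big1 ?addr0; last first.
  by move=> y ys; rewrite c0 // scale0r.
rewrite -big_filter; apply: perm_big; apply: uniq_perm => //; first exact: filter_uniq.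
by move=> y; rewrite mem_filter; case: (boolP (y \in s)) => // /ss' ->.
Qed.

Lemma basis_coordinates B x : is_basis B -> exists sc, coordinates B x sc.
Proof.
case=> /(_ x)[n [b [v [Bb ->]]]] _.
pose s := undup (codom b); pose c y := \sum_(i | b i == y) v 0 i.
exists (s, c); split=> /=.
- exact: undup_uniq.
- by move=> y; rewrite mem_undup => /codomP[i ->].
- move=> y; rewrite mem_undup => ys; rewrite /c big_pred0 // => i.
  by apply: contraNF ys => /eqP <-; apply: codom_f.
rewrite /lincomb; under [RHS]eq_bigr do rewrite scaler_suml.
rewrite (exchange_big_dep xpredT) //=; apply: eq_bigr => i _.
rewrite -big_filter (_ : [seq y <- s | b i == y] = [:: b i]) ?big_seq1 //.
apply: perm_small_eq => //; apply: uniq_perm => //; first by rewrite filter_uniq ?undup_uniq.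
move=> y; rewrite mem_filter mem_seq1 eq_sym andb_idr // => /eqP ->.
by rewrite mem_undup codom_f.
Qed.

Lemma basis_unique B s (c : M -> R) : is_basis B -> uniq s -> (forall y, y \in s -> B y) ->
  \sum_(y <- s) c y *: y = 0 -> forall y, y \in s -> c y = 0.
Proof.
case=> _ Bfree us sB c0 y ys.
pose b i := tnth (in_tuple s) i; pose v := \row_i c (b i).
have /rowP v0 : v = 0.
  apply: (Bfree _ b) => [i||]; first by apply: sB; apply: mem_tnth.
    exact/(tuple_uniqP (in_tuple s)).
  rewrite -[RHS]c0 (big_tnth _ _ s); apply: eq_bigr => i _; by rewrite mxE.
have /tnthP[i ->] : y \in in_tuple s by [].
by have := v0 i; rewrite !mxE.
Qed.

Lemma free_projective : free_module M -> projective M.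
Proof.
case=> B bB A N g h gsurj.
have /choice[sc scP] : forall x, exists sc, coordinates B x sc by move=> x; apply: basis_coordinates.
have /choice[l lP] : forall y : M, exists a, g a = h y by move=> y; apply: gsurj.
pose h' x := \sum_(y <- (sc x).1) (sc x).2 y *: l y.
have sB z t : t \in (sc z).1 -> B t by have [_ h1 _ _] := scP z; apply: h1.
have h'L : linear h'.
  (* The supports of [x], [y] and [a *: x + y] differ; linearity is compared on their union. *)
  move=> a x y; pose s := undup ((sc x).1 ++ (sc y).1 ++ (sc (a *: x + y)).1).
  have us : uniq s by apply: undup_uniq.
  have sub z : z = x \/ z = y \/ z = a *: x + y -> {subset (sc z).1 <= s}.
    by move=> zE t tz; rewrite mem_undup !mem_cat; case: zE tz => [->|[->|->]] ->; rewrite ?orbT.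
  have ext (N' : lmodType R) (q : M -> N') z : z = x \/ z = y \/ z = a *: x + y ->
      \sum_(t <- (sc z).1) (sc z).2 t *: q t = \sum_(t <- s) (sc z).2 t *: q t.
    move=> zE; have [u _ z0 _] := scP z; symmetry; apply: sum_support => //; exact: sub.
  have [Ux Uy Uz] : [/\ x = \sum_(t <- s) (sc x).2 t *: t, y = \sum_(t <- s) (sc y).2 t *: t
      & a *: x + y = \sum_(t <- s) (sc (a *: x + y)).2 t *: t].
    by split; [have [_ _ _ {1}->] := scP x|have [_ _ _ {1}->] := scP y
              |have [_ _ _ {1}->] := scP (a *: x + y)]; apply: (ext M id); tauto.
  have cE t : t \in s -> (sc (a *: x + y)).2 t = a * (sc x).2 t + (sc y).2 t.
    move=> ts; apply/eqP; rewrite -subr_eq0; apply/eqP.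
    apply: (basis_unique (c := fun t => (sc (a *: x + y)).2 t - (a * (sc x).2 t + (sc y).2 t)) bB us) => //.
      move=> z; rewrite mem_undup !mem_cat => /or3P[]; apply: sB.
    under eq_bigr do rewrite scalerBl scalerDl -scalerA.
    by rewrite sumrB big_split /= -scaler_sumr -Ux -Uy -Uz subrr.
  rewrite /h' !ext; try tauto.
  rewrite scaler_sumr -big_split; apply: eq_big_seq => t /cE -> /=.
  by rewrite scalerDl scalerA.
have [k kE] := pack_linear h'L; exists k => x; rewrite kE /h'.
have [_ _ _ xE] := scP x; apply: etrans (congr1 h (esym xE)).
rewrite !linear_sum; apply: eq_bigr => y _.
by rewrite !linearZ_LR lP.
Qed.

End FreeModules.

Section Sections.

Variable k : closedFieldType.

Local Notation R := {mpoly k[3]}.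

Lemma meval_origin (p : R) : p.@[fun=> 0] = p@_0.
Proof.
elim/mpoly_closure: p => [c|i|p q IHp IHq|p q IHp IHq].
- by rewrite mevalC mcoeffC eqxx mulr1.
- by rewrite mevalXU mcoeffX mnm1_eq0.
- by rewrite mevalD IHp IHq mcoeffD.
by rewrite mevalM IHp IHq; case: (mcoeff0_is_multiplicative 3 k) => h _; rewrite h.
Qed.

(** The determinant takes the value 1 at the origin, so it is nonzero, and the adjugate
    concludes. *)
Lemma unimodular_at_origin n (Q : 'M[R]_n) (v : 'rV[R]_n) :
  (forall i j, (Q i j)@_0 = (i == j)%:R) -> v *m Q = 0 -> v = 0.
Proof.
move=> Q1 vQ; have detQ : \det Q != 0.
  have : (\det Q).@[fun=> 0] = 1.
    rewrite -(det_map_mx (meval (fun=> 0 : k))) -[RHS](det1 k n); congr (\det _).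
    apply/matrixP => i j; rewrite !mxE; apply: etrans (meval_origin _) _; exact: Q1.
  by apply: contra_eqN => /eqP ->; rewrite meval0 eq_sym oner_eq0.
have : v *m Q *m \adj Q = 0 by rewrite vQ mul0mx.
rewrite -mulmxA mul_mx_adj mul_mx_scalar => /rowP h.
by apply/rowP => i; have := h i; rewrite !mxE => /eqP; rewrite mulf_eq0 (negbTE detQ) => /eqP.
Qed.

(* The matrix of [h o lincomb g] is the identity modulo (x, y, z). *)
Lemma section_independent (M : lmodType R) n (g : 'I_n -> M) (h : M -> 'rV[R]_n) :
  linear h -> (forall i, lincomb g (h (g i)) = g i) ->
  (forall v, lincomb g v = 0 -> forall i, (v 0 i)@_0 = 0) ->
  forall v, lincomb g v = 0 -> v = 0.
Proof.
move=> hL hg rel v v0; have [h' h'E] := pack_linear hL.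
apply: (@unimodular_at_origin _ (\matrix_i h (g i))).
  move=> i j; rewrite mxE; have := rel (h (g i) - delta_mx 0 i) _ j.
  rewrite lincombB hg lincomb_delta subrr => /(_ erefl).
  by rewrite !mxE mcoeffB eqxx /= eq_sym => /eqP; rewrite subr_eq0 => /eqP ->; case: (i == j); rewrite ?mcoeff1 ?mcoeff0 ?eqxx.
have := congr1 h' v0; rewrite linear0 lincomb_map => E; rewrite -[RHS]E mulmx_sum_row.
by apply: eq_bigr => i _; rewrite rowK /= h'E.
Qed.

Lemma projective_independent (M : lmodType R) n (g : 'I_n -> M) :
  projective M -> generates g ->
  (forall v, lincomb g v = 0 -> forall i, (v 0 i)@_0 = 0) ->
  forall v, lincomb g v = 0 -> v = 0.
Proof.
move=> pM ggen rel.
have [lc lcE] : exists l : {linear 'rV[R]_n -> M}, l =1 lincomb g.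
  by apply: pack_linear => a x y; apply: lincombP.
have [h hE] := pM _ _ lc (idfun : {linear M -> M}) (fun b => let: ex_intro v e := ggen b in ex_intro _ v (etrans (lcE v) (esym e))).
apply: (@section_independent _ _ _ h) => //; first exact: linearP.
by move=> i; rewrite -lcE hE.
Qed.

(** Two values [rho (s i)] satisfy the trivial relation r1 r0 - r0 r1 = 0, so independence allows at
    most one generator; by coprimality there is exactly one, and its value is a unit. *)
Lemma independent_coprime_generators (M : lmodType R) (rho : {linear M -> R^o}) m (s : 'I_m -> M) :
  (forall a b, (forall x, rdvd a (b * rho x)) -> rdvd a b) ->
  (forall x, exists v, rho x = \sum_i v i * rho (s i)) ->
  (forall v : 'rV[R]_m, \sum_i v 0 i * rho (s i) = 0 -> v = 0) ->
  exists x, rho x = 1.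
Proof.
case: m s => [|[|m]] s cop gen ind.
- have [|c /eqP] := cop 0 1; last by rewrite mul0r oner_eq0.
  by move=> x; have [v ->] := gen x; rewrite big_ord0 mulr0; apply: rdvd0.
- have [|c cE] := cop (rho (s 0)) 1.
    by move=> x; have [v ->] := gen x; exists (v 0); rewrite big_ord1; ring.
  by exists (c *: s 0); rewrite linearZ /= cE mulrC.
pose o0 : 'I_m.+2 := ord0; pose o1 : 'I_m.+2 := lift ord0 ord0.
have sum2 (v : 'rV[R]_m.+2) : (forall i, i != o0 -> i != o1 -> v 0 i = 0) ->
    \sum_i v 0 i * rho (s i) = v 0 o0 * rho (s o0) + v 0 o1 * rho (s o1).
  move=> h; rewrite (bigD1 o0) //= (bigD1 o1) //= big1 ?addr0 // => i /andP[a b].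
  by rewrite h ?mul0r.
pose v : 'rV[R]_m.+2 := \row_i (if i == o0 then rho (s o1) else if i == o1 then - rho (s o0) else 0 : R).
have /rowP v0 : v = 0.
  apply: ind; rewrite sum2 => [|i /negbTE a /negbTE b]; last by rewrite mxE a b.
  by rewrite !mxE /=; ring.
have r1 : rho (s o1) = 0 by have := v0 o0; rewrite !mxE eqxx.
have /rowP/(_ o1) : delta_mx 0 o1 = 0 :> 'rV[R]_m.+2.
  apply: ind; rewrite sum2 => [|i a /negbTE b]; last by rewrite mxE b andbF.
  by rewrite !mxE /= mul0r r1 mulr0 addr0.
by rewrite !mxE !eqxx => /eqP; rewrite oner_eq0.
Qed.

End Sections.

Section FreenessOfSyzygies.

Variable k : closedFieldType.

Local Notation R := {mpoly k[3]}.

Variables (f : R) (eps : syz f).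
Variable rho : {linear syz f -> R^o}.
Hypothesis rho_ker : forall s, rho s = 0 <-> exists c, s = c *: eps.
Hypothesis rho_coprime : forall a b, (forall s, rdvd a (b * rho s)) -> rdvd a b.
Hypothesis eps_torsion : forall c, c *: eps = 0 -> c = 0.

Lemma ueps_eq0 s : ueps eps s = 0 <-> exists c, s = c *: eps.
Proof.
have -> : (0 : Meps eps) = ueps eps 0 by rewrite linear0.
split=> [/lproj_eq|]; rewrite ?subr0; first by move/asboolP.
by move=> h; apply/lproj_eq; rewrite subr0; apply/asboolP.
Qed.

Lemma theta_exists : exists theta : {linear Meps eps -> R^o},
  (forall s, theta (ueps eps s) = rho s) /\ injective theta.
Proof.
have /choice[r rE] : forall q : Meps eps, exists s, ueps eps s = q by move=> q; apply: lproj_surj.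
have key s : rho (r (ueps eps s)) = rho s.
  apply/eqP; rewrite -subr_eq0 -linearB; apply/eqP/rho_ker/ueps_eq0.
  by rewrite linearB rE subrr.
have [th thE] : exists th : {linear Meps eps -> R^o}, th =1 rho \o r.
  apply: pack_linear => a x y /=; rewrite -{1}(rE x) -{1}(rE y) -linearP key.
  by rewrite linearP.
exists th; split=> [s|x y]; first by rewrite thE /= key.
rewrite !thE /= => /eqP; rewrite -subr_eq0 -linearB => /eqP/rho_ker/ueps_eq0.
by rewrite linearB !rE => /eqP; rewrite subr_eq0 => /eqP.
Qed.

Lemma free_syz s0 : rho s0 = 1 -> free_module (syz f).
Proof.
move=> s01; have rho_eps : rho eps = 0 by apply/rho_ker; exists 1; rewrite scale1r.
exists (fun x => x = eps \/ x = s0); split.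
  move=> x; have [c cE] : exists c, x - rho x *: s0 = c *: eps.
    by apply/rho_ker; rewrite linearB linearZ /= s01 /GRing.scale /= mulr1 subrr.
  exists 2, (fun i => if i == ord0 then eps else s0), (\row_i if i == ord0 then c else rho x).
  split=> [i|]; first by case: eqP; [left|right].
  by rewrite /lincomb !big_ord_recl big_ord0 !mxE /= addr0 -cE subrK.
move=> n b v bB binj v0.
have vs0 i : b i = s0 -> v 0 i = 0.
  move=> bi; have := congr1 rho v0; rewrite lincomb_map linear0 /lincomb (bigD1 i) //=.
  rewrite bi s01 big1 ?addr0 /GRing.scale /= ?mulr1 // => j ji.
  case: (bB j) => [->|bj]; first by rewrite rho_eps mulr0.
  by rewrite -bj in bi; move: ji; rewrite (binj _ _ bi) eqxx.
apply/rowP => i; rewrite mxE; case: (bB i) => [bi|]; last exact: vs0.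
apply: eps_torsion; rewrite -bi -[RHS]v0 /lincomb [RHS](bigD1 i) //= big1 ?addr0 // => j ji.
case: (bB j) => [bj|/vs0 ->]; last by rewrite scale0r.
by rewrite -bj in bi; move: ji; rewrite (binj _ _ bi) eqxx.
Qed.

Lemma free_Meps s0 : rho s0 = 1 -> free_module (Meps eps).
Proof.
move=> s01; have [theta [thetaE theta_inj]] := theta_exists.
have us : theta (ueps eps s0) = 1 by rewrite thetaE.
exists (fun x => x = ueps eps s0); split.
  move=> x; exists 1%N, (fun=> ueps eps s0), (\row_i theta x); split=> //.
  apply: theta_inj; rewrite lincomb_map /lincomb big_ord1 mxE /= us.
  by rewrite /GRing.scale /= mulr1.
move=> n b v bB binj /(congr1 theta); rewrite lincomb_map linear0 => v0.
apply/rowP => i; rewrite mxE -[RHS]v0 /lincomb (bigD1 i) //= bB us big1 ?addr0.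
  by rewrite /GRing.scale /= mulr1.
by move=> j ji; move: ji; rewrite (binj j i) ?eqxx // !bB.
Qed.

Lemma free_Meps_image : free_module (Meps eps) -> exists s, rho s = 1.
Proof.
case=> B [Bgen Bind]; have [theta [thetaE theta_inj]] := theta_exists.
(* The relation [theta y *: x - theta x *: y = 0] excludes two distinct basis elements. *)
have Buniq x y : B x -> B y -> x = y.
  move=> Bx By; apply: contrapT => xy.
  have B2 : injective (fun i : 'I_2 => if i == ord0 then x else y).
    move=> [[|[|//]] hi] [[|[|//]] hj] /= e; try by apply/val_inj.
    by case: xy; rewrite e.
  have /rowP v0 : \row_(i < 2) (if i == ord0 then theta y else - theta x : R) = 0.
    apply: (Bind _ _ _ _ B2) => [i|]; first by case: eqP.
    apply: theta_inj; rewrite lincomb_map linear0 /lincomb !big_ord_recl big_ord0 !mxE /=.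
    by rewrite /GRing.scale /=; ring.
  have := (v0 ord0, v0 (lift ord0 ord0)); rewrite !mxE /= => -[y0 /eqP].
  rewrite oppr_eq0 => /eqP x0; apply: xy.
  by apply: theta_inj; rewrite x0 y0.
have gen1 z x : B x -> exists c, theta z = c * theta x.
  move=> Bx; have [n [b [v [bB ->]]]] := Bgen z; exists (\sum_i v 0 i).
  by rewrite lincomb_map /lincomb mulr_suml; apply: eq_bigr => i _; rewrite /= (Buniq (b i) x).
have [[x Bx]|noB] := pselect (exists x, B x).
  have [|c cE] := rho_coprime (a := theta x) (b := 1).
    by move=> s; rewrite -thetaE; have [c ->] := gen1 (ueps eps s) x Bx; exists c; ring.
  have [s sE] := lproj_surj (c *: x); exists s; rewrite -thetaE [ueps eps s]sE.
  by rewrite linearZ /= cE mulrC.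
have [|c /eqP] := rho_coprime (a := 0) (b := 1); last by rewrite mul0r oner_eq0.
move=> s; rewrite -thetaE; have [[|n] [b [v [bB ->]]]] := Bgen (ueps eps s).
  by rewrite /lincomb big_ord0 linear0 mulr0; apply: rdvd0.
by case: noB; exists (b ord0).
Qed.

Lemma cons_fam0 T (x : T) m (g : 'I_m -> T) i : cons_fam x g (lshift m i) = x.
Proof. by rewrite /cons_fam -[lshift m i]/(unsplit (inl i)) unsplitK. Qed.

Lemma cons_famS T (x : T) m (g : 'I_m -> T) i : cons_fam x g (rshift 1 i) = g i.
Proof. by rewrite /cons_fam -[rshift 1 i]/(unsplit (inr i)) unsplitK. Qed.

Lemma lincomb_cons (N : lmodType R) (x : N) m (g : 'I_m -> N) c v :
  lincomb (cons_fam x g) (row_mx c v) = c 0 0 *: x + lincomb g v.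
Proof.
rewrite /lincomb big_split_ord big_ord1 /= cons_fam0 row_mxEl; congr (_ + _).
by apply: eq_bigr => i _; rewrite cons_famS row_mxEr.
Qed.

Lemma minimal_generators_cons (G : grading (syz f)) : minimal_hom_generator G eps ->
  exists m (g : 'I_m -> syz f), minimal_hom_generators G (cons_fam eps g).
Proof.
case=> -[|n] [g [gmin [i0' gi]]]; first by case: (i0').
have [ghom ggen girr] := gmin.
exists n, (fun j => g (lift i0' j)).
pose to (v : 'rV[R]_n.+1) : 'rV[R]_(1 + n) := row_mx (v 0 i0')%:M (\row_j v 0 (lift i0' j)).
pose of_ (w : 'rV[R]_(1 + n)) : 'rV[R]_n.+1 :=
  \row_l if unlift i0' l is Some j then w 0 (rshift 1 j) else w 0 (lshift n 0).
have toE v : lincomb (cons_fam eps (fun j => g (lift i0' j))) (to v) = lincomb g v.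
  rewrite lincomb_cons mxE eqxx /lincomb (bigD1_ord i0') //= gi; congr (_ + _).
  by apply: eq_bigr => j _; rewrite mxE.
have ofK w : to (of_ w) = w.
  rewrite -[RHS]hsubmxK; congr row_mx; apply/rowP => j; rewrite !mxE ?liftK //.
  by rewrite ord1 eqxx unlift_none.
split=> [i|x|i h].
- rewrite -[i]splitK; case: (split i) => j /=; first by rewrite cons_fam0 -gi; apply: ghom.
  by rewrite cons_famS; apply: ghom.
- by have [v ->] := ggen x; exists (to v); rewrite toE.
pose l := match split i with inl _ => i0' | inr j => lift i0' j end.
apply: (girr l) => x; have [w [wi ->]] := h x; exists (of_ w); split; last by rewrite -toE ofK.
by move: wi; rewrite mxE /l -{1}[i]splitK; case: (split i) => j /=; rewrite ?unlift_none ?liftK ?ord1.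
Qed.

End FreenessOfSyzygies.

(** * Projective dimension *)

Lemma projective_rows (R : comNzRingType) n : projective 'rV[R]_n.
Proof.
move=> A B g h gsurj; have /choice[l lE] : forall i, exists a, g a = h (delta_mx 0 i).
  by move=> i; apply: gsurj.
have [k kE] : exists k : {linear 'rV[R]_n -> A}, k =1 lincomb l.
  by apply: pack_linear => a x y; apply: lincombP.
exists k => x; rewrite kE lincomb_map {2}[x]row_sum_delta /lincomb linear_sum.
by apply: eq_bigr => i _; rewrite /= lE linearZ_LR.
Qed.

Section ProjectiveDimension.

Variable R : comNzRingType.
Variable I : idealr R.

Lemma lproj_ideal0 (r : R^o) : lproj (ideal_submod I) r = 0 <-> r \in (I : {pred R}).
Proof.
have -> : (0 : lquot (ideal_submod I)) = lproj (ideal_submod I) 0 by rewrite linear0.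
by split=> [/lproj_eq|h]; [|apply/lproj_eq]; rewrite subr0.
Qed.

Lemma pd_le2_of_resolution n m (psi : 'M[R]_(n, m)) (t : 'I_m -> R^o) :
  injective (fun v : 'rV[R]_n => v *m psi) ->
  (forall v : 'rV[R]_m, lincomb t v = 0 <-> exists w, w *m psi = v) ->
  (forall x, x \in (I : {pred R}) <-> exists v, lincomb t v = x) ->
  pd_le (lquot (ideal_submod I)) 2.
Proof.
move=> psi_inj psi_ker tI.
(* The resolution of R/I has ranks 1, [m], [n] and zero from then on. *)
pose sz i := match i with 0 => 1 | 1 => m | 2 => n | _ => 0 end.
pose A i : 'M[R]_(sz i.+1, sz i) :=
  match i with 0 => \col_j t j | 1 => psi | _ => 0 end.
pose D i : {linear 'rV[R]_(sz i.+1) -> 'rV[R]_(sz i)} := mulmxr (A i).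
have [aug augE] : exists aug : {linear 'rV[R]_1 -> lquot (ideal_submod I)},
    forall x, aug x = lproj (ideal_submod I) (x 0 0 : R^o).
  by apply: pack_linear => a x y; rewrite -linearP !mxE.
have tE v : v *m \col_j t j = (lincomb t v : R)%:M.
  by rewrite [LHS]mx11_scalar mxE; congr (_%:M); apply: eq_bigr => j _; rewrite mxE.
exists (fun i => 'rV[R]_(sz i) : lmodType R), D, aug; split.
- by move=> i; apply: projective_rows.
- by move=> x; have [r <-] := lproj_surj x; exists (r : R)%:M; rewrite augE mxE eqxx.
- move=> x; rewrite augE; split=> [/lproj_ideal0/tI[v vE]|[y <-]].
    by exists v; rewrite -[D 0%N v]/(v *m \col_j t j) tE vE -mx11_scalar.
  apply/lproj_ideal0/tI; exists y.
    by rewrite -[D 0%N y]/(y *m \col_j t j) tE mxE eqxx.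
- move=> [|[|i]] x.
  + rewrite -[D 0%N x]/(x *m \col_j t j) tE.
    split=> [/(congr1 (fun M : 'M_1 => M 0 0))|[y <-]].
      by rewrite !mxE eqxx => /psi_ker[w wE]; exists w.
    have -> : lincomb t (D 1%N y) = 0 by apply/psi_ker; exists y.
    by rewrite raddf0.
  + rewrite -[D 1%N x]/(x *m psi); split=> [x0|[y <-]].
      by exists 0; rewrite linear0; apply: psi_inj; rewrite x0 mul0mx.
    by rewrite -[D 2%N y]/(y *m 0) mulmx0 mul0mx.
  + by split=> [_|_]; [exists 0|]; rewrite !thinmx0 ?linear0.
- by case=> [|[|[|i]]] // _ x; rewrite thinmx0.
Qed.

End ProjectiveDimension.

Section PdLowerBound.

Variable k : closedFieldType.

Local Notation R := {mpoly k[3]}.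

(* [R / I] of projective dimension at most 1 would make [I] a direct summand of
   a free module: by Schanuel's lemma multiplication by some [1 + i], [i] in
   [I], factors through the first syzygy module. *)
Lemma pd_le1_section (M : lmodType R) (I : idealr R) (theta : {linear M -> R^o})
    m (g : 'I_m -> M) :
  injective theta -> (forall r : R, r \in (I : {pred R}) <-> exists x, theta x = r) ->
  generates g -> pd_le (lquot (ideal_submod I)) 1 ->
  exists2 h : M -> 'rV[R]_m, linear h & forall x, lincomb g (h x) = x.
Proof.
move=> theta_inj thetaI ggen [P [D [aug [Pproj augsurj augker Dker Pzero]]]].
have Dinj x : D 0%N x = 0 -> x = 0.
  by move=> /Dker[y <-]; rewrite (Pzero 2%N isT y) linear0.
have Dinj2 x y : D 0%N x = D 0%N y -> x = y.
  by move=> E; apply/eqP; rewrite -subr_eq0; apply/eqP/Dinj; rewrite linearB E subrr.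
pose pi := lproj (ideal_submod I).
have [al alE] := Pproj 0%N R^o (lquot (ideal_submod I)) pi aug (lproj_surj (N := _)).
have [y1 y1E] := augsurj (pi 1).
have /choice[ga gaE] : forall q, exists z, D 0%N z = (theta q : R) *: y1.
  move=> q; apply/augker; rewrite linearZ /= y1E -linearZ /=.
  by apply/lproj_ideal0; rewrite /GRing.scale /= mulr1; apply/thetaI; exists q.
have /choice[de deE] : forall z, exists q, theta q = al (D 0%N z).
  move=> z; apply/thetaI/lproj_ideal0; apply: etrans (alE _) _.
  by apply/augker; exists z.
have [de' de'E] : exists d : {linear P 1%N -> M}, d =1 de.
  by apply: pack_linear => a x y; apply: theta_inj; rewrite linearP !deE !linearP.
have [lc lcE] : exists l : {linear 'rV[R]_m -> M}, l =1 lincomb g.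
  by apply: pack_linear => a x y; apply: lincombP.
have [la laE] : exists la : {linear P 1%N -> 'rV[R]_m}, forall z, lc (la z) = de' z.
  apply: (Pproj 1%N) => b; have [v ->] := ggen b; by exists v; rewrite lcE.
have [q0 q0E] : exists q0, theta q0 = al y1 - 1.
  apply/thetaI; have [h _] := lproj_eq (ideal_submod I) (al y1) (1 : R^o).
  by apply: h; apply: etrans (alE _) y1E.
have [r0 r0E] := ggen q0.
(* [theta (de (ga q))] is [theta q * al y1], that is [theta q * (1 + theta q0)]. Subtracting
   [theta q *: r0], which lifts [theta q *: q0], leaves a lift of [q]. *)
exists (fun q => la (ga q) - (theta q : R) *: r0) => [a x y|q].
  have -> : ga (a *: x + y) = a *: ga x + ga y.
    by apply: Dinj2; rewrite linearP !gaE linearP scalerDl scalerA.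
  rewrite !linearP scalerDl -scalerA scalerBr opprD !addrA; congr (_ + _).
  by rewrite addrAC.
rewrite lincombB lincombZ -r0E -lcE laE de'E; apply: theta_inj.
rewrite linearB linearZ /= deE gaE q0E linearZ /= /GRing.scale /=; ring.
Qed.

End PdLowerBound.

(** * The ideal attached to a minimal generator *)

Section Multiplicities.

Variable k : closedFieldType.

Local Notation R := {mpoly k[3]}.

Lemma hilbert_value_eq0 (I : {pred R}) t h : hilbert_value I t h ->
  h = 0%N <-> forall p : R, p \is t.-homog -> p \in I.
Proof.
case=> U [UI ->]; split=> [/eqP|full].
  rewrite subn_eq0 => dU p pt; apply/(UI (DHomog pt)).
  have /eqP -> : U == fullv by rewrite eqEdim subvf.
  exact: memvf.
suff -> : U = fullv by rewrite subnn.
by apply/vspaceP => p; rewrite memvf; apply/(UI p)/full/dhomog_is_dhomog.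
Qed.

Lemma has_mult_ext (I I' : {pred R}) m : (forall p, p \in I <-> p \in I') ->
  has_mult I m -> has_mult I' m.
Proof.
move=> II' [h [hI hP]]; exists h; split=> // t; have [U [UI hU]] := hI t.
by exists U; split=> // p; rewrite UI II'.
Qed.

Lemma homog_Xn (i : 'I_3) t : ('X_i ^+ t : R) \is t.-homog.
Proof. by have := dhomogMn t (grad_polyX k i); rewrite mul1n. Qed.

End Multiplicities.

Section MinimalGenerator.

Variable k : closedFieldType.

Local Notation R := {mpoly k[3]}.

Variables (f : R) (d e : nat).

Hypothesis f_form : f \is (d.+1).-homog.
Hypothesis phi_coprime : coprime_family (fun i => f^`M(i)).
Variable eps : syz f.
Hypothesis eps_deg : grad_syz e%:Z eps.
Hypothesis eps_coprime : coprime_family (fun i => syz_val eps 0 i).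
Variable rho : {linear syz f -> R^o}.
Hypothesis rhoE : forall s i,
  cross (syz_val eps) (syz_val s) i = rho s * f^`M(i).

Local Notation ker := (rho_ker phi_coprime eps_coprime rhoE).
Local Notation cop := (rho_image_coprime f_form phi_coprime eps_coprime rhoE).
Local Notation tor := (eps_torsion_free eps_coprime).
Local Notation s := (e%:Z - d%:Z).
Local Notation D := (d%:Z ^+ 2 + e%:Z * s).

Lemma ueps0P x : ueps eps x = 0 <-> rho x = 0.
Proof. by rewrite (ueps_eq0 eps x) ker. Qed.

Lemma syz_gradedP m (g : 'I_m -> syz f) (a : 'rV[int]_m) j (v : 'rV[R]_m) :
  (forall i, grad_syz (a 0 i) (g i)) -> grad_free a j v -> grad_syz j (lincomb g v).
Proof.
move=> ga va; apply/grad_syz_rows; rewrite syz_val_lincomb -(hrow_id va).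
rewrite -(hrow_lincomb (c := 0)) => [|i]; first exact: grad_free_hrow.
exact/grad_syz_rows.
Qed.

Lemma rho_in x : rho x \in rho_image rho.
Proof. by apply/asboolP; exists x. Qed.

Lemma rho_imageP p : p \in rho_image rho <-> exists x, rho x = p.
Proof. by split=> [/asboolP|?]; last exact/asboolP. Qed.

(** Depth two permits descent: once all forms of one degree are in the image, so are those of the
    degree below. *)
Lemma rho_image_irrelevant N : (forall t p, (N <= t)%N -> p \is t.-homog -> p \in rho_image rho) ->
  exists x, rho x = 1.
Proof.
move=> h; suff all n : (forall p, p \is (N - n).-homog -> p \in rho_image rho).
  by apply/rho_imageP; apply: (all N); rewrite subnn; apply: dhomog1.
elim: n => [|n IHn] p pn; first by apply: (h N) => //; rewrite subn0 in pn.
have [Nn|nN] := leqP N n.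
  by apply: IHn; move: pn; have -> : (N - n.+1 = N - n)%N by lia.
apply/rho_imageP/(rho_image_depth phi_coprime eps_coprime rhoE) => i.
apply/rho_imageP/IHn; have -> : (N - n = 1 + (N - n.+1))%N by lia.
by apply: dhomogM => //; exact: grad_polyX.
Qed.

Section Generators.

Variables (m : nat) (g : 'I_m -> syz f).
Hypothesis gmin : minimal_hom_generators (@grad_syz k f) (cons_fam eps g).

Lemma gens_rel (v : 'rV[R]_(1 + m)) : lincomb (cons_fam eps g) v = 0 ->
  forall i, (v 0 i)@_0 = 0.
Proof.
have [b gb] := minimal_degrees gmin.
exact: (irredundant_rel (homog_rel_syz (f := f)) gb (minimal_irredundant gmin)).
Qed.

Lemma gens_span x : exists v, rho x = \sum_i v i * rho (g i).
Proof.
have [_ ggen _] := gmin; have [w ->] := ggen x; exists (fun i => w 0 (rshift 1 i)).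
rewrite -[w]hsubmxK lincomb_cons linearD linearZ /= (rho_eps phi_coprime eps_coprime rhoE).
rewrite scaler0 add0r lincomb_map; apply: eq_bigr => i _.
by rewrite hsubmxK mxE.
Qed.

Lemma lincomb_ueps v : lincomb (fun i => ueps eps (g i)) v = ueps eps (lincomb g v).
Proof. by rewrite lincomb_map. Qed.

Lemma gens_ker (v : 'rV[R]_m) : rho (lincomb g v) = 0 ->
  exists c, lincomb (cons_fam eps g) (row_mx c%:M v) = 0.
Proof.
move=> /ker[c cE]; exists (- c); rewrite lincomb_cons cE mxE eqxx mulr1n.
by rewrite scaleNr addNr.
Qed.

Lemma gens_rel_rho (v : 'rV[R]_m) : rho (lincomb g v) = 0 -> forall i, (v 0 i)@_0 = 0.
Proof.
by move=> /gens_ker[c cE] i; have := gens_rel cE (rshift 1 i); rewrite row_mxEr.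
Qed.

(** Freeness makes the whole minimal system independent, and a relation among the [rho (g i)]
    extends by a multiple of [eps] to a relation of that system. *)
Lemma free_divisor_image : free_divisor f -> exists x, rho x = 1.
Proof.
move=> /free_projective pf; have [_ ggen _] := gmin.
apply: (independent_coprime_generators (s := g)) => [|x|v v0].
- exact: cop.
- exact: gens_span.
have [|c cE] := @gens_ker v; first by rewrite lincomb_map -[RHS]v0.
have := projective_independent pf ggen gens_rel cE.
by move=> /(congr1 rsubmx); rewrite row_mxKr linear0.
Qed.

Lemma free_divisor_iff : free_divisor f <-> exists x, rho x = 1.
Proof.
split; first exact: free_divisor_image.
by case=> x x1; apply: (free_syz ker tor x1).
Qed.

Lemma free_Meps_iff : free_module (Meps eps) <-> exists x, rho x = 1.
Proof.
split; first exact: (free_Meps_image ker cop).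
by case=> x x1; apply: (free_Meps ker x1).
Qed.

(** [cJ] and [cI] are eventual dimensions of graded pieces. They are claimed as multiplicities only
    when positive: a zero value means finite length, and then [has_mult] measures that length
    instead. *)
Lemma multiplicities (char_d : (d.+1%:R : k) != 0) : exists cJ cI : nat,
  [/\ cJ%:Z + cI%:Z = D,
      (exists x, rho x = 1) -> cI = 0%N,
      ~ (exists x, rho x = 1) -> (0 < cI)%N,
      (0 < cI)%N -> has_mult (rho_image rho) cI /\
        exists v : 'I_3 -> k, (exists i, v i != 0) /\
          forall p t, p \in rho_image rho -> p \is t.-homog -> p.@[v] = 0
    & (0 < cJ)%N -> has_mult (gradient_ideal f) cJ] /\
  ((0 < cJ)%N <-> singular_curve f).
Proof.
have [b gb] := minimal_degrees gmin; have [_ ggen _] := gmin.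
have [uJ [uI [uJP uIP [cJ [cI [N [cP DE]]]]]]] := hilbert_functions f_form phi_coprime eps_deg
  eps_coprime rhoE gb ggen (minimal_irredundant gmin).
have hJ (t : nat) := hilbert_value_kdim (ksub_gradient_ideal f t) (uJP t).
have hI (t : nat) := hilbert_value_kdim (ksub_rho_image rho t) (uIP t).
have idI : ideal_like (fun p => p \in rho_image rho).
  split; first by apply/rho_imageP; exists 0; rewrite linear0.
  by move=> a _ _ /rho_imageP[x <-] /rho_imageP[y <-]; apply/rho_imageP; exists (a *: x + y); rewrite linearP.
have gradP p : p \in gradient_ideal f <-> exists c : 'I_3 -> R, p = \sum_i c i * f^`M(i).
  by split=> [/asboolP|?]; last exact/asboolP.
have idJ : ideal_like (fun p => p \in gradient_ideal f).
  split; first by apply/gradP; exists (fun=> 0); rewrite big1 // => i _; rewrite mul0r.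
  move=> a _ _ /gradP[x ->] /gradP[y ->]; apply/gradP; exists (fun i => a * x i + y i).
  by rewrite mulr_sumr -big_split; apply: eq_bigr => i _ /=; ring.
exists cJ, cI; split; first split=> //.
- move=> [x x1]; have [_ <-] := cP N (leqnn N); apply/(hilbert_value_eq0 (hI N)) => p _.
  by apply/rho_imageP; exists (p *: x); rewrite linearZ /= x1 /GRing.scale /= mulr1.
- move=> h; rewrite lt0n; apply/eqP => cI0; apply: h; apply: (@rho_image_irrelevant N) => t p Nt.
  by have [_ ct] := cP t Nt; apply: (hilbert_value_eq0 (hI t)).1; rewrite ct.
- move=> cI0; split.
    by apply: (has_mult_const hI _ cI0 (N := N)) => t /cP[].
  apply: (bounded_Nullstellensatz (c := cI) (N := N) idI) => // t /cP[_ ct].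
  by exists (uI t).
- by move=> cJ0; apply: (has_mult_const hJ _ cJ0 (N := N)) => t /cP[].
split=> [cJ0|[v [[i vi] _ fv]]].
  have [v [v0 vJ]] := bounded_Nullstellensatz (c := cJ) (N := N) idJ
    (fun t Nt => let: conj ct _ := cP t Nt in ex_intro2 _ _ (uJ t) (uJP t) ct) cJ0.
  have fv i : (f^`M(i)).@[v] = 0.
    apply: (vJ _ d); last exact: mderiv_homog.
    apply/gradP; exists (fun j => (j == i)%:R); rewrite (bigD1 i) //= eqxx mul1r big1 ?addr0 //.
    by move=> j /negbTE ->; rewrite mul0r.
  exists v; split=> //; have /(congr1 (meval v)) := euler_formula f_form.
  rewrite raddf_sum big1 => [/esym/eqP|i _]; last by rewrite /= mevalM fv mulr0.
  by rewrite mevalMn -mulr_natr mulf_eq0 (negbTE char_d) orbF => /eqP.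
(* If [cJ] were zero, the gradient ideal would contain a power of a variable that does not vanish at
   [v]. *)
rewrite lt0n; apply/eqP => cJ0; have [ct _] := cP N (leqnn N).
have /gradP[c cE] : ('X_i : R) ^+ N \in gradient_ideal f.
  by apply: (hilbert_value_eq0 (hJ N)).1; [rewrite ct|apply: homog_Xn].
have /eqP := congr1 (meval v) cE; rewrite rmorphXn /= mevalXU raddf_sum big1.
  by rewrite expf_eq0 (negbTE vi) andbF.
by move=> j _; rewrite /= mevalM fv mulr0.
Qed.

End Generators.

(** [rho y *: x - rho x *: y] lies in the kernel, so [theta] is proportional to [rho]. Coprimality
    of the image of [rho] makes the ratio a polynomial, and the gradings make it constant. *)
Lemma model_unique (I : idealr R) (theta : {linear Meps eps -> R^o}) :
  codim2_ideal_model s I theta ->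
  exists2 c : k, c != 0 & forall x, theta (ueps eps x) = c%:MP * rho x.
Proof.
case=> hI _ theta_inj thetaI theta_deg.
have prop x y : rho y * theta (ueps eps x) = rho x * theta (ueps eps y).
  have thZ a z : theta (ueps eps (a *: z)) = a * theta (ueps eps z).
    by rewrite linearZ linearZ.
  rewrite -!thZ; congr (theta _); apply/eqP; rewrite -subr_eq0 -linearB; apply/eqP/ueps0P.
  by rewrite linearB !linearZ /= /GRing.scale /=; ring.
have [i /eqP Ei] := coprime_family_neq0 eps_coprime.
have [x [xd xE]] := rho_koszul f_form phi_coprime rhoE i.
have [r rE] : rdvd (rho x : R) (theta (ueps eps x)).
  by apply: cop => y; exists (theta (ueps eps y)); rewrite mulrC prop.
have thE y : theta (ueps eps y) = r * rho y.
  by apply: (mulfI Ei); rewrite -xE prop rE; ring.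
(* [x] has degree [d] and [rho x] is a coordinate of [eps], of degree [e]; [theta] shifts degrees by
   [e - d], so the ratio has degree zero. *)
have r0 : r = (r@_0)%:MP.
  apply: grad_poly0P; rewrite -(subrr e%:Z); apply: (grad_poly_divl Ei (eps_deg i)).
  have : gshift (@grad_poly k) s d%:Z (theta (ueps eps x)).
    by apply: theta_deg; exists x.
  by rewrite rE xE /gshift subrK.
exists r@_0; last by move=> y; rewrite thE -r0.
rewrite -(mpolyC_eq0 3) -r0; apply: contra_neq Ei => r0'.
rewrite -xE; apply/ueps0P/theta_inj; by rewrite thE r0' mul0r linear0.
Qed.

Lemma model_image (I : idealr R) (theta : {linear Meps eps -> R^o}) :
  codim2_ideal_model s I theta -> forall p, p \in (I : {pred R}) <-> p \in rho_image rho.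
Proof.
move=> md p; have [c c0 thE] := model_unique md; have [_ _ _ thetaI _] := md.
rewrite thetaI rho_imageP; split=> [[q <-]|[x <-]].
  by have [x <-] := lproj_surj q; exists (c%:MP *: x); rewrite linearZ /= thE.
exists (ueps eps ((c^-1)%:MP *: x)); rewrite thE linearZ /= /GRing.scale /= mulrA -mpolyCM.
by rewrite mulfV // mpolyC1 mul1r.
Qed.

Lemma model_exists (v : 'I_3 -> k) : (exists i, v i != 0) ->
  (forall p t, p \in rho_image rho -> p \is t.-homog -> p.@[v] = 0) ->
  ~ (exists x, rho x = 1) ->
  exists (I : idealr R) (theta : {linear Meps eps -> R^o}), codim2_ideal_model s I theta.
Proof.
move=> v0 vI no1.
have [I IE] : exists I : idealr R, (I : {pred R}) =i rho_image rho.
  apply: idealr_exists; split.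
  - by apply/rho_imageP; exists 0; rewrite linear0.
  - by apply/negP => /rho_imageP.
  by move=> a _ _ /rho_imageP[x <-] /rho_imageP[y <-]; apply/rho_imageP; exists (a *: x + y); rewrite linearP.
have [theta [thE theta_inj]] := theta_exists ker.
have hI p n : p \in (I : {pred R}) -> pihomog mdeg n p \in (I : {pred R}).
  rewrite !IE => /rho_imageP[x <-]; have [y yE] := hsyz_exists f_form (n%:Z - s) x.
  apply/rho_imageP; exists y; rewrite (rho_hpart f_form phi_coprime eps_deg rhoE yE).
  by rewrite addrC subrK.
exists I, theta; split=> //.
- apply: (has_codim2 v0) => //; last by move=> p t; rewrite IE; apply: vI.
  by move=> a b h; apply: cop => x; apply: h; rewrite IE; apply: rho_in.
- move=> r; rewrite IE rho_imageP; split=> [[x <-]|[q <-]].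
    by exists (ueps eps x); rewrite thE.
  by have [x <-] := lproj_surj q; exists x; rewrite -thE.
move=> j q [x [xj <-]]; rewrite [theta _]thE.
exact: (rho_homog f_form eps_deg phi_coprime rhoE xj).
Qed.

Section Resolution.

Variables (m : nat) (g : 'I_m -> syz f) (a : 'rV[int]_m).
Hypothesis gmin : minimal_hom_generators (@grad_syz k f) (cons_fam eps g).
Hypothesis ga : forall i, grad_syz (a 0 i) (g i).

Local Notation a' := (row_mx (const_mx e%:Z : 'rV_1) a).

Definition syz_resolution n (b : 'rV[int]_n) lambda (psi : 'M[R]_(n, m)) :=
  minimal_free_res (@grad_syz k f) predT b a' (row_mx lambda psi) (cons_fam eps g).

Lemma cons_degrees i : grad_syz (a' 0 i) (cons_fam eps g i).
Proof.
rewrite -[i]splitK; case: (split i) => j /=.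
  by rewrite cons_fam0 row_mxEl mxE.
by rewrite cons_famS row_mxEr.
Qed.

Lemma resolution_exists : exists n (b : 'rV[int]_n) lambda psi, syz_resolution b lambda psi.
Proof.
have [_ ggen _] := gmin.
have [n [b [A [Ab Ainj Aker A0]]]] := minimal_resolution (homog_rel_syz (f := f))
  (koszul_left_syz (f := f)) cons_degrees ggen (minimal_irredundant gmin).
exists n, b, (lsubmx (A : 'M_(n, 1 + m))), (rsubmx (A : 'M_(n, 1 + m))).
rewrite /syz_resolution hsubmxK; split=> //.
- split=> j v vb; last exact: syz_gradedP cons_degrees vb.
  rewrite /= -(hrow_id vb) -lincomb_row -(hrow_lincomb _ _ Ab).
  exact: grad_free_hrow.
- by move=> x; split=> // _; have [v ->] := ggen x; exists v.
Qed.

Lemma model_resolution n (b : 'rV[int]_n) lambda psi (I : idealr R)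
    (theta : {linear Meps eps -> R^o}) :
  syz_resolution b lambda psi -> codim2_ideal_model s I theta ->
  minimal_free_res (V := R^o) (@grad_poly k) (I : {pred R})
    (b - const_mx (d%:Z - e%:Z)) (a - const_mx (d%:Z - e%:Z)) psi
    (fun i => theta (ueps eps (g i))).
Proof.
case=> -[Agr ggr] Ainj Aker Agen A0 [_ _ theta_inj thetaI theta_gr].
have shift l (c : 'rV[int]_l) j (v : 'rV[R]_l) : grad_free (c - const_mx (d%:Z - e%:Z)) j v ->
    grad_free c (j + (d%:Z - e%:Z)) v.
  move=> h i; have := h i; rewrite !mxE.
  by rewrite (_ : j - (c 0 i - (d%:Z - e%:Z)) = j + (d%:Z - e%:Z) - c 0 i) //; ring.
have unshift l (c : 'rV[int]_l) j (v : 'rV[R]_l) : grad_free c (j + (d%:Z - e%:Z)) v ->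
    grad_free (c - const_mx (d%:Z - e%:Z)) j v.
  move=> h i; have := h i; rewrite !mxE.
  by rewrite (_ : j - (c 0 i - (d%:Z - e%:Z)) = j + (d%:Z - e%:Z) - c 0 i) //; ring.
have thE v : lincomb (fun i => theta (ueps eps (g i))) v = theta (ueps eps (lincomb g v)).
  by rewrite !lincomb_map.
have rel0 v : lincomb (fun i => theta (ueps eps (g i))) v = 0 <-> rho (lincomb g v) = 0.
  rewrite thE -ueps0P; split=> [E|->]; last by rewrite linear0.
  by apply: theta_inj; rewrite linear0.
split.
- split=> j v /shift vb.
    apply: unshift => i; have := Agr _ _ vb (rshift 1 i).
    by rewrite /= mul_mx_row !row_mxEr.
  have v'b : grad_free a' (j + (d%:Z - e%:Z)) (row_mx 0 v).
    move=> i; rewrite -[i]splitK; case: (split i) => l /=.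
      by rewrite !row_mxEl !mxE; apply: grad_poly0.
    by rewrite !row_mxEr.
  have := ggr _ _ v'b; rewrite lincomb_cons mxE scale0r add0r => gv.
  have := theta_gr _ _ (ex_intro _ _ (conj gv erefl)); rewrite -thE /gshift.
  have -> : e%:Z - d%:Z + (j + (d%:Z - e%:Z)) = j by ring.
  by [].
(* A row killed by [psi] gives a relation involving [eps] alone; as [eps] is torsion free, [lambda]
   kills the row too. *)
- move=> v w E; apply: Ainj; apply/eqP; rewrite -subr_eq0 -mulmxBl; apply/eqP.
  have z : (v - w) *m psi = 0 by rewrite mulmxBl E subrr.
  have : lincomb (cons_fam eps g) ((v - w) *m row_mx lambda psi) = 0.
    by apply/Aker; exists (v - w).
  rewrite mul_mx_row z lincomb_cons lincomb0 addr0 => /tor l0.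
  by rewrite [_ *m lambda]mx11_scalar l0 raddf0 row_mx0.
- move=> v; rewrite rel0; split=> [|[w wE]].
    move=> /(gens_ker)[c /Aker[w wE]]; exists w.
    by move: wE; rewrite mul_mx_row => /eq_row_mx[].
  apply/ker; have : lincomb (cons_fam eps g) (w *m row_mx lambda psi) = 0.
    by apply/Aker; exists w.
  rewrite mul_mx_row wE lincomb_cons => /eqP; rewrite addr_eq0 => /eqP h.
  by exists (- (w *m lambda) 0 0); rewrite scaleNr h opprK.
- move=> r; rewrite thetaI; split=> [[q <-]|[v <-]]; last by exists (ueps eps (lincomb g v)).
  have [x <-] := lproj_surj q; have [|w wE] := (Agen x).1 _; first by [].
  exists (rsubmx (w : 'rV_(1 + m))); rewrite thE; congr (theta _).
  apply/eqP; rewrite -subr_eq0 -linearB; apply/eqP/ueps_eq0.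
  exists (- (w : 'rV_(1 + m)) 0 (lshift m 0)).
  have -> : x = (w : 'rV_(1 + m)) 0 (lshift m 0) *: eps + lincomb g (rsubmx (w : 'rV_(1 + m))).
    by rewrite -wE -{1}[w](hsubmxK (w : 'rV_(1 + m))) lincomb_cons mxE.
  by rewrite opprD addrCA subrr addr0 scaleNr.
by move=> i j; have := A0 i (rshift 1 j); rewrite row_mxEr.
Qed.

(** Projective dimension at most one would split the free cover of M_eps, make its minimal
    generators independent and force 1 into the proper ideal [I]. *)
Lemma model_perfect (I : idealr R) (theta : {linear Meps eps -> R^o}) :
  ~ (exists x, rho x = 1) -> codim2_ideal_model s I theta -> perfect_ideal I.
Proof.
move=> no1 md; have [hI cI theta_inj thetaI theta_gr] := md.
exists 2; split=> //; split.
  have [n [b [lambda [psi res]]]] := resolution_exists.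
  have [_ pinj pker pgen _] := model_resolution res md.
  exact: (pd_le2_of_resolution pinj pker pgen).
move=> l l2 [P [D' [aug [P1 P2 P3 P4 P5]]]].
have pd1 : pd_le (lquot (ideal_submod I)) 1.
  exists P, D', aug; split=> // i i1; apply: P5; exact: leq_ltn_trans i1.
have ugen : generates (fun i => ueps eps (g i)).
  move=> q; have [x <-] := lproj_surj q; have [_ ggen _] := gmin; have [w ->] := ggen x.
  exists (rsubmx (w : 'rV_(1 + m))); rewrite lincomb_ueps.
  apply/eqP; rewrite -subr_eq0 -linearB; apply/eqP/ueps_eq0.
  exists ((w : 'rV_(1 + m)) 0 (lshift m 0)).
  by rewrite -{1}[w](hsubmxK (w : 'rV_(1 + m))) lincomb_cons addrK mxE.
have [h hL hE] := pd_le1_section theta_inj thetaI ugen pd1.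
have ind (v : 'rV[R]_m) : lincomb (fun i => ueps eps (g i)) v = 0 -> v = 0.
  apply: (section_independent hL) => [i|w]; first exact: hE.
  by rewrite lincomb_ueps => /ueps0P/(gens_rel_rho gmin).
have [c c0 thE] := model_unique md.
case: no1; have [|x|v v0|q q1] := independent_coprime_generators
    (rho := theta) (s := fun i => ueps eps (g i)).
- move=> a1 b1 hab; apply: cop => x.
  have := hab (ueps eps ((c^-1)%:MP *: x)); rewrite thE linearZ /=.
  by rewrite /GRing.scale /= [c%:MP * _]mulrA -mpolyCM mulfV // mpolyC1 mul1r.
- by have [v ->] := ugen x; exists (fun i => v 0 i); rewrite lincomb_map.
- by apply: ind; apply: theta_inj; rewrite lincomb_map linear0.
by have := (thetaI 1).2 (ex_intro _ q q1); rewrite idealr1.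
Qed.

End Resolution.

End MinimalGenerator.

Theorem theorem2p1 (k : closedFieldType) (d e : nat) (f : {mpoly k[3]})
    (hd : (1 <= d)%N)
    (f_neq0 : f != 0)
    (f_form : f \is (d.+1).-homog)
    (f_reduced : reduced f)
    (hchar : forall p, p \in [pchar k] -> ~~ (p %| d.+1)%N)
    (eps : syz f)
    (he : (1 <= e)%N)
    (eps_deg : grad_syz e%:Z eps)
    (eps_min : minimal_hom_generator (@grad_syz k f) eps) :
  let s : int := e%:Z - d%:Z in
  let D : int := d%:Z ^+ 2 + e%:Z * s in
  (* (a) *)
  ((free_module (Meps eps) <-> free_divisor f) /\
   (free_divisor f ->
      exists2 m : nat, has_mult (gradient_ideal f) m & m%:Z = D)) /\
  (* (b) *)
  (~ free_divisor f ->
   (exists (I : idealr {mpoly k[3]}) (theta : {linear Meps eps -> {mpoly k[3]}^o}),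
      codim2_ideal_model s I theta) /\
   (forall (I : idealr {mpoly k[3]}) (theta : {linear Meps eps -> {mpoly k[3]}^o}),
      codim2_ideal_model s I theta ->
      (singular_curve f -> exists m mJ : nat,
         [/\ has_mult I m, has_mult (gradient_ideal f) mJ
           & m%:Z = D - mJ%:Z]) /\
      (~ singular_curve f -> exists2 m : nat, has_mult I m & m%:Z = D))) /\
  (* (c) *)
  (~ free_divisor f ->
   (forall m (g : 'I_m -> syz f) (a : 'rV[int]_m),
      minimal_hom_generators (@grad_syz k f) (cons_fam eps g) ->
      (forall i, grad_syz (a 0 i) (g i)) ->
      let is_res n (b : 'rV[int]_n) lambda psi :=
        minimal_free_res (@grad_syz k f) predT b
          (row_mx (const_mx e%:Z : 'rV_1) a) (row_mx lambda psi)
          (cons_fam eps g) in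
      (exists n (b : 'rV[int]_n) lambda psi, is_res n b lambda psi) /\
      (forall n (b : 'rV[int]_n) (lambda : 'cV[{mpoly k[3]}]_n)
              (psi : 'M[{mpoly k[3]}]_(n, m)),
         is_res n b lambda psi ->
         forall (I : idealr {mpoly k[3]})
                (theta : {linear Meps eps -> {mpoly k[3]}^o}),
         codim2_ideal_model s I theta ->
         minimal_free_res (V := {mpoly k[3]}^o) (@grad_poly k) I
           (b - const_mx (d%:Z - e%:Z)) (a - const_mx (d%:Z - e%:Z)) psi
           (fun i => theta (ueps eps (g i))))) /\
   (forall (I : idealr {mpoly k[3]}) (theta : {linear Meps eps -> {mpoly k[3]}^o}),
      codim2_ideal_model s I theta -> has_codim I 2 /\ perfect_ideal I)).
Proof.
move=> s D.
have phi_cop := gradient_coprime f_neq0 f_form f_reduced hchar.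
have char_d : (d.+1%:R : k) != 0.
  apply/negP => z; have [p pP] := natf0_pchar (ltn0Sn d) z.
  by have := hchar p pP; rewrite (dvdn_pcharf pP) z.
have eps_cop := minimal_generator_coprime eps_deg eps_min.
have [rho rhoE] := rho_exists eps phi_cop.
have [m0 [g0 gmin0]] := minimal_generators_cons eps_min.
have freeP := free_divisor_iff f_form phi_cop eps_cop rhoE gmin0.
have MfreeP := free_Meps_iff f_form phi_cop eps_cop rhoE.
have [cJ [cI [[cD cI0 cIpos multI multJ] singP]]] :=
  multiplicities f_form phi_cop eps_deg eps_cop rhoE gmin0 char_d.
rewrite -/s -/D in cD.
split; last split.
- split=> [|/freeP x1]; first by rewrite MfreeP freeP.
  have cJD : cJ%:Z = D by rewrite -cD (cI0 x1) addr0.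
  (* [D] is d^2 - de + e^2, which is positive because d is. *)
  exists cJ => //; apply: multJ; move: cJD hd; rewrite /D /s expr2; nia.
- move=> nfree; have no1 : ~ exists x, rho x = 1 by move/freeP.
  have [mI [v [v0 vI]]] := multI (cIpos no1); split.
    exact: (model_exists f_form phi_cop eps_deg eps_cop rhoE v0 vI no1).
  move=> I theta md.
  have mI' : has_mult I cI.
    apply: has_mult_ext mI => p; symmetry.
    exact: (model_image f_form phi_cop eps_deg eps_cop rhoE md).
  split=> [/singP/multJ mJ|nsing].
    by exists cI, cJ; split=> //; apply/eqP; rewrite eq_sym subr_eq addrC cD.
  by exists cI => //; rewrite -cD; case: (posnP cJ) => [->|/singP//]; rewrite add0r.
move=> nfree; have no1 : ~ exists x, rho x = 1 by move/freeP.
split=> [m g a gmin ga is_res|I theta md].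
  split; first exact: (resolution_exists eps_deg gmin ga).
  move=> n b lambda psi res I theta md.
  exact: (model_resolution phi_cop eps_cop rhoE res md).
have [a' ga'] := minimal_degrees gmin0.
split; first by case: md.
have ga0 i : grad_syz ((\row_j a' 0 (rshift 1 j)) 0 i) (g0 i).
  by rewrite mxE -(cons_famS eps g0); apply: ga'.
exact: (model_perfect f_form phi_cop eps_deg eps_cop rhoE gmin0 ga0 no1 md).
Qed.
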